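(* Consider the Gaussian graphical model: $n$ i.i.d. samples from $(X_1,\dots,X_p)\sim N(0,\Sigma)$, with $\Sigma_{jj}=1$ for all $j$, where $n\le p<e^{n/(4C_2^2)}$ and $C_2>4\sqrt{5/3}$. For each node $i$ write $X_i=\sum_{j\ne i}\beta^i_jX_j+V_i$ for the regression of $X_i$ on the other variables, and $\sigma_i^2=\mathrm{Var}(V_i)$. Let $1<s<p/2$ be an integer such that every node has at most $s$ neighbours in the conditional independence graph. Set $K=\sqrt2\,K(s,s,3,\Sigma)$, $c_0=\sqrt{3/2}$ and $\lambda^{i}_{\mathrm{init}}=\sqrt{24}\,c_0\sigma_i\sqrt{\log p/n}$. Assume: (a) $\Sigma$ satisfies $\frac{1}{K(s,s,3,\Sigma)}>0$, and $\Lambda_{\min}(\Sigma_{JJ})\ge\frac{17}{16}\Lambda_{\min}(s)>0$ for every $J\subset\{1,\dots,p\}$ with $|J|\le s$. (b) For some $0<\eta<1$ and some constant $M$, for every node $i$: $$\frac{4K}{\eta}\le M\le\frac{\sqrt{\Lambda_{\min}(s)}}{(1-\eta)c_0\sigma_i}\sqrt{\frac{n}{2\log p}},$$ $$s\le\frac{1}{32K^2(s,s,3,\Sigma)}\min\left\{\frac1{C_2},\frac{\sqrt{\Lambda_{\min}(s)}(1-\eta)}{6\sqrt6\,\sigma_i}\right\}\sqrt{\frac{n}{\log p}},$$ and for all $j\neq i$ with $\beta^i_j\ne0$, $$|\beta^i_j|>\max\left\{\frac{2\sqrt s}{(1-\eta)\sqrt{\Lambda_{\min}(s)}},\frac{M}{\sqrt3}\right\}16K^2\lambda^i_{\mathrm{init}}\sqrt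 s.$$ (c) For every $i$, $\hat\beta^i$ is the adaptive Lasso estimator for the regression of $X_i$ on $\{X_j:j\neq i\}$, whose penalty level $\lambda^i_n$ satisfies, on $\mathcal{X}\cap\mathcal{T}_i$, $$16MK\ \ge\ \frac{\lambda^i_n}{c_0\sigma_i\lambda^i_{\mathrm{init}}\sqrt{\bar s_i}}\sqrt{\frac{n}{2\log(p-s)}}\ \ge\ \frac{64K^2}{\eta},\qquad \bar s_i=|\{j\ne i:|\beta^i_{j,\mathrm{init}}|>4\lambda^i_{\mathrm{init}}\}|.$$ Let the edge set be estimated by either of the rules: $i$ and $j$ are joined iff $\hat\beta^i_j\ne0$ and $\hat\beta^j_i\neq0$; or: iff $\hat\beta^i_j\ne0$ or $\hat\beta^j_i\ne0$; and let $\mathrm{supp}(\hat\Sigma_n^{-1})$ denote the resulting estimated off-diagonal support of the concentration matrix. Then $$\mathbb{P}\left(\mathrm{supp}(\hat\Sigma_n^{-1})=\mathrm{supp}(\Sigma^{-1})\right)\ge1-3/p .$$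
   Context: The conditional independence graph has nodes $\{1,\dots,p\}$ and an undirected edge between $i\neq j$ iff $\Sigma^{-1}_{ij}\ne0$; equivalently $\beta^i_j=-\Sigma^{-1}_{ij}/\Sigma^{-1}_{ii}\neq0$. The residual $V_i$ is a mean-zero Gaussian. Let $\mathbf{X}$ be the $n\times p$ data matrix with i.i.d. rows $N(0,\Sigma)$, with columns $\mathbf{X}_j$, let $\mathbf{X}_{-i}$ be $\mathbf{X}$ with the $i$-th column removed, and $\mathbf{V}_i=\mathbf{X}_i-\sum_{j\ne i}\beta^i_j\mathbf{X}_j$. Adaptive Lasso for node $i$: $\beta^i_{\mathrm{init}}=\arg\min_b\frac1{2n}\|\mathbf{X}_i-\mathbf{X}_{-i}b\|_2^2+\lambda^i_{\mathrm{init}}\|b\|_1$, $w^i_j=\max\{1/|\beta^i_{j,\mathrm{init}}|,1\}$ (if $\beta^i_{j,\mathrm{init}}=0$, then $w_j^i=\infty$, i.e. coordinate $j$ is constrained to be $0$), and $\hat\beta^i=\arg\min_b\frac1{2n}\|\mathbf{X}_i-\mathbf{X}_{-i}b\|_2^2+\lambda^i_n\sum_{j\ne i}w^i_j|b_j|$. $\mathcal{X}:=\left\{\max_{j,k}|\Delta_{jk}|<C_2\sqrt{\log p/n}\right\}$, $\Delta=\mathbf{X}^T\mathbf{X}/n-\Sigma$; $\mathcal{T}_i:=\left\{\|\mathbf{X}_{-i}^T\mathbf{V}_i/n\|_\infty\le c_0\sigma_i\sqrt{6\log p/n}\right\}$ ($\|\cdot\|_\infty$ = maximum absolute entry). $\Lambda_{\min}(A)$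 of a symmetric matrix is its smallest eigenvalue, $\Sigma_{JJ}$ is the submatrix with rows and columns in $J$, and $\Lambda_{\min}(s):=\frac{16}{17}\min_{|J_0|\le s}\ \min_{\gamma\ne0,\ \gamma_{J_0^c}=0}\frac{\gamma^T\Sigma\gamma}{\|\gamma_{J_0}\|_2^2}$. $\frac{1}{K(s,s,3,\Sigma)}:=\min_{J_0\subseteq\{1,\dots,p\},|J_0|\le s}\ \min_{\gamma\neq0,\ \|\gamma_{J_0^c}\|_1\le3\|\gamma_{J_0}\|_1}\frac{\|\Sigma^{1/2}\gamma\|_2}{\|\gamma_{J_{0s}}\|_2}$, where $J_{0s}=J_0\cup J_s$ and $J_s$ is the set of the $s$ coordinates of $\gamma$ outside $J_0$ that are largest in absolute value. *)

(* Defs.v *)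
From HB Require Import structures.
From mathcomp Require Import all_boot all_order all_algebra.
From mathcomp Require Import all_classical all_reals all_analysis.
Set Implicit Arguments.
Unset Strict Implicit.
Unset Printing Implicit Defensive.
Import Order.TTheory GRing.Theory Num.Theory.
Import numFieldNormedType.Exports.

Local Open Scope classical_set_scope.
Local Open Scope ring_scope.

Definition norm1 (R : realType) (m : nat) (J : {set 'I_m}) (v : 'cV[R]_m) : R :=
  \sum_(j in J) `|v j 0|.

Definition norm2 (R : realType) (m : nat) (J : {set 'I_m}) (v : 'cV[R]_m) : R :=
  Num.sqrt (\sum_(j in J) v j 0 ^+ 2).

Definition quad (R : realType) (p : nat) (A : 'M[R]_p) (v : 'cV[R]_p) : R :=
  (v^T *m A *m v) 0 0.

Definition psdmx (R : realType) (p : nat) (A : 'M[R]_p) : Prop :=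
  A^T = A /\ forall v : 'cV[R]_p, 0 <= quad A v.

(* The unique positive semidefinite square root, when A is psd; 0 otherwise. *)
Definition sqrtmx (R : realType) (p : nat) (A : 'M[R]_p) : 'M[R]_p :=
  xget 0 [set B : 'M[R]_p | psdmx B /\ B *m B = A].

Definition principal_submx (R : realType) (p : nat) (A : 'M[R]_p)
    (J : {set 'I_p}) : 'M[R]_#|J| :=
  mxsub (@enum_val _ (mem J)) (@enum_val _ (mem J)) A.

(* For a symmetric matrix of positive size the set of eigenvalues is finite
   and nonempty, so that this is the smallest one. *)
Definition lambda_min (R : realType) (m : nat) (A : 'M[R]_m) : R :=
  inf [set a : R | eigenvalue A a].

(* The double minimum is the infimum over all admissible pairs (J0, g); J0 = set0
   admits no g. *)
Definition Lambda_min (R : realType) (p : nat) (Sigma : 'M[R]_p) (s : nat) : R :=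
  16 / 17 * inf [set r : R | exists (J0 : {set 'I_p}) (g : 'cV[R]_p),
    [/\ (#|J0| <= s)%N, g != 0, (forall j, j \notin J0 -> g j 0 = 0) &
        r = quad Sigma g / norm2 J0 g ^+ 2]].

(* J is a set of m coordinates of g outside J0 that are largest in absolute
   value.  Ties may be broken arbitrarily: norm2 (J0 :|: J) g does not depend on
   the choice. *)
Definition largest_outside (R : realType) (p : nat) (J0 : {set 'I_p}) (m : nat)
    (g : 'cV[R]_p) (J : {set 'I_p}) : Prop :=
  [/\ J \subset ~: J0, #|J| = m &
      forall j k, j \in J -> k \notin J0 :|: J -> `|g k 0| <= `|g j 0|].

(* The restricted eigenvalue 1 / K(s, m, c, Sigma). *)
Definition re_inv (R : realType) (s m : nat) (c : R) (p : nat)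
    (Sigma : 'M[R]_p) : R :=
  inf [set r : R | exists (J0 : {set 'I_p}) (g : 'cV[R]_p) (J : {set 'I_p}),
    [/\ (#|J0| <= s)%N, g != 0,
        norm1 (~: J0) g <= c * norm1 J0 g,
        largest_outside J0 m g J &
        r = norm2 [set: 'I_p] (sqrtmx Sigma *m g) / norm2 (J0 :|: J) g]].

Definition re_K (R : realType) (s m : nat) (c : R) (p : nat)
    (Sigma : 'M[R]_p) : R := (re_inv s m c Sigma)^-1.

(* Y ~ N(0, Sigma): every linear combination a^T Y is N(0, a^T Sigma a), the
   latter being the Dirac mass at 0 when the variance vanishes (the library's
   normal_prob is not Gaussian for a zero standard deviation). *)
Definition gaussian_vector (d : measure_display) (T : measurableType d)
    (R : realType) (P : probability T R) (p : nat)
    (Y : 'I_p -> {RV P >-> R}) (Sigma : 'M[R]_p) : Prop :=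
  forall (a : 'cV[R]_p) (A : set R), measurable A ->
    P ((fun w => \sum_j a j 0 * Y j w) @^-1` A) =
    if quad Sigma a == 0 then \d_(0 : R) A
    else normal_prob 0 (Num.sqrt (quad Sigma a)) A.

(* Mutual independence of the sigma-algebras generated by the rows; subfamilies
   are covered by taking E k = setT. *)
Definition independent_rows (d : measure_display) (T : measurableType d)
    (R : realType) (P : probability T R) (n p : nat)
    (X : 'I_n -> 'I_p -> {RV P >-> R}) : Prop :=
  forall E : 'I_n -> set T,
    (forall k, g_sigma_preimage (fun j (w : T) => X k j w) (E k)) ->
    P (\bigcap_(k in [set: 'I_n]) E k) = (\prod_(k < n) P (E k))%E.

Definition data_mx (d : measure_display) (T : measurableType d)
    (R : realType) (P : probability T R) (n p : nat)
    (X : 'I_n -> 'I_p -> {RV P >-> R}) (w : T) : 'M[R]_(n, p) :=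
  \matrix_(k, j) X k j w.

(* beta^i_j for j != i. *)
Definition reg_coef (R : realType) (p : nat) (Sigma : 'M[R]_p) (i j : 'I_p) : R :=
  - (invmx Sigma i j / invmx Sigma i i).

Definition residual (R : realType) (n p : nat) (Sigma : 'M[R]_p)
    (D : 'M[R]_(n, p)) (i : 'I_p) : 'cV[R]_n :=
  col i D - \sum_(j | j != i) reg_coef Sigma i j *: col j D.

Definition neighbours (R : realType) (p : nat) (Sigma : 'M[R]_p) (i : 'I_p) :
    {set 'I_p} := [set j | (j != i) && (invmx Sigma i j != 0)].

Definition c0 (R : realType) : R := Num.sqrt (3 / 2).

Definition lambda_init (R : realType) (n p : nat) (sigma : R) : R :=
  Num.sqrt 24 * c0 R * sigma * Num.sqrt (ln p%:R / n%:R).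

Definition is_argmin (R : realType) (V : Type) (dom : set V) (F : V -> R)
    (b : V) : Prop := dom b /\ forall b', dom b' -> F b <= F b'.

(* A coefficient vector for the regression of column i on the other columns,
   indexed by the j != i, is encoded as b : 'cV_p with b i 0 = 0; then
   X_{-i} b is D *m b. *)
Definition quad_loss (R : realType) (n p : nat) (D : 'M[R]_(n, p)) (i : 'I_p)
    (b : 'cV[R]_p) : R :=
  norm2 [set: 'I_n] (col i D - D *m b) ^+ 2 / (2 * n%:R).

Definition is_lasso (R : realType) (n p : nat) (D : 'M[R]_(n, p)) (i : 'I_p)
    (lam : R) (b : 'cV[R]_p) : Prop :=
  is_argmin [set b' : 'cV[R]_p | b' i 0 = 0]
    (fun b' => quad_loss D i b' + lam * norm1 [set: 'I_p] b') b.

Definition ada_weight (R : realType) (p : nat) (binit : 'cV[R]_p) (j : 'I_p) : R :=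
  Num.max (`|binit j 0|^-1) 1.

(* An infinite weight (binit j 0 = 0) is the constraint b j 0 = 0; the value of
   ada_weight at such a j is then irrelevant. *)
Definition is_adaptive_lasso (R : realType) (n p : nat) (D : 'M[R]_(n, p))
    (i : 'I_p) (binit : 'cV[R]_p) (lam : R) (b : 'cV[R]_p) : Prop :=
  is_argmin [set b' : 'cV[R]_p | b' i 0 = 0 /\
                forall j, j != i -> binit j 0 = 0 -> b' j 0 = 0]
    (fun b' => quad_loss D i b' +
               lam * \sum_(j | j != i) ada_weight binit j * `|b' j 0|) b.

(* The event calX, as a condition on the data matrix. *)
Definition gram_close (R : realType) (n p : nat) (C2 : R) (Sigma : 'M[R]_p)
    (D : 'M[R]_(n, p)) : Prop :=
  forall j k, `|(n%:R^-1 *: (D^T *m D) - Sigma) j k|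
              < C2 * Num.sqrt (ln p%:R / n%:R).

(* The event calT_i, as a condition on the data matrix. *)
Definition noise_small (R : realType) (n p : nat) (Sigma : 'M[R]_p) (sigma : R)
    (i : 'I_p) (D : 'M[R]_(n, p)) : Prop :=
  forall j, j != i ->
    `|(n%:R^-1 *: (D^T *m residual Sigma D i)) j 0|
    <= c0 R * sigma * Num.sqrt (6 * ln p%:R / n%:R).

Definition sbar (R : realType) (p : nat) (i : 'I_p) (lam_init : R)
    (binit : 'cV[R]_p) : nat :=
  #|[pred j | (j != i) && (4 * lam_init < `|binit j 0|)]|.

Definition concentration_supp (R : realType) (p : nat) (Sigma : 'M[R]_p) :
    {set 'I_p * 'I_p} :=
  [set e | (e.1 != e.2) && (invmx Sigma e.1 e.2 != 0)].

Variant edge_rule := AndRule | OrRule.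

Definition estimated_supp (R : realType) (p : nat) (rule : edge_rule)
    (bhat : 'I_p -> 'cV[R]_p) : {set 'I_p * 'I_p} :=
  [set e | (e.1 != e.2) &&
    (if rule is AndRule
     then (bhat e.1 e.2 0 != 0) && (bhat e.2 e.1 0 != 0)
     else (bhat e.1 e.2 0 != 0) || (bhat e.2 e.1 0 != 0))].

(* Main.v *)
Require Import Defs.
From HB Require Import structures.
From mathcomp Require Import all_boot all_order all_algebra.
From mathcomp Require Import all_classical all_reals all_analysis.
From mathcomp Require Import measurable_realfun ring lra zify.
Set Implicit Arguments.
Unset Strict Implicit.
Unset Printing Implicit Defensive.
Import Order.TTheory GRing.Theory Num.Theory.
Import numFieldNormedType.Exports.

Local Open Scope classical_set_scope.
Local Open Scope ring_scope.

(** The theorem splits into an event of probability at least 1 - 3/p and a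
    statement about each node that holds surely on this event.  Write S for the
    set of neighbours of the node i, beta for its population coefficients,
    r = sqrt (log p / n), A for the matrix X^T X / n and g for X^T V_i / n; then
    lambda_init = 6 sigma_i r, and C2 r < 1/2 by the bound on p.

    The event.  It asks for four families of empirical covariances to be close
    to their expectations: the entries of A within C2 r (the event calX), the
    entries of g within 3 sigma_i r (the events calT_i), and two families that
    replace the usual conditioning on the neighbours.  For j outside S and
    different from i let rho_ij = X_j - theta_ij^T X be the residual of the
    population regression of X_j on the variables of S, where theta_ij is a fixed
    vector supported in S.  As rho_ij is uncorrelated with V_i and with every X_k,
    k in S, the empirical covariance of rho_ij with V_i is at most 5 sigma_i r
    and its empirical covariances with the X_k are at most C2 r.  Each of these
    bounds fails with probability at most 2 p^-4, there are at most 3 p^2 + p^3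
    of them, and p >= 16.  The failure probability comes from the Chernoff bound
    ([chernoff_indep]); only the calT_i, where the constant 3 leaves no room,
    need a precise moment generating function for the product of two
    uncorrelated Gaussians ([pair_product_mgf]).  Elsewhere a convexity argument
    suffices ([unit_product_mgf]).

    One node.  On the event the Lasso error lies in the cone of the restricted
    eigenvalue condition, which bounds it coordinatewise by
    3 K^2 lambda_init sqrt |S| and bounds its l1 norm off S ([lasso_error]).  The
    initial estimator is thus large on S and small off S: the adaptive weights
    are bounded on S, they are at least 1 / (3 K^2 lambda_init sqrt |S|) off S,
    and |S| <= sbar <= (1 + 9/16 K^2) |S| turns the assumption on the penalty
    level lambda_n into explicit bounds ([penalty_level_bounds]).  Next, comparing
    the adaptive estimator with its A-orthogonal correction that moves the mass
    lying off S onto S removes this mass, because for every j off S the weight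
    exceeds the projected noise plus the weights of the projection
    ([adaptive_vanishes_off_support]).  The sample projection is close enough to
    the fixed theta_ij for the bound on rho_ij to control the projected noise.
    Finally the estimator restricted to S has an l2 error smaller than the
    smallest nonzero |beta_j| ([adaptive_l2_error]), so no neighbour is missed
    ([adaptive_recovery]).  An isolated node is simpler: the cone condition makes
    the initial Lasso vanish, and with it the adaptive Lasso.

    Every node recovers its neighbourhood on the same event, so both rules for
    combining the neighbourhoods return the support of the concentration
    matrix. *)

(** * Exponential moments of the standard normal law *)

Section weighted_image.
Import HBNNSimple.

(** A change of variables with a density: the formula on indicators determines
    the pushforward of the measure with density G, and passes to nonnegative
    functions by simple approximation.  It serves for densities against Lebesgue
    measure, for laws of linear combinations, and, with G the product of the
    other factors, for splitting off an independent factor. *)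
Lemma integral_comp_weight d1 d2 (X : measurableType d1) (Y : measurableType d2)
    (R : realType) (mu : {measure set X -> \bar R})
    (nu : {measure set Y -> \bar R}) (psi : X -> Y) (G : X -> R) (c : R)
    (f : Y -> R) :
  measurable_fun setT psi -> measurable_fun setT G -> (forall x, 0 <= G x) ->
  0 <= c ->
  (forall B, measurable B ->
     (\int[mu]_x (\1_(psi @^-1` B) x * G x)%:E = c%:E * nu B)%E) ->
  measurable_fun setT f -> (forall y, 0 <= f y) ->
  (\int[mu]_x (f (psi x) * G x)%:E = c%:E * \int[nu]_y (f y)%:E)%E.
Proof.
move=> mpsi mG G0 c0 HB mf f0.
have mEf : measurable_fun [set: Y] (fun y => (f y)%:E) by exact/measurable_EFinP.
pose h := nnsfun_approx measurableT mEf.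
have cvgh y : (EFin \o h n) y @[n --> \oo] --> (f y)%:E.
  by apply: (cvg_nnsfun_approx (D := setT)) => // z _; rewrite lee_fin.
have ndh y : nondecreasing_seq (fun n => h n y).
  by move=> a b ab; exact/lefP/nd_nnsfun_approx.
have -> : (\int[nu]_y (f y)%:E = limn (fun n => \int[nu]_y (h n y)%:E))%E.
  rewrite -monotone_convergence//.
  - by apply: eq_integral => y _; apply/esym/cvg_lim => //; exact: cvgh.
  - by move=> n; apply/measurable_EFinP.
  - by move=> n y _; rewrite lee_fin.
  - by move=> y _ a b ab; rewrite lee_fin; exact: ndh.
have step n : (\int[mu]_x (h n (psi x) * G x)%:E = c%:E * \int[nu]_y (h n y)%:E)%E.
  transitivity (\sum_(r \in range (h n)) \int[mu]_x (r * (\1_(psi @^-1` (h n @^-1` [set r])) x * G x))%:E)%E.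
    rewrite -ge0_integral_fsum//.
    - apply: eq_integral => x _; rewrite fimfunE fsumEFin//; congr (_%:E).
      rewrite mulrC -[LHS]/(G x * _) mulr_fsumr//.
      by apply: eq_fsbigr => r _; rewrite mulrCA (mulrC (G x)).
    - move=> r; apply/measurable_EFinP; apply: measurable_funM => //.
      apply: measurable_funM => //; apply: measurable_indic.
      by rewrite -[X in measurable X]setTI; apply: mpsi => //.
    - move=> r x _; rewrite lee_fin mulrA mulr_ge0//.
      exact: (nnfun_muleindic_ge0 (h n) r (psi x)).
  transitivity (\sum_(r \in range (h n)) c%:E * (r%:E * nu (h n @^-1` [set r])))%E.
    apply: eq_fsbigr => r; rewrite inE => -[t _ <-].
    under eq_integral do rewrite EFinM.
    rewrite ge0_integralZl//.
    - by rewrite HB// muleCA.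
    - apply/measurable_EFinP; apply: measurable_funM => //; apply: measurable_indic.
      by rewrite -[X in measurable X]setTI; apply: mpsi => //.
    - by move=> x _; rewrite lee_fin mulr_ge0.
    - by rewrite lee_fin.
  rewrite -ge0_mule_fsumr.
    congr (_ * _)%E.
    under eq_integral do rewrite fimfunE -fsumEFin//.
    rewrite ge0_integral_fsum//.
    - apply: eq_fsbigr => r; rewrite inE => rh.
      by rewrite integralZl_indic_nnsfun// integral_indic// setIT.
    - by move=> r; apply/measurable_EFinP; exact: measurable_funM.
    - by move=> r y _; rewrite EFinM nnfun_muleindic_ge0.
  move=> r; have [->|/set0P[t /= ht]] := eqVneq (h n @^-1` [set r]) set0.
    by rewrite measure0 mule0.
  by rewrite mule_ge0// lee_fin -ht.
have -> : (\int[mu]_x (f (psi x) * G x)%:E = limn (fun n => \int[mu]_x (h n (psi x) * G x)%:E))%E.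
  rewrite -monotone_convergence//.
  - apply: eq_integral => x _; apply/esym/cvg_lim => //.
    under eq_fun do rewrite EFinM.
    by rewrite EFinM; apply: cvgeZr => //; exact: cvgh.
  - move=> n; apply/measurable_EFinP; apply: measurable_funM => //.
    exact: measurableT_comp.
  - by move=> n x _; rewrite lee_fin mulr_ge0.
  - by move=> x _ a b ab; rewrite lee_fin ler_wpM2r//; exact: ndh.
under eq_fun do rewrite step.
apply/cvg_lim => //; apply: cvgeZl => //.
apply: ereal_nondecreasing_is_cvgn => a b ab.
apply: ge0_le_integral => //.
- by move=> y _; rewrite lee_fin.
- exact/measurable_EFinP.
- exact/measurable_EFinP.
- by move=> y _; rewrite lee_fin; exact: ndh.
Qed.

End weighted_image.

Lemma integral_normal_prob (R : realType) (s : R) (f : R -> R) :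
  measurable_fun setT f -> (forall x, 0 <= f x) ->
  (\int[normal_prob 0 s]_x (f x)%:E =
   \int[lebesgue_measure]_x (f x * normal_pdf 0 s x)%:E)%E.
Proof.
move=> mf f0.
apply/esym; rewrite -[RHS]mul1e.
apply: (@integral_comp_weight _ _ _ _ R lebesgue_measure (normal_prob 0 s)
  (@idfun (measurableTypeR R)) (normal_pdf 0 s) 1 f) => //.
- exact: measurable_id.
- exact: measurable_normal_pdf.
- by move=> x; exact: normal_pdf_ge0.
- move=> B mB; rewrite mul1e /normal_prob [RHS]integral_mkcond.
  apply: eq_integral => x _; rewrite patchE indicE.
  rewrite (_ : idfun @^-1` B = B)//.
  by case: (x \in B); rewrite ?mul1r ?mul0r.
Qed.

(** The exponent is written (1 - z^-2) / 2 because multiplying by the standard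
    density then gives z times the centred density with standard deviation z. *)
Lemma gauss_exp_sqr (R : realType) (z : R) : 0 < z ->
  (\int[normal_prob 0 1]_x (expR ((1 - z ^- 2) / 2 * x ^+ 2))%:E = z%:E)%E.
Proof.
move=> z0.
have me : measurable_fun [set: R] (fun x : R => expR ((1 - z ^- 2) / 2 * x ^+ 2)).
  by apply: measurableT_comp => //; apply: measurable_funM => //; exact: measurable_funX.
rewrite integral_normal_prob//.
transitivity (\int[lebesgue_measure]_x (z%:E * (normal_pdf 0 z x)%:E))%E.
  apply: eq_integral => x _; rewrite -EFinM; congr (_%:E).
  rewrite !normal_pdfE ?oner_neq0 ?gt_eqF// /normal_peak /normal_fun.
  rewrite mulrCA -expRD [RHS]mulrA; congr (_ * expR _).
    rewrite expr1n mul1r -!mulrnAr sqrtrM ?sqr_ge0// sqrtr_sqr gtr0_norm//.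
    by rewrite invfM mulrA divff ?gt_eqF// mul1r.
  rewrite !subr0 -mulr_natr expr1n -[z ^+ 2 *+ 2]mulr_natr; field.
  by rewrite gt_eqF.
rewrite ge0_integralZl//.
- by rewrite integral_normal_pdf mule1.
- by apply/measurable_EFinP; exact: measurable_normal_pdf.
- by move=> x _; rewrite lee_fin normal_pdf_ge0.
- by rewrite lee_fin ltW.
Qed.

Lemma gauss_exp_sqr_lt (R : realType) (phi : R) : phi < 1 / 2 ->
  (\int[normal_prob 0 1]_x (expR (phi * x ^+ 2))%:E
   = ((Num.sqrt (1 - 2 * phi))^-1)%:E)%E.
Proof.
move=> h; have u0 : 0 < 1 - 2 * phi by lra.
have z0 : 0 < (Num.sqrt (1 - 2 * phi))^-1 by rewrite invr_gt0 sqrtr_gt0.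
have phiE : phi = (1 - (Num.sqrt (1 - 2 * phi))^-1 ^- 2) / 2.
  by rewrite exprVn invrK sqr_sqrtr ?(ltW u0)//; field.
rewrite -[RHS](gauss_exp_sqr z0); apply: eq_integral => x _.
by rewrite [in LHS]phiE.
Qed.

(** Formally this is the k-th derivative of [gauss_exp_sqr] in the parameter
    t = (1 - z^-2) / 2.  Differentiation under the integral sign is avoided by
    convexity: the tangent line of t |-> x^2k exp (t x^2) lies below the graph, so
    after integration the induction hypothesis says that
    y |-> (2k-1)!! y^(2k+1) + I y^-2 / 2 is minimal at y = z, where I is the unknown
    integral; its derivative vanishes there, which gives I. *)
Lemma gauss_moment_exp (R : realType) (k : nat) (z : R) : 0 < z ->
  (\int[normal_prob 0 1]_x (x ^+ k.*2 * expR ((1 - z ^- 2) / 2 * x ^+ 2))%:E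
   = ((\prod_(i < k) (i.*2.+1)%:R) * z ^+ k.*2.+1)%:E)%E.
Proof.
elim: k z => [|k IHk] z z0.
  rewrite big_ord0 mul1r expr1 -(gauss_exp_sqr z0); apply: eq_integral => x _.
  by rewrite expr0 mul1r.
pose dk : R := \prod_(i < k) (i.*2.+1)%:R.
pose h (m : nat) (y x : R) := x ^+ m.*2 * expR ((1 - y ^- 2) / 2 * x ^+ 2).
have evenge0 (m : nat) (x : R) : 0 <= x ^+ m.*2 by rewrite -mul2n exprM exprn_ge0 ?sqr_ge0.
have h0 m y x : 0 <= h m y x by rewrite mulr_ge0 ?expR_ge0.
have mh m y : measurable_fun [set: R] (fun x => (h m y x)%:E).
  apply/measurable_EFinP; apply: measurable_funM; first exact: measurable_funX.
  by apply: measurableT_comp => //; apply: measurable_funM => //; exact: measurable_funX.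
pose I := (\int[normal_prob 0 1]_x (h k.+1 z x)%:E)%E.
have I0 : (0 <= I)%E by apply: integral_ge0 => x _; rewrite lee_fin.
(* tangent line at z of the convex function t |-> x^2k exp (t x^2) *)
have tan (y x : R) : 0 < y ->
    h k z x + (z ^- 2 - y ^- 2) / 2 * h k.+1 z x <= h k y x.
  move=> y0; rewrite /h.
  have -> : x ^+ k.+1.*2 = x ^+ k.*2 * x ^+ 2 by rewrite doubleS -exprD addn2.
  set a := x ^+ k.*2; set e := (1 - z ^- 2) / 2 * _.
  have -> : (1 - y ^- 2) / 2 * x ^+ 2 = e + (z ^- 2 - y ^- 2) / 2 * x ^+ 2.
    by rewrite /e; ring.
  rewrite expRD.
  have := expR_ge1Dx ((z ^- 2 - y ^- 2) / 2 * x ^+ 2).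
  move=> /(ler_wpM2l (mulr_ge0 (evenge0 k x) (expR_ge0 e))); rewrite -/a.
  by move/(le_trans _); rewrite mulrA; apply; rewrite -subr_ge0 le_eqVlt; apply/orP; left; apply/eqP; ring.
have hD y (c : R) : 0 <= c ->
    (\int[normal_prob 0 1]_x (h k y x)%:E + c%:E * I =
     \int[normal_prob 0 1]_x (h k y x + c * h k.+1 z x)%:E)%E.
  move=> c0; rewrite /I -ge0_integralZl//; first rewrite -ge0_integralD//.
  all: try solve [exact: mh|exact: (measurable_funeM _ (mh k.+1 z))
             |by move=> x _; rewrite ?mule_ge0 ?lee_fin ?h0].
have mhD y (c : R) : measurable_fun [set: R] (fun x => (h k y x + c * h k.+1 z x)%:E).
  apply/measurable_EFinP; apply: measurable_funD.
    by apply/measurable_EFinP; exact: (mh k y).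
  by apply: measurable_funM => //; apply/measurable_EFinP; exact: (mh k.+1 z).
have coef (x y : R) : 0 < x -> x <= y -> 0 <= (x ^- 2 - y ^- 2) / 2.
  move=> x0 xy; have y0 := lt_le_trans x0 xy.
  by rewrite divr_ge0// subr_ge0 lef_pV2 ?posrE ?exprn_gt0// ler_pXn2r ?nnegrE ?(ltW x0) ?(ltW y0).
have intle (y : R) : z <= y ->
    ((dk * z ^+ k.*2.+1)%:E + ((z ^- 2 - y ^- 2) / 2)%:E * I <= (dk * y ^+ k.*2.+1)%:E)%E.
  move=> zy; have y0 := lt_le_trans z0 zy.
  rewrite -(IHk z z0) -(IHk y y0) hD; last exact: coef.
  apply: ge0_le_integral => //.
  all: try solve [exact: mh|exact: mhD|by move=> x _; rewrite lee_fin tan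
             |by move=> x _; rewrite lee_fin addr_ge0// mulr_ge0// coef].
have intge (y : R) : 0 < y -> y <= z ->
    ((dk * z ^+ k.*2.+1)%:E <= (dk * y ^+ k.*2.+1)%:E + ((y ^- 2 - z ^- 2) / 2)%:E * I)%E.
  move=> y0 yz.
  rewrite -(IHk z z0) -(IHk y y0) hD; last exact: coef.
  apply: ge0_le_integral => //.
  all: try solve [exact: mh|exact: mhD|by move=> x _; rewrite lee_fin h0].
  move=> x _; rewrite lee_fin -[_ * expR _]/(h k z x).
  by rewrite -(opprB (z ^- 2) (y ^- 2)) !mulNr lerBrDr tan.
(* an infinite I would contradict the finiteness of the left side of intle *)
have Ifin : I \is a fin_num.
  rewrite ge0_fin_numE// ltNge leye_eq; apply/negP => /eqP Iy.
  have zy : z <= z + 1 by rewrite lerDl.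
  have := intle _ zy; rewrite Iy gt0_muley ?addey ?leye_eq//.
  have y1 : 0 < z + 1 by rewrite addr_gt0.
  rewrite lte_fin divr_gt0// subr_gt0 ltf_pV2 ?posrE ?exprn_gt0//.
  by rewrite ltr_pXn2r ?nnegrE ?(ltW y1) ?(ltW z0)// ltrDl.
rewrite -/(h k.+1 z _) -/I -(fineK Ifin).
set w := fine I.
pose F (t : R) := dk * t ^+ k.*2.+1 + w / 2 * t ^- 2.
have Fmin (t : R) : 0 < t -> F z <= F t.
  move=> t0; rewrite /F; have [zt|tz] := leP z t.
    by have := intle t zt; rewrite -(fineK Ifin) -/w -EFinM -EFinD lee_fin; lra.
  have := intge t t0 (ltW tz).
  by rewrite -(fineK Ifin) -/w -EFinM -EFinD lee_fin; lra.
have dF (t : R) : 0 < t -> is_derive t (1 : R) F (dk * (k.*2.+1%:R * t ^+ k.*2) - w * t ^- 3).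
  move=> t0.
  have t20 : t ^+ 2 != 0 by rewrite gt_eqF ?exprn_gt0.
  have dX m : is_derive t (1 : R) (@GRing.exp R ^~ m) (m%:R * t ^+ m.-1).
    by split; [exact: exprn_derivable|rewrite exp_derive /GRing.scale /= mulr1].
  pose f1 := @GRing.exp R ^~ k.*2.+1.
  pose f2 : R -> R := fun t => ((@GRing.exp R ^~ 2) t)^-1.
  have d1 : is_derive t (1 : R) f1 (k.*2.+1%:R * t ^+ k.*2) by exact: dX.
  have d2 : is_derive t (1 : R) f2 (- (t ^+ 2) ^- 2 *: (2%:R * t ^+ 1)).
    exact: is_deriveV (dX 2).
  have -> : F = (dk \*: f1 + (w / 2) \*: f2).
    by apply/funext => u; rewrite /F /f1 /f2 !fctE.
  apply: is_derive_eq; rewrite /GRing.scale /=.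
  by field; rewrite gt_eqF.
have mF : is_derive z (1 : R) F 0.
  have le0 : 0 <= z + 1 by rewrite addr_ge0// ltW.
  apply: (derive1_at_min le0).
  - by move=> t; rewrite in_itv /= => /andP[t0 _]; case: (dF t t0).
  - by rewrite in_itv /=; apply/andP; split => //; rewrite ltrDl ltr01.
  - by move=> t; rewrite in_itv /= => /andP[t0 _]; exact: Fmin.
have [_ e1] := mF; have [_ e2] := dF z z0.
have {e1 e2} e : w * z ^- 3 = dk * (k.*2.+1%:R * z ^+ k.*2).
  by apply/esym/eqP; rewrite -subr_eq0 -e2 e1.
congr (_%:E); rewrite big_ord_recr /= -/dk.
have -> : w = (w * z ^- 3) * z ^+ 3 by rewrite divfK// gt_eqF ?exprn_gt0.
by rewrite e doubleS -(addn3 k.*2) exprD; ring.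
Qed.

(** * Products of two uncorrelated Gaussian variables *)

Lemma poly_eval_inj (F : numFieldType) (p q : {poly F}) :
  (forall a, p.[a] = q.[a]) -> p = q.
Proof.
move=> pq; apply/eqP; rewrite -subr_eq0; apply/eqP.
apply: (@roots_geq_poly_eq0 _ _ [seq i%:R | i <- iota 0 (size (p - q))]).
- by apply/allP => x _; rewrite rootE hornerD hornerN pq subrr.
- rewrite map_inj_uniq ?iota_uniq// => i j; exact: (mulrIn (oner_neq0 F)).
- by rewrite size_map size_iota.
Qed.

Lemma Rintegral_lincomb d (T : measurableType d) (R : realType)
    (mu : {measure set T -> \bar R}) (N : nat) (c : nat -> R) (f : nat -> T -> R) :
  (forall i, mu.-integrable setT (EFin \o f i)) ->
  mu.-integrable setT (EFin \o (fun x => \sum_(i < N) c i * f i x)) /\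
  \int[mu]_x (\sum_(i < N) c i * f i x) = \sum_(i < N) c i * \int[mu]_x f i x.
Proof.
move=> fi; elim: N => [|N [IH1 IH2]].
  under [X in _ /\ X = _]eq_Rintegral do rewrite big_ord0.
  rewrite (_ : EFin \o _ = cst 0%E); last by apply/funext => x /=; rewrite big_ord0.
  by split; [exact: integrable0|rewrite Rintegral_cst// mul0r big_ord0].
have fN : mu.-integrable setT (EFin \o (fun x => c N * f N x)).
  by have := integrableZl measurableT (c N) (fi N).
have -> : (fun x => \sum_(i < N.+1) c i * f i x) =
   (fun x => (\sum_(i < N) c i * f i x) + c N * f N x).
  by apply/funext => x; rewrite big_ord_recr.
split; first by have := integrableD measurableT IH1 fN.
by rewrite RintegralD// IH2 RintegralZl// big_ord_recr.
Qed.

Lemma double_fact_prod (k : nat) :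
  ((\prod_(i < k) i.*2.+1) * (2 ^ k * k`!) = (k.*2)`!)%N.
Proof.
elim: k => [|k IH]; first by rewrite big_ord0.
rewrite big_ord_recr /= doubleS !factS -IH expnS.
set Q := (\prod_(i < k) _)%N; have -> : (k.*2.+2 = 2 * k.+1)%N by rewrite mul2n.
move: (k.*2.+1) (2 ^ k)%N (k`!) (k.+1) => a b c e; ring.
Qed.

Lemma binS_le (n m : nat) : ('C(n.+1, m) <= 2 ^ n)%N.
Proof.
elim: n m => [|n IH] [|m]; rewrite ?bin0 ?expn_gt0//.
  by case: m.
by rewrite binS expnS mul2n -addnn leq_add.
Qed.

(** By symmetry and Pascal's rule the central coefficient is at most half of the
    sum of its row.  The factor 2 is what makes the moment generating function in
    [pair_product_mgf] sharp enough for the constant 3 in the noise events. *)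
Lemma central_bin_le (l : nat) : (0 < l)%N -> ('C(l.*2, l) * 2 <= 4 ^ l)%N.
Proof.
case: l => // l _; rewrite (_ : 4 = 2 ^ 2)%N// -expnM mul2n doubleS expnS mulnC.
by rewrite leq_mul2l /= binS_le.
Qed.

(** The middle coefficient of (a^2 + 1)^m, which carries E (X V)^m in the expansion
    of E (a X + V)^2m. *)
Lemma coef_add1X2_expn (R : comNzRingType) (m : nat) :
  (('X^2 + 1 : {poly R}) ^+ m)`_m = (if odd m then 0 else 'C(m, m./2)%:R).
Proof.
have -> : ('X^2 + 1 : {poly R}) ^+ m = (('X + 1) ^+ m) \Po 'X^2.
  by rewrite rmorphXn /= rmorphD /= comp_polyX comp_polyC.
rewrite coef_comp_poly_Xn// dvdn2; case: (odd m) => //=.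
rewrite divn2 addrC exprDn coef_sum.
have hm : (m./2 < m.+1)%N by rewrite ltnS -divn2 leq_div.
rewrite (bigD1 (Ordinal hm)) //= expr1n mul1r coefMn coefXn eqxx.
rewrite big1 ?addr0// => i /eqP ih; rewrite expr1n mul1r coefMn coefXn.
by case: eqVneq => [e|]; [case: ih; apply: val_inj|rewrite mul0rn].
Qed.

(** X and V are jointly Gaussian, uncorrelated and standardized, but this is
    expressed by the law of every unit combination a X + b V only, which is what
    the definition of a Gaussian vector yields directly; no joint density is
    involved. *)
Section standard_pair.
Context d (T : measurableType d) (R : realType) (P : probability T R).
Variables X V : T -> R.
Hypothesis mX : measurable_fun setT X.
Hypothesis mV : measurable_fun setT V.
Hypothesis law : forall (a b : R) (f : R -> R), a ^+ 2 + b ^+ 2 = 1 ->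
  measurable_fun setT f -> (forall x, 0 <= f x) ->
  (\int[P]_w (f (a * X w + b * V w))%:E = \int[normal_prob 0 1]_x (f x)%:E)%E.

Let dfact (k : nat) : R := \prod_(i < k) i.*2.+1%:R.

Let mlin (a b : R) : measurable_fun setT (fun w => a * X w + b * V w).
Proof. by apply: measurable_funD; apply: measurable_funM. Qed.

Lemma pair_even_moment (a b : R) (k : nat) :
  (\int[P]_w ((a * X w + b * V w) ^+ k.*2)%:E
   = (dfact k * (a ^+ 2 + b ^+ 2) ^+ k)%:E)%E.
Proof.
have evenge0 (x : R) : 0 <= x ^+ k.*2 by rewrite -mul2n exprM exprn_ge0 ?sqr_ge0.
set r := a ^+ 2 + b ^+ 2.
have r0 : 0 <= r by rewrite addr_ge0 ?sqr_ge0.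
have [re0|rn0] := eqVneq r 0.
  have /andP[/eqP a0 /eqP b0] : (a == 0) && (b == 0).
    by move/eqP: re0; rewrite paddr_eq0 ?sqr_ge0// !sqrf_eq0.
  transitivity (\int[P]_w (0 ^+ k.*2 : R)%:E)%E.
    by apply: eq_integral => w _; rewrite a0 b0 !mul0r addr0.
  rewrite integral_cst//= re0 probability_setT mule1.
  by case: k {evenge0} => [|k]; rewrite /dfact ?big_ord0 !expr0n /= ?mul1r ?mulr0.
have rp : 0 < r by rewrite lt_neqAle eq_sym rn0.
set q := Num.sqrt r; have q0 : 0 < q by rewrite sqrtr_gt0.
have q2 : q ^+ 2 = r by rewrite sqr_sqrtr.
have qq : (a / q) ^+ 2 + (b / q) ^+ 2 = 1.
  by rewrite !expr_div_n -mulrDl q2 -/r divff.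
have mpow : measurable_fun [set: R] (fun x : R => x ^+ k.*2) by exact: measurable_funX.
have := law qq mpow evenge0.
have -> : (\int[normal_prob 0 1]_x (x ^+ k.*2)%:E = (dfact k)%:E :> \bar R)%E.
  have := @gauss_moment_exp R k 1 ltr01; rewrite !expr1n mulr1 /dfact => <-.
  by apply: eq_integral => x _; rewrite invr1 subrr !mul0r expR0 mulr1.
move=> e; rewrite mulrC EFinM -e -ge0_integralZl//.
- apply: eq_integral => w _; rewrite -EFinM -q2 -exprM -mul2n -exprMn; congr ((_ ^+ _)%:E).
  by field; rewrite gt_eqF.
- by apply/measurable_EFinP/measurable_funX; exact: mlin.
- by move=> w _; rewrite lee_fin.
- by rewrite lee_fin exprn_ge0.
Qed.

(** |x^i v^j| <= x^2i + v^2j reduces mixed monomials to even powers. *)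
Lemma integrable_pair_monomial (i j : nat) :
  P.-integrable setT (EFin \o (fun w => X w ^+ i * V w ^+ j)).
Proof.
have evenge0 (x : R) n : 0 <= x ^+ n.*2 by rewrite -mul2n exprM exprn_ge0 ?sqr_ge0.
have intl (a b : R) k : P.-integrable setT (EFin \o (fun w => (a * X w + b * V w) ^+ k.*2)).
  apply/integrableP; split.
    by apply/measurable_EFinP/measurable_funX; exact: mlin.
  under eq_integral do rewrite /= ger0_norm//.
  by rewrite pair_even_moment ltry.
have h := integrableD measurableT (intl 1 0 i) (intl 0 1 j).
apply: le_integrable h => //.
  by apply/measurable_EFinP; apply: measurable_funM; exact: measurable_funX.
move=> w _ /=; rewrite lee_fin !mul1r !mul0r addr0 add0r.
rewrite [leRHS]ger0_norm ?addr_ge0// normrM !normrX -!mul2n !(mulnC 2) !exprM.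
rewrite -(real_normK (num_real (X w ^+ i))) -(real_normK (num_real (V w ^+ j))) !normrX.
set u := _ ^+ i; set v := _ ^+ j.
have u0 : 0 <= u by rewrite exprn_ge0.
have v0 : 0 <= v by rewrite exprn_ge0.
have := sqr_ge0 (u - v); nra.
Qed.

(** E (a X + V)^2m = (2m-1)!! (a^2 + 1)^m for every real a, so both sides agree
    as polynomials in a; compare the coefficients of a^m. *)
Lemma pair_product_moment (m : nat) :
  'C(m.*2, m)%:R * \int[P]_w ((X w * V w) ^+ m) =
  if odd m then 0 else dfact m * 'C(m, m./2)%:R.
Proof.
pose f (i : nat) (w : T) := X w ^+ i * V w ^+ (m.*2 - i).
pose mom (i : nat) := \int[P]_w f i w.
pose p : {poly R} := \poly_(i < m.*2.+1) ('C(m.*2, i)%:R * mom i).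
pose q : {poly R} := (dfact m) *: (('X^2 + 1) ^+ m).
have pq : p = q.
  apply: poly_eval_inj => a; rewrite horner_poly hornerZ horner_exp !hornerE.
  have [h1 h2] := @Rintegral_lincomb _ T R P m.*2.+1
     (fun i => 'C(m.*2, i)%:R * a ^+ i) f (fun i => integrable_pair_monomial i _).
  transitivity (\sum_(i < m.*2.+1) 'C(m.*2, i)%:R * a ^+ i * mom i).
    by apply: eq_bigr => i _; rewrite mulrAC.
  rewrite -h2.
  have := pair_even_moment a 1 m; rewrite expr1n => /(congr1 fine) /= <-.
  rewrite /Rintegral; congr fine; apply: eq_integral => w _; congr (_%:E).
  rewrite mul1r addrC exprDn; apply: eq_bigr => i _.
  by rewrite /f exprMn -mulr_natl; ring.
have := congr1 (fun r : {poly R} => r`_m) pq.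
rewrite coef_poly coefZ coef_add1X2_expn ltnS -addnn leq_addr addnn => e.
have -> : \int[P]_w ((X w * V w) ^+ m) = mom m.
  by apply: eq_Rintegral => w _; rewrite /f -addnn addnK exprMn.
by rewrite e; case: ifP; rewrite ?mulr0.
Qed.

Lemma pair_product_moment_odd (m : nat) : odd m -> \int[P]_w ((X w * V w) ^+ m) = 0.
Proof.
move=> om; have := pair_product_moment m; rewrite om => /eqP.
rewrite mulf_eq0 pnatr_eq0 => /orP[|/eqP//].
by rewrite -leqn0 leqNgt bin_gt0 -addnn leq_addr.
Qed.

Lemma pair_product_moment_even (l : nat) :
  \int[P]_w ((X w * V w) ^+ l.*2) = (l.*2)`!%:R * ('C(l.*2, l)%:R / 4 ^+ l).
Proof.
have := pair_product_moment l.*2; rewrite odd_double doubleK.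
set I := \int[P]_w _ => e.
have hd : dfact l.*2 * (4 ^+ l * (l.*2)`!%:R) = (l.*2.*2)`!%:R.
  rewrite -(double_fact_prod l.*2) !natrM natr_prod natrX.
  by have -> : (2 : R) ^+ l.*2 = 4 ^+ l by rewrite -mul2n exprM -natrX.
have hb : 'C(l.*2.*2, l.*2)%:R * ((l.*2)`!%:R * (l.*2)`!%:R) = (l.*2.*2)`!%:R :> R.
  by rewrite -!natrM -[in RHS](@bin_fact l.*2.*2 l.*2) ?leq_addr -?addnn ?leq_addr ?addnK.
have f0 : (l.*2)`!%:R != 0 :> R by rewrite pnatr_eq0 -lt0n fact_gt0.
have c0 : 'C(l.*2.*2, l.*2)%:R != 0 :> R.
  by rewrite pnatr_eq0 -lt0n bin_gt0 -[l.*2.*2]addnn leq_addr.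
have p4 : 4 ^+ l != 0 :> R by rewrite expf_neq0.
apply: (mulfI c0); rewrite e.
apply: (mulfI f0); apply: (mulfI p4).
transitivity (dfact l.*2 * (4 ^+ l * (l.*2)`!%:R) * 'C(l.*2, l)%:R); first by ring.
rewrite hd -hb; field; exact: p4.
Qed.

End standard_pair.

Lemma series_exp_coeff_le (R : realType) (x : R) (n : nat) : 0 <= x ->
  \sum_(m < n) x ^+ m / m`!%:R <= expR x.
Proof.
move=> x0.
have := @nondecreasing_cvgn_le R (series (exp_coeff x)).
move/(_ _ (is_cvg_series_exp_coeff x) n); rewrite /series /= big_mkord; apply.
apply: nondecreasing_series => i _ _; rewrite /exp_coeff /=.
by rewrite divr_ge0// exprn_ge0.
Qed.

Section standard_pair_mgf.
Context d (T : measurableType d) (R : realType) (P : probability T R).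
Variables X V : T -> R.
Hypothesis mX : measurable_fun setT X.
Hypothesis mV : measurable_fun setT V.
Hypothesis law : forall (a b : R) (f : R -> R), a ^+ 2 + b ^+ 2 = 1 ->
  measurable_fun setT f -> (forall x, 0 <= f x) ->
  (\int[P]_w (f (a * X w + b * V w))%:E = \int[normal_prob 0 1]_x (f x)%:E)%E.

(** E (X V)^2l = (2l)! binomial(2l, l) / 4^l, so that the exponential series
    integrates termwise to a series dominated by 1 + sum_(l >= 1) th^2l / 2.
    Termwise integration is dominated convergence:
    |X V| <= max (X^2, V^2) and exp (th X^2) is integrable for th < 1/2. *)
Lemma pair_product_mgf (th : R) : 0 <= th -> th < 1 / 2 ->
  (\int[P]_w (expR (th * (X w * V w)))%:E <=
   (expR (th ^+ 2 / (2 * (1 - th ^+ 2))))%:E)%E.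
Proof.
move=> th0 th1; set x := th ^+ 2.
have x1 : 0 <= x < 1 by rewrite /x; apply/andP; split; nra.
have mXV : measurable_fun setT (fun w => X w * V w) by exact: measurable_funM.
pose c (m : nat) : R := th ^+ m / m`!%:R.
pose f (m : nat) (w : T) := (X w * V w) ^+ m.
have intf m : P.-integrable setT (EFin \o f m).
  apply: (eq_integrable _ (EFin \o (fun w => X w ^+ m * V w ^+ m))) => //.
    by move=> w _; rewrite /f /= exprMn.
  exact: integrable_pair_monomial.
pose S (N : nat) (w : T) := \sum_(m < N) c m * f m w.
have Sc N w : S N w = \sum_(m < N) (th * (X w * V w)) ^+ m / m`!%:R.
  by apply: eq_bigr => m _; rewrite /c /f [(th * _) ^+ m]exprMn mulrAC.
pose g (w : T) := expR (th * X w ^+ 2) + expR (th * V w ^+ 2).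
have dom N w : `|S N w| <= g w.
  rewrite Sc (le_trans (ler_norm_sum _ _ _))//.
  apply: (@le_trans _ _ (\sum_(m < N) `|th * (X w * V w)| ^+ m / m`!%:R)).
    by apply: ler_sum => m _; rewrite normrM normrX [X in _ * X <= _]ger0_norm// invr_ge0.
  rewrite (le_trans (series_exp_coeff_le _ _))// /g.
  have h : `|th * (X w * V w)| <= Num.max (th * X w ^+ 2) (th * V w ^+ 2).
    rewrite normrM ger0_norm// normrM -(real_normK (num_real (X w))) -(real_normK (num_real (V w))).
    rewrite le_max; have := normr_ge0 (X w); have := normr_ge0 (V w).
    set u := `|X w|; set v := `|V w| => v0 u0; apply/orP; have [uv|vu] := leP u v.
      by right; rewrite ler_wpM2l// expr2 ler_wpM2r.
    by left; rewrite ler_wpM2l// expr2 ler_wpM2l// ltW.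
  move: h; rewrite -ler_expR => /le_trans; apply.
  by rewrite maxEle; case: ifP => _; rewrite ?lerDl ?lerDr expR_ge0.
have mexp : measurable_fun [set: R] (fun x : R => expR (th * x ^+ 2)).
  by apply: measurableT_comp => //; apply: measurable_funM => //; exact: measurable_funX.
have intexp (a b : R) : a ^+ 2 + b ^+ 2 = 1 ->
    P.-integrable setT (EFin \o (fun w => expR (th * (a * X w + b * V w) ^+ 2))).
  move=> ab; apply/integrableP; split.
    apply/measurable_EFinP; apply: (measurableT_comp mexp).
    by apply: measurable_funD; apply: measurable_funM.
  under eq_integral do rewrite /= ger0_norm ?expR_ge0//.
  rewrite (@law a b (fun x => expR (th * x ^+ 2)) ab)//.
  by rewrite gauss_exp_sqr_lt// ltry.
have ig : P.-integrable setT (EFin \o g).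
  have e1 : (1 : R) ^+ 2 + 0 ^+ 2 = 1 by rewrite expr1n expr0n addr0.
  have e2 : (0 : R) ^+ 2 + 1 ^+ 2 = 1 by rewrite expr1n expr0n add0r.
  have := integrableD measurableT (intexp _ _ e1) (intexp _ _ e2).
  apply: eq_integrable => // w _ /=.
  by rewrite !mul1r !mul0r addr0 add0r.
have SE N : \int[P]_w S N w = \sum_(m < N) c m * \int[P]_w f m w.
  by have [] := Rintegral_lincomb N c intf.
have iS N : P.-integrable setT (EFin \o S N).
  by have [] := Rintegral_lincomb N c intf.
have [_ _ cvgS] : [/\ P.-integrable setT (fun w => (expR (th * (X w * V w)))%:E),
   [sequence \int[P]_w `|(S N w)%:E - (expR (th * (X w * V w)))%:E| ]_N @ \oo --> 0%E &
   [sequence \int[P]_w (S N w)%:E]_N @ \oo --> (\int[P]_w (expR (th * (X w * V w)))%:E)%E]%E.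
  apply: (@dominated_convergence _ T R P setT measurableT (fun N w => (S N w)%:E) _ (EFin \o g)) => //.
  - by move=> N; have /integrableP[] := iS N.
  - by apply/measurable_EFinP; apply: measurableT_comp => //; exact: measurable_funM.
  - apply: aeW => w _; apply/fine_cvgP; split; first exact: nearW.
    rewrite (_ : _ \o _ = series (exp_coeff (th * (X w * V w)))).
      exact: is_cvg_series_exp_coeff.
    by apply/funext => N; rewrite /= Sc /series /= big_mkord.
  - by apply: aeW => w N _ /=; rewrite lee_fin dom.
pose b (m : nat) := c m * \int[P]_w f m w.
have bodd m : odd m -> b m = 0.
  by move=> om; rewrite /b /f (pair_product_moment_odd mX mV law om) mulr0.
have beven l : b l.*2 = x ^+ l * ('C(l.*2, l)%:R / 4 ^+ l).
  rewrite /b /f (pair_product_moment_even mX mV law) /c /= [LHS]mulrA divfK.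
    by rewrite -mul2n exprM.
  by rewrite pnatr_eq0 -lt0n fact_gt0.
have b0 m : 0 <= b m.
  have [om|em] := boolP (odd m); first by rewrite bodd.
  rewrite -(odd_double_half m) (negbTE em) add0n beven.
  by rewrite mulr_ge0 ?divr_ge0 ?exprn_ge0//; case/andP: x1.
(* partial sums of the geometric series 1 + (x + ... + x^N) / 2 *)
have bsum N : \sum_(m < N.+1.*2) b m <= 1 + (x - x ^+ N.+1) / (2 * (1 - x)).
  elim: N => [|N IH].
    rewrite !big_ord_recl big_ord0 /= (bodd 1%N)// expr1 subrr mul0r !addr0.
    by have := beven 0%N; rewrite /= => ->; rewrite bin0 !expr0 divr1 mulr1.
  rewrite doubleS 2!big_ord_recr /= (bodd N.+1.*2.+1) ?addr0 ?beven; last by rewrite /= odd_double.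
  have hC : 'C(N.+1.*2, N.+1)%:R / 4 ^+ N.+1 <= 1 / 2 :> R.
    rewrite ler_pdivrMr ?exprn_gt0// mulrAC ler_pdivlMr// mul1r -natrX -natrM ler_nat.
    exact: central_bin_le.
  have xN : 0 <= x ^+ N.+1 by rewrite exprn_ge0//; case/andP: x1.
  rewrite (le_trans (lerD IH (ler_wpM2l xN hC)))// le_eqVlt; apply/orP; left; apply/eqP.
  by rewrite [x ^+ N.+2]exprS; field; rewrite subr_eq0 gt_eqF//; case/andP: x1.
have bsum' N : \sum_(m < N) b m <= 1 + x / (2 * (1 - x)).
  apply: (@le_trans _ _ (\sum_(m < N.+1.*2) b m)).
    rewrite (big_ord_widen N.+1.*2 b); last first.
      by rewrite -addnn (leq_trans (leqnSn N)) ?leq_addr.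
    rewrite [leRHS](bigID (fun m : 'I__ => (m < N)%N)) /= lerDl.
    by apply: sumr_ge0 => m _.
  apply: (le_trans (bsum N)); rewrite lerD2l ler_wpM2r ?invr_ge0 ?mulr_ge0 ?subr_ge0//.
    by case/andP: x1 => _ /ltW.
  by rewrite lerBlDr lerDl exprn_ge0//; case/andP: x1.
apply: (@le_trans _ _ (1 + x / (2 * (1 - x)))%:E); last by rewrite lee_fin expR_ge1Dx.
rewrite -(cvg_lim _ cvgS)//.
apply: lime_le; first by apply/cvg_ex; eexists; exact: cvgS.
apply: nearW => N /=.
have -> : (\int[P]_w (S N w)%:E = (\int[P]_w S N w)%:E)%E.
  rewrite /Rintegral fineK//; apply: integrable_fin_num => //; exact: iS.
by rewrite lee_fin SE bsum'.
Qed.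

End standard_pair_mgf.

(** * Linear combinations of a Gaussian vector *)

Definition bil (R : realType) (p : nat) (A : 'M[R]_p) (u v : 'cV[R]_p) : R :=
  (u^T *m A *m v) 0 0.

Section bilinear.
Context (R : realType) (p : nat).
Variable A : 'M[R]_p.
Implicit Types u v w : 'cV[R]_p.

Lemma quadE v : quad A v = bil A v v. Proof. by []. Qed.

Lemma bilDl u v w : bil A (u + v) w = bil A u w + bil A v w.
Proof. by rewrite /bil linearD /= !mulmxDl mxE. Qed.

Lemma bilDr u v w : bil A w (u + v) = bil A w u + bil A w v.
Proof. by rewrite /bil mulmxDr mxE. Qed.

Lemma bilZl (c : R) u v : bil A (c *: u) v = c * bil A u v.
Proof. by rewrite /bil linearZ /= -!scalemxAl mxE. Qed.

Lemma bilZr (c : R) u v : bil A u (c *: v) = c * bil A u v.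
Proof. by rewrite /bil -scalemxAr mxE. Qed.

Lemma bilNl u v : bil A (- u) v = - bil A u v.
Proof. by rewrite -scaleN1r bilZl mulN1r. Qed.

Lemma bilNr u v : bil A u (- v) = - bil A u v.
Proof. by rewrite -scaleN1r bilZr mulN1r. Qed.

Lemma bilC u v : A^T = A -> bil A u v = bil A v u.
Proof.
move=> sA; rewrite /bil.
have -> : u^T *m A *m v = (v^T *m A *m u)^T by rewrite !trmx_mul trmxK sA mulmxA.
by rewrite mxE.
Qed.

Lemma bil_sum u v : bil A u v = \sum_i u i 0 * (A *m v) i 0.
Proof. by rewrite /bil -mulmxA mxE; apply: eq_bigr => i _; rewrite mxE. Qed.

Lemma quad_add u v : A^T = A -> quad A (u + v) = quad A u + 2 * bil A u v + quad A v.
Proof. by move=> sA; rewrite !quadE bilDl !bilDr (bilC v u)//; ring. Qed.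

Lemma quad_scale (c : R) u : quad A (c *: u) = c ^+ 2 * quad A u.
Proof. by rewrite !quadE bilZl bilZr; ring. Qed.

End bilinear.

Definition lincomb (T : Type) (R : realType) (p : nat) (Y : 'I_p -> T -> R)
  (a : 'cV[R]_p) (w : T) : R := \sum_j a j 0 * Y j w.

Lemma lincombD (T : Type) (R : realType) (p : nat) (Y : 'I_p -> T -> R) a b w :
  lincomb Y (a + b) w = lincomb Y a w + lincomb Y b w.
Proof. by rewrite /lincomb -big_split; apply: eq_bigr => j _; rewrite mxE mulrDl. Qed.

Lemma lincombZ (T : Type) (R : realType) (p : nat) (Y : 'I_p -> T -> R) c a w :
  lincomb Y (c *: a) w = c * lincomb Y a w.
Proof. by rewrite /lincomb mulr_sumr; apply: eq_bigr => j _; rewrite mxE mulrA. Qed.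

Lemma expR_convex_le (R : realType) (s t x y : R) : 0 <= s -> 0 <= t -> s + t = 1 ->
  expR (s * x + t * y) <= s * expR x + t * expR y.
Proof.
move=> s0 t0 st; set m := s * x + t * y.
have h z : expR m * (1 + (z - m)) <= expR z.
  have -> : expR z = expR m * expR (z - m) by rewrite -expRD; congr expR; ring.
  by rewrite ler_wpM2l ?expR_ge0 ?expR_ge1Dx.
have := ler_wpM2l s0 (h x); have := ler_wpM2l t0 (h y).
suff : s * (expR m * (1 + (x - m))) + t * (expR m * (1 + (y - m))) = expR m by lra.
transitivity (expR m * ((s + t) + (s * x + t * y) - (s + t) * m)); first by ring.
by rewrite st -/m; ring.
Qed.

(** exp (-phi) / sqrt (1 - 2 phi) has logarithm phi^2 + O(phi^3); the constant 3/2
    absorbs the remainder for |phi| <= 1/6.  After squaring, with y = 2 phi, the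
    claim is 1 <= exp (y + 3/4 y^2) (1 - y). *)
Lemma gauss_centered_sqr_mgf (R : realType) (phi : R) : `|phi| <= 1 / 6 ->
  (\int[normal_prob 0 1]_x (expR (phi * (x ^+ 2 - 1)))%:E
   <= (expR (3 / 2 * phi ^+ 2))%:E)%E.
Proof.
rewrite ler_norml => /andP[l u].
have u0 : 0 < 1 - 2 * phi by lra.
have mexp : measurable_fun [set: R] (fun x : R => expR (phi * x ^+ 2)).
  by apply: measurableT_comp => //; apply: measurable_funM => //; exact: measurable_funX.
have -> : (\int[normal_prob 0 1]_x (expR (phi * (x ^+ 2 - 1)))%:E =
   (expR (- phi))%:E * \int[normal_prob 0 1]_x (expR (phi * x ^+ 2))%:E :> \bar R)%E.
  rewrite -ge0_integralZl//.
  - by apply: eq_integral => x _; rewrite -EFinM -expRD; congr (expR _)%:E; ring.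
  - exact/measurable_EFinP.
have ph : phi < 1 / 2 by lra.
rewrite gauss_exp_sqr_lt//.
rewrite -EFinM lee_fin ler_pdivrMr ?sqrtr_gt0//.
rewrite -(@ler_pXn2r _ 2)// ?nnegrE ?mulr_ge0 ?expR_ge0 ?sqrtr_ge0//.
rewrite exprMn sqr_sqrtr ?(ltW u0)//.
rewrite -!expRM_natl; set y := 2 * phi.
suff h : 1 <= expR (y + 3 / 4 * y ^+ 2) * (1 - y).
  have -> : 2%:R * - phi = 2%:R * (3 / 2 * phi ^+ 2) - (y + 3 / 4 * y ^+ 2) by rewrite /y; field.
  rewrite expRB ler_wpM2l ?expR_ge0// -[_^-1]mul1r ler_pdivrMr ?expR_gt0//.
  by rewrite mulrC.
(* positive y: second order Taylor bound for exp; negative y: the exponent is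
   negative, and exp (-2 v) >= (1 - v)^2 *)
have [y0|y0] := leP 0 y.
  have v0 : 0 <= y + 3 / 4 * y ^+ 2 by have := sqr_ge0 y; lra.
  have := series_exp_coeff_le 3 v0; rewrite !big_ord_recl big_ord0 /= addr0.
  rewrite expr0 expr1 !divr1 /bump /= => hs.
  have y3 : y <= 1 / 3 by rewrite /y; lra.
  have {}hs : 1 + (y + 3 / 4 * y ^+ 2) + (y + 3 / 4 * y ^+ 2) ^+ 2 / 2 <= expR (y + 3 / 4 * y ^+ 2).
    by move: hs; rewrite addrA.
  have y1 : 0 <= 1 - y by lra.
  apply: le_trans (ler_wpM2r y1 hs).
  suff : 0 <= y ^+ 2 * (1 / 4 - y / 2 - 15 / 32 * y ^+ 2 - 9 / 32 * y ^+ 3) by lra.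
  rewrite mulr_ge0 ?sqr_ge0//; have : y ^+ 2 <= 1 / 9 by nra.
  have : y ^+ 3 <= 1 / 27 by rewrite exprSr; nra.
  lra.
pose z := - y; have z0 : 0 < z by rewrite oppr_gt0.
have z3 : z <= 1 / 3 by rewrite /z /y; lra.
pose v := (z - 3 / 4 * z ^+ 2) / 2.
have -> : y + 3 / 4 * y ^+ 2 = 2%:R * - v by rewrite /v /z; field.
rewrite expRM_natl.
have hv : 1 - v <= expR (- v) by exact: expR_ge1Dx.
have v1 : 0 <= 1 - v by rewrite /v; nra.
have hs : (1 - v) ^+ 2 <= expR (- v) ^+ 2 by rewrite ler_pXn2r ?nnegrE ?expR_ge0.
have y1 : 0 <= 1 - y by rewrite -[y]opprK -/z; lra.
apply: le_trans (ler_wpM2r y1 hs); rewrite -[y]opprK -/z /v.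
suff : 0 <= z ^+ 3 * (40 - 15 * z + 9 * z ^+ 2) / 64.
  by lra.
rewrite divr_ge0// mulr_ge0 ?exprn_ge0 ?ltW//; nra.
Qed.

Section gaussian_rows.
Context d (T : measurableType d) (R : realType) (P : probability T R).
Context (p : nat) (Sigma : 'M[R]_p) (Y : 'I_p -> {RV P >-> R}).
Hypothesis symS : Sigma^T = Sigma.
Hypothesis posS : forall v : 'cV[R]_p, v != 0 -> 0 < quad Sigma v.
Hypothesis gY : gaussian_vector Y Sigma.
Local Notation L := (lincomb (fun j => Y j : T -> R)).

Lemma measurable_lincomb (a : 'cV[R]_p) : measurable_fun setT (L a).
Proof. by apply: measurable_sum => j; exact: measurable_funM. Qed.

Lemma gaussian_unit_law (a : 'cV[R]_p) (f : R -> R) : quad Sigma a = 1 ->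
  measurable_fun setT f -> (forall x, 0 <= f x) ->
  (\int[P]_w (f (L a w))%:E = \int[normal_prob 0 1]_x (f x)%:E)%E.
Proof.
move=> qa mf f0; rewrite -[RHS]mul1e.
rewrite -(@integral_comp_weight _ _ _ _ R P (normal_prob 0 1) (L a) (cst 1) 1 f)//.
- by apply: eq_integral => w _; rewrite mulr1.
- exact: measurable_lincomb.
- move=> B mB; rewrite mul1e.
  have e : P (L a @^-1` B) = normal_prob 0 1 B.
    by have := gY a mB; rewrite qa oner_eq0 sqrtr1.
  transitivity (P (L a @^-1` B)); last exact: e.
  have mLB : measurable (L a @^-1` B).
    by rewrite -[X in measurable X]setTI; apply: measurable_lincomb.
  by under eq_integral do rewrite mulr1; rewrite integral_indic// setIT.
Qed.

Lemma unit_centered_sqr_mgf (a : 'cV[R]_p) (phi : R) : quad Sigma a = 1 ->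
  `|phi| <= 1 / 6 ->
  (\int[P]_w (expR (phi * (L a w ^+ 2 - 1)))%:E <= (expR (3 / 2 * phi ^+ 2))%:E)%E.
Proof.
move=> qa hphi.
rewrite [leLHS](@gaussian_unit_law a (fun x => expR (phi * (x ^+ 2 - 1))) qa).
- exact: gauss_centered_sqr_mgf.
- apply: measurableT_comp => //; apply: measurable_funM => //.
  by apply: measurable_funB => //; exact: measurable_funX.
- by move=> x; exact: expR_ge0.
Qed.

(** Polarization: a b = ((a + b)^2 - (a - b)^2) / 4, and
    quad (a + b) / 4 + quad (a - b) / 4 = 1.  Convexity of exp with these two
    weights reduces the product to centred squares of the normalized sum and
    difference, whatever the correlation of a and b. *)
Lemma unit_product_mgf (a b : 'cV[R]_p) (phi : R) :
  quad Sigma a = 1 -> quad Sigma b = 1 -> `|phi| <= 1 / 6 ->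
  (\int[P]_w (expR (phi * (L a w * L b w - bil Sigma a b)))%:E
   <= (expR (3 / 2 * phi ^+ 2))%:E)%E.
Proof.
move=> qa qb hphi.
(* if b = a or b = - a then one of the two weights vanishes *)
have [ab|ab] := eqVneq a b.
  rewrite -ab -quadE qa; apply: le_trans (unit_centered_sqr_mgf qa hphi).
  rewrite le_eqVlt; apply/orP; left; apply/eqP.
  by apply: eq_integral => w _; rewrite expr2.
have [anb|anb] := eqVneq a (- b).
  have -> : bil Sigma a b = - 1 by rewrite anb bilNl -quadE qb.
  have hphi' : `|- phi| <= 1 / 6 by rewrite normrN.
  rewrite -(sqrrN phi); have := unit_centered_sqr_mgf qb hphi'.
  apply: le_trans; rewrite le_eqVlt; apply/orP; left; apply/eqP.
  apply: eq_integral => w _; congr (expR _)%:E.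
  by rewrite anb -scaleN1r lincombZ; ring.
set k := bil Sigma a b.
have u0 : 0 < quad Sigma (a + b) by apply: posS; rewrite addr_eq0.
have v0 : 0 < quad Sigma (a - b) by apply: posS; rewrite subr_eq0.
have uE : quad Sigma (a + b) = 2 + 2 * k by rewrite quad_add// qa qb -/k; ring.
have vE : quad Sigma (a - b) = 2 - 2 * k.
  have qNb : quad Sigma (- b) = 1 by rewrite -scaleN1r quad_scale qb; ring.
  by rewrite quad_add// bilNr -/k qa qNb; ring.
rewrite uE in u0; rewrite vE in v0.
pose su := Num.sqrt (2 + 2 * k); pose sv := Num.sqrt (2 - 2 * k).
have su2 : su ^+ 2 = 2 + 2 * k by rewrite sqr_sqrtr ?ltW.
have sv2 : sv ^+ 2 = 2 - 2 * k by rewrite sqr_sqrtr ?ltW.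
have su0 : su != 0 by rewrite gt_eqF// sqrtr_gt0.
have sv0 : sv != 0 by rewrite gt_eqF// sqrtr_gt0.
pose a1 := su^-1 *: (a + b); pose b1 := sv^-1 *: (a - b).
have qa1 : quad Sigma a1 = 1 by rewrite quad_scale uE -su2 exprVn mulVf// expf_neq0.
have qb1 : quad Sigma b1 = 1 by rewrite quad_scale vE -sv2 exprVn mulVf// expf_neq0.
have La1 w : L a1 w ^+ 2 * (2 + 2 * k) = (L a w + L b w) ^+ 2.
  by rewrite /a1 lincombZ lincombD exprMn -su2; field.
have Lb1 w : L b1 w ^+ 2 * (2 - 2 * k) = (L a w - L b w) ^+ 2.
  have -> : L b w = - L (- b) w by rewrite -[- b]scaleN1r lincombZ; ring.
  by rewrite /b1 lincombZ lincombD exprMn -sv2 opprK; field.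
have s0 : 0 <= (2 + 2 * k) / 4 by lra.
have t0 : 0 <= (2 - 2 * k) / 4 by lra.
have st : (2 + 2 * k) / 4 + (2 - 2 * k) / 4 = 1 by field.
pose f1 w := expR (phi * (L a1 w ^+ 2 - 1)).
pose f2 w := expR (- phi * (L b1 w ^+ 2 - 1)).
have mf1 : measurable_fun setT f1.
  apply: measurableT_comp => //; apply: measurable_funM => //.
  by apply: measurable_funB => //; apply: measurable_funX; exact: measurable_lincomb.
have mf2 : measurable_fun setT f2.
  apply: measurableT_comp => //; apply: measurable_funM => //.
  by apply: measurable_funB => //; apply: measurable_funX; exact: measurable_lincomb.
have mE1 : measurable_fun setT (fun w => (f1 w)%:E) by apply/measurable_EFinP; exact: mf1.
have mE2 : measurable_fun setT (fun w => (f2 w)%:E) by apply/measurable_EFinP; exact: mf2.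
have p1 w : (0 <= (f1 w)%:E)%E by rewrite lee_fin; exact: expR_ge0.
have p2 w : (0 <= (f2 w)%:E)%E by rewrite lee_fin; exact: expR_ge0.
have s0E : (0 <= ((2 + 2 * k) / 4)%:E :> \bar R)%E by rewrite lee_fin.
have t0E : (0 <= ((2 - 2 * k) / 4)%:E :> \bar R)%E by rewrite lee_fin.
apply: (@le_trans _ _ (\int[P]_w (((2 + 2 * k) / 4)%:E * (f1 w)%:E +
                                  ((2 - 2 * k) / 4)%:E * (f2 w)%:E))%E).
  apply: ge0_le_integral => //.
  all: try (by move=> w _; rewrite lee_fin expR_ge0).
  - apply/measurable_EFinP; apply: measurableT_comp => //; apply: measurable_funM => //.
    by apply: measurable_funB => //; apply: measurable_funM; exact: measurable_lincomb.
  - by apply: emeasurable_funD; [exact: measurable_funeM mE1|exact: measurable_funeM mE2].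
  - move=> w _; rewrite -!EFinM -EFinD lee_fin.
    rewrite (le_trans _ (expR_convex_le _ _ s0 t0 st))// le_eqVlt.
    apply/orP; left; apply/eqP; congr expR.
    have e1 := La1 w; have e2 := Lb1 w.
    transitivity (phi / 4 * ((L a w + L b w) ^+ 2 - (L a w - L b w) ^+ 2 - 4 * k)); first by field.
    by rewrite -e1 -e2; field.
have -> : (\int[P]_w (((2 + 2 * k) / 4)%:E * (f1 w)%:E + ((2 - 2 * k) / 4)%:E * (f2 w)%:E)
    = ((2 + 2 * k) / 4)%:E * \int[P]_w (f1 w)%:E + ((2 - 2 * k) / 4)%:E * \int[P]_w (f2 w)%:E)%E.
  rewrite (ge0_integralD _ measurableT).
  - rewrite (ge0_integralZl _ measurableT mE1 (fun w _ => p1 w) s0E).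
    by rewrite (ge0_integralZl _ measurableT mE2 (fun w _ => p2 w) t0E).
  - by move=> w _; exact: mule_ge0.
  - exact: measurable_funeM mE1.
  - by move=> w _; exact: mule_ge0.
  - exact: measurable_funeM mE2.
have hphi' : `|- phi| <= 1 / 6 by rewrite normrN.
set E := expR (3 / 2 * phi ^+ 2).
have h1 : (\int[P]_w (f1 w)%:E <= E%:E)%E := unit_centered_sqr_mgf qa1 hphi.
have h2 : (\int[P]_w (f2 w)%:E <= E%:E)%E.
  by rewrite /E -(sqrrN phi); exact: (unit_centered_sqr_mgf qb1 hphi').
apply: (le_trans (leeD (lee_wpmul2l s0E h1) (lee_wpmul2l t0E h2))).
by rewrite -!EFinM -EFinD -mulrDl st mul1r.
Qed.

Lemma uncorrelated_product_mgf (a b : 'cV[R]_p) (th : R) :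
  quad Sigma a = 1 -> quad Sigma b = 1 -> bil Sigma a b = 0 ->
  0 <= th -> th < 1 / 2 ->
  (\int[P]_w (expR (th * (L a w * L b w)))%:E
   <= (expR (th ^+ 2 / (2 * (1 - th ^+ 2))))%:E)%E.
Proof.
move=> qa qb ab; apply: pair_product_mgf.
- exact: measurable_lincomb.
- exact: measurable_lincomb.
- move=> x y f xy mf f0; rewrite -(@gaussian_unit_law (x *: a + y *: b) f)//.
    by apply: eq_integral => w _; rewrite lincombD !lincombZ.
  by rewrite quad_add// !quad_scale bilZl bilZr ab qa qb !mulr0 addr0 !mulr1.
Qed.

End gaussian_rows.

Section gaussian_variance.
Context d (T : measurableType d) (R : realType) (P : probability T R).
Context (p : nat) (Sigma : 'M[R]_p) (Y : 'I_p -> {RV P >-> R}).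
Hypothesis gY : gaussian_vector Y Sigma.
Local Notation L := (lincomb (fun j => Y j : T -> R)).

(** The mean vanishes because the positive part of L z and that of L (- z) have
    the same law; x <= x^2 + 1 makes their integrals finite. *)
Lemma gaussian_variance (a : 'cV[R]_p) : 0 < quad Sigma a -> ('V_P[L a] = (quad Sigma a)%:E)%E.
Proof.
move=> qa; set v := quad Sigma a; pose s := Num.sqrt v.
have s2 : s ^+ 2 = v by rewrite sqr_sqrtr ?ltW.
have s0 : s != 0 by rewrite gt_eqF// sqrtr_gt0.
pose z := s^-1 *: a.
have az : a = s *: z by rewrite scalerA divff// scale1r.
have qz : quad Sigma z = 1 by rewrite quad_scale -/v -s2 exprVn mulVf// expf_neq0.
have qNz : quad Sigma (- z) = 1 by rewrite -scaleN1r quad_scale qz; ring.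
have La w : L a w = s * L z w by rewrite [in LHS]az lincombZ.
have mp : measurable_fun [set: R] (fun x : R => Num.max (s * x) 0).
  by apply: measurable_maxr => //; exact: measurable_funM.
have p0 (x : R) : 0 <= Num.max (s * x) 0 by rewrite le_max lexx orbT.
have msq : measurable_fun [set: R] (fun x : R => x ^+ 2) by exact: measurable_funX.
have m2 : (\int[P]_w (L z w ^+ 2)%:E = 1)%E.
  rewrite (gaussian_unit_law gY (f := fun x => x ^+ 2) qz)//; last by move=> x; exact: sqr_ge0.
  have := @gauss_moment_exp R 1 1 ltr01; rewrite big_ord1 !expr1n !mulr1 => <-.
  by apply: eq_integral => x _; rewrite invr1 subrr !mul0r expR0 mulr1.
have mLz := measurable_lincomb Y z.
have mLa := measurable_lincomb Y a.
have LNz w : L (- z) w = - L z w.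
  by rewrite -[- z]scaleN1r (lincombZ _ (-1) z) mulN1r.
have E0 : ('E_P[L a] = 0)%E.
  rewrite unlock integralE.
  have -> : (\int[P]_w (((fun w => (L a w)%:E)^\+) w) = \int[P]_w (Num.max (s * L z w) 0)%:E)%E.
    by apply: eq_integral => w _; rewrite funeposE -La EFin_max.
  have -> : (\int[P]_w (((fun w => (L a w)%:E)^\-) w) = \int[P]_w (Num.max (s * L (- z)%R w) 0)%:E)%E.
    apply: eq_integral => w _; rewrite funenegE EFin_max La -EFinN; congr (maxe _%:E _).
    by rewrite LNz mulrN.
  have e1 := gaussian_unit_law gY qz mp p0; have e2 := gaussian_unit_law gY qNz mp p0.
  rewrite e1 e2 subee// -e1 ge0_fin_numE; last by apply: integral_ge0 => w _; rewrite lee_fin.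
  apply: (@le_lt_trans _ _ (\int[P]_w ((s ^+ 2 + 1)%:E * (L z w ^+ 2)%:E + 1%:E))%E).
    apply: ge0_le_integral => //.
    all: try by move=> w _; rewrite lee_fin.
    - by apply/measurable_EFinP; apply: (measurableT_comp mp).
    - apply: emeasurable_funD => //; apply: measurable_funeM; apply/measurable_EFinP.
      exact: measurable_funX.
    - move=> w _; rewrite -EFinM -EFinD lee_fin ge_max; apply/andP; split.
        have := sqr_ge0 (s * L z w - 1); have := sqr_ge0 (L z w); have := sqr_ge0 (s * L z w).
        nra.
      by rewrite addr_ge0// mulr_ge0 ?addr_ge0 ?sqr_ge0.
  rewrite ge0_integralD//; first rewrite ge0_integralZl//; first by rewrite m2 integral_cst//= probability_setT ltry.
  all: try by apply/measurable_EFinP; exact: measurable_funX.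
  all: try by apply: measurable_funeM; apply/measurable_EFinP; exact: measurable_funX.
  - by move=> w _; rewrite lee_fin sqr_ge0.
  - by rewrite lee_fin addr_ge0 ?sqr_ge0.
  - by move=> w _; rewrite -EFinM lee_fin mulr_ge0 ?addr_ge0 ?sqr_ge0.
rewrite /variance covariance.unlock E0 expectation.unlock /=.
transitivity (\int[P]_w (v%:E * (L z w ^+ 2)%:E))%E.
  by apply: eq_integral => w _; rewrite fctE /= subr0 La -s2 -EFinM; congr (_%:E); ring.
rewrite ge0_integralZl//; first by rewrite m2 mule1.
- by apply/measurable_EFinP; exact: measurable_funX.
- by move=> w _; rewrite lee_fin sqr_ge0.
- by rewrite lee_fin ltW.
Qed.

End gaussian_variance.

(** * Chernoff bound for independent sigma-algebras *)

(** Measurability with respect to the sigma-algebra of one row, which is obtained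
    by regarding that sigma-algebra as the measurable structure of the domain. *)
Lemma g_sigma_preimage_product d (T : measurableType d) (R : realType) (p : nat)
    (X : 'I_p -> T -> R) (a b : 'cV[R]_p) (phi : R -> R) (B : set R) :
  measurable_fun setT phi -> measurable B ->
  g_sigma_preimage X ((fun w => phi (lincomb X a w * lincomb X b w)) @^-1` B).
Proof.
move=> mphi mB.
pose G := \big[setU/set0]_(j < p) preimage_set_system setT (X j) measurable.
have GX j C : measurable C -> G ([set: T] `&` X j @^-1` C).
  by move=> mC; rewrite /G (bigD1 j)//=; left; exists C.
pose GT : measurableType _ := g_sigma_algebraType G.
have mX j : measurable_fun [set: GT] (X j : GT -> R).
  by move=> _ C mC; apply: sub_sigma_algebra; exact: GX.
have mL (c : 'cV[R]_p) : measurable_fun [set: GT] (lincomb X c : GT -> R).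
  by apply: measurable_sum => j; exact: measurable_funM.
have mf : measurable_fun [set: GT] (fun w : GT => phi (lincomb X a w * lincomb X b w)).
  by apply: measurableT_comp => //; exact: measurable_funM.
by have := mf measurableT B mB; rewrite setTI.
Qed.

Section independent_product.
Context d (T : measurableType d) (R : realType) (P : probability T R) (n : nat).
Variable S : 'I_n -> set (set T).
Hypothesis mS : forall k A, S k A -> measurable A.
Hypothesis indep : forall E : 'I_n -> set T, (forall k, S k (E k)) ->
  P (\bigcap_(k in [set: 'I_n]) E k) = (\prod_(k < n) P (E k))%E.

Lemma indic_prod (E : 'I_n -> set T) (w : T) :
  \prod_(k < n) \1_(E k) w = \1_(\bigcap_(k in [set: 'I_n]) E k) w :> R.
Proof.
rewrite [RHS]indicE; case: (boolP (w \in _)) => [/set_mem h|/negP h].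
  by rewrite big1// => k _; rewrite indicE mem_set//; exact: h.
have [k nk] : exists k, ~ E k w.
  apply: contrapT => h'; apply: h; apply/mem_set => k _.
  by apply: contrapT => nk; apply: h'; exists k.
by rewrite (bigD1 k)//= indicE memNset// mul0r.
Qed.

(** Induction on the number m of factors that are general functions, the others
    being indicators of events of their sigma-algebras.  The factor number m is
    split off by [integral_comp_weight]: it suffices to treat the case in which it
    is an indicator, and this case has one general factor less. *)
Lemma integral_prod_indep_upto (m : nat) (g : 'I_n -> T -> R) (e : 'I_n -> R)
    (E : 'I_n -> set T) :
  (forall k : 'I_n, (k < m)%N -> [/\ measurable_fun setT (g k), (forall w, 0 <= g k w),
     (forall B, measurable B -> S k (g k @^-1` B)) &
     (\int[P]_w (g k w)%:E = (e k)%:E)%E]) ->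
  (forall k : 'I_n, (m <= k)%N -> [/\ S k (E k), g k = \1_(E k) & e k = fine (P (E k))]) ->
  (\int[P]_w (\prod_(k < n) g k w)%:E = (\prod_(k < n) e k)%:E)%E.
Proof.
elim: m g e E => [|m IH] g e E hg hE.
  have SE k : S k (E k) by have [] := hE k (leq0n _).
  transitivity (P (\bigcap_(k in [set: 'I_n]) E k)).
    have mE : measurable (\bigcap_(k in [set: 'I_n]) E k).
      by apply: fin_bigcap_measurable => // k _; exact: mS (SE k).
    rewrite -[E in P E]setIT -integral_indic//; apply: eq_integral => w _.
    rewrite -indic_prod; congr (_%:E); apply: eq_bigr => k _.
    by have [_ ->] := hE k (leq0n _).
  rewrite indep// -prodEFin; apply: eq_bigr => k _.
  by have [_ _ ->] := hE k (leq0n _); rewrite fineK// fin_num_measure//; exact: mS.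
have [mn|nm] := ltnP m n; last first.
  apply: (IH g e E) => k km; first by apply: hg; rewrite ltnS ltnW.
  by have := leq_trans (ltn_ord k) (leq_trans nm km); rewrite ltnn.
pose k0 := Ordinal mn.
have [mg0 g0 Sg0 eg0] := hg k0 (ltnSn m).
have measg k : measurable_fun setT (g k).
  have [km|km] := ltnP k m.+1; first by have [] := hg k km.
  by have [SEk -> _] := hE k km; apply: measurable_indic; exact: mS SEk.
have ge0g k w : 0 <= g k w.
  have [km|km] := ltnP k m.+1; first by have [_ + _ _] := hg k km; apply.
  by have [_ -> _] := hE k km.
pose G w := \prod_(k < n | k != k0) g k w.
pose c := \prod_(k < n | k != k0) e k.
have c0 : 0 <= c.
  apply: prodr_ge0 => k _; have [km|km] := ltnP k m.+1.
    by have [_ h _ ek] := hg k km; rewrite -lee_fin -ek integral_ge0// => w _; rewrite lee_fin.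
  by have [_ _ ->] := hE k km; rewrite fine_ge0.
(* |.| stands for the identity, as [integral_comp_weight] needs a nonnegative
   function on the whole line *)
pose hg0 := isMeasurableFun.Build _ _ _ _ _ mg0.
pose rg : {RV P >-> R} := HB.pack (g k0) hg0.
have splitg (h : 'I_n -> R) : \prod_(k < n) h k = h k0 * \prod_(k < n | k != k0) h k.
  by rewrite (bigD1 k0).
have key B : measurable B ->
    (\int[P]_w (\1_(g k0 @^-1` B) w * G w)%:E = c%:E * distribution P rg B)%E.
  move=> mB; set A := g k0 @^-1` B.
  pose g' k := if k == k0 then \1_A else g k.
  pose e' k := if k == k0 then fine (P A) else e k.
  pose E' k := if k == k0 then A else E k.
  have := IH g' e' E' _ _.
  have -> : (\int[P]_w (\prod_(k < n) g' k w)%:E = \int[P]_w (\1_A w * G w)%:E)%E.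
    apply: eq_integral => w _; rewrite splitg /g' eqxx; congr (_ * _)%:E.
    by apply: eq_bigr => k /negbTE ->.
  have -> : \prod_(k < n) e' k = fine (P A) * c.
    by rewrite splitg /e' eqxx; congr (_ * _); apply: eq_bigr => k /negbTE ->.
  move=> ->.
  - rewrite EFinM muleC fineK// fin_num_measure//.
    by apply: mS; exact: Sg0.
  - move=> k km; rewrite /g' /e'; have kk0 : k != k0.
      by apply: contraTneq km => ->; rewrite ltnn.
    by rewrite (negbTE kk0); apply: hg; rewrite ltnS ltnW.
  - move=> k km; rewrite /g' /e' /E'; have [->|kk0] := eqVneq k k0.
      by split => //; exact: Sg0.
    by apply: hE; rewrite ltn_neqAle km andbT eq_sym -(inj_eq val_inj) in kk0 *.
have mG : measurable_fun setT G.
  rewrite (_ : G = fun w => \prod_(k <- [seq k <- index_enum 'I_n | k != k0]) g k w).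
    exact: measurable_prod.
  by apply/funext => w; rewrite big_filter.
have mnorm : measurable_fun [set: R] (fun x : R => `|x|) by exact: normr_measurable.
have G0 w : 0 <= G w by apply: prodr_ge0.
have norm0 (x : R) : 0 <= `|x| by exact: normr_ge0.
have nn := @integral_comp_weight _ _ _ _ R P (distribution P rg) (g k0) G c
  (fun x : R => `|x|) mg0 mG G0 c0 key mnorm norm0.
transitivity (\int[P]_w (`|g k0 w| * G w)%:E)%E.
  by apply: eq_integral => w _; rewrite splitg ger0_norm.
rewrite nn splitg mulrC EFinM; congr (_ * _)%E; rewrite -eg0.
rewrite (@ge0_integral_distribution _ _ _ _ _ _ rg (fun y : R => `|y|%:E))//.
- by apply: eq_integral => w _; rewrite /= ger0_norm.
- exact/measurable_EFinP.
Qed.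

Lemma integral_prod_indep (g : 'I_n -> T -> R) (e : 'I_n -> R) :
  (forall k, [/\ measurable_fun setT (g k), (forall w, 0 <= g k w),
     (forall B, measurable B -> S k (g k @^-1` B)) &
     (\int[P]_w (g k w)%:E = (e k)%:E)%E]) ->
  (\int[P]_w (\prod_(k < n) g k w)%:E = (\prod_(k < n) e k)%:E)%E.
Proof.
move=> h; apply: (@integral_prod_indep_upto n _ _ (fun=> set0)) => k kn //.
by have := leq_ltn_trans kn (ltn_ord k); rewrite ltnn.
Qed.

Lemma chernoff_indep (Z : 'I_n -> T -> R) (c th t : R) :
  (forall k, measurable_fun setT (Z k)) ->
  (forall k B, measurable B -> S k ((fun w => expR (th * Z k w)) @^-1` B)) ->
  (forall k, \int[P]_w (expR (th * Z k w))%:E <= (expR c)%:E)%E ->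
  0 <= th ->
  (P [set w | (n%:R * t <= \sum_(k < n) Z k w)%R] <= (expR (n%:R * (c - th * t)))%:E)%E.
Proof.
move=> mZ SZ hZ th0; set A := [set w | _].
have mg k : measurable_fun setT (fun w => expR (th * Z k w)).
  by apply: measurableT_comp => //; exact: measurable_funM.
have g0 k w : 0 <= expR (th * Z k w) by exact: expR_ge0.
pose e k := fine (\int[P]_w (expR (th * Z k w))%:E)%E.
have eE k : (\int[P]_w (expR (th * Z k w))%:E = (e k)%:E)%E.
  rewrite fineK// ge0_fin_numE; first exact: le_lt_trans (hZ k) (ltry _).
  by apply: integral_ge0 => w _; rewrite lee_fin.
have e0 k : 0 <= e k.
  by rewrite -lee_fin -eE; apply: integral_ge0 => w _; rewrite lee_fin.
have ec k : e k <= expR c by rewrite -lee_fin -eE.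
have prodE := @integral_prod_indep (fun k w => expR (th * Z k w)) e
  (fun k => And4 (mg k) (g0 k) (SZ k) (eE k)).
have mA : measurable A.
  have msum : measurable_fun setT (fun w => \sum_(k < n) Z k w) by exact: measurable_sum.
  rewrite (_ : A = (fun w => \sum_(k < n) Z k w) @^-1` `[n%:R * t, +oo[).
    by rewrite -[X in measurable X]setTI; apply: msum.
  by apply/seteqP; split => w /=; rewrite in_itv /= andbT.
have : (\int[P]_w ((expR (th * (n%:R * t)))%:E * (\1_A w)%:E) <= (\prod_(k < n) e k)%:E)%E.
  rewrite -prodE; apply: ge0_le_integral => //.
  all: try (by move=> w _; rewrite -?EFinM lee_fin ?mulr_ge0 ?expR_ge0).
  - apply: measurable_funeM; apply/measurable_EFinP; exact: measurable_indic.
  - by apply/measurable_EFinP; apply: measurable_prod => k _; exact: mg.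
  - move=> w _; rewrite -EFinM lee_fin indicE.
    case: (boolP (w \in A)) => [/set_mem wA|_]; last by rewrite mulr0 prodr_ge0.
    rewrite mulr1 -expR_sum ler_expR -mulr_sumr; exact: ler_wpM2l.
have -> : (\int[P]_w ((expR (th * (n%:R * t)))%:E * (\1_A w)%:E) =
   (expR (th * (n%:R * t)))%:E * P A)%E.
  rewrite ge0_integralZl//; first by rewrite integral_indic// setIT.
  by apply/measurable_EFinP; exact: measurable_indic.
rewrite -lee_pdivlMl ?expR_gt0// => /le_trans; apply.
rewrite -EFinM lee_fin -expRN.
have -> : n%:R * (c - th * t) = - (th * (n%:R * t)) + n%:R * c by ring.
rewrite expRD expRM_natl ler_wpM2l ?expR_ge0//.
rewrite -[n in leRHS]card_ord -prodr_const; apply: ler_prod => k _.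
by rewrite e0 ec.
Qed.

End independent_product.

(** * Concentration of empirical covariances *)

Definition empcov (T : Type) (R : realType) (n p : nat)
    (X : 'I_n -> 'I_p -> T -> R) (a b : 'cV[R]_p) (w : T) : R :=
  n%:R^-1 * \sum_(k < n) lincomb (X k) a w * lincomb (X k) b w.

Lemma expR_ln4 (R : realType) (q : R) : 0 < q -> q ^- 4 = expR (- (4 * ln q)).
Proof. by move=> q0; rewrite expRN (expRM_natl 4) lnK ?posrE. Qed.

Section row_tails.
Context d (T : measurableType d) (R : realType) (P : probability T R).
Context (n p : nat) (Sigma : 'M[R]_p) (X : 'I_n -> 'I_p -> {RV P >-> R}).
Hypothesis n0 : (0 < n)%N.
Hypothesis symS : Sigma^T = Sigma.
Hypothesis posS : forall v : 'cV[R]_p, v != 0 -> 0 < quad Sigma v.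
Hypothesis gX : forall k, gaussian_vector (X k) Sigma.
Hypothesis iX : independent_rows X.
Local Notation cov := (empcov (fun k j => X k j : T -> R)).

Let S (k : 'I_n) : set (set T) := g_sigma_preimage (fun j (w : T) => X k j w).

Let mS k A : S k A -> measurable A.
Proof.
apply: smallest_sub => [|B]; first exact: sigma_algebra_measurable.
elim/big_ind: _ => //.
  by move=> G H hG hH [/hG|/hH].
by move=> j _ [C mC <-]; exact: measurable_funP.
Qed.

Let rn : 0 < n%:R :> R. Proof. by rewrite ltr0n. Qed.

Lemma measurable_empcov a b : measurable_fun setT (cov a b).
Proof.
apply: measurable_funM => //; apply: measurable_sum => k.
by apply: measurable_funM; exact: measurable_lincomb.
Qed.

Lemma measurable_deviation (a b : 'cV[R]_p) (kappa t : R) :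
  measurable [set w | t <= `|cov a b w - kappa|].
Proof.
have mf : measurable_fun setT (fun w => `|cov a b w - kappa|).
  by apply: measurableT_comp => //; apply: measurable_funB => //; exact: measurable_empcov.
rewrite (_ : [set _ | _] = (fun w => `|cov a b w - kappa|) @^-1` `[t, +oo[).
  by rewrite -[X in measurable X]setTI; apply: mf.
by apply/seteqP; split => w /=; rewrite in_itv /= andbT.
Qed.

Lemma one_sided_tail (eps kappa c th t : R) (a b : 'cV[R]_p) :
  (forall k, \int[P]_w (expR (th * (eps * (lincomb (X k) a w * lincomb (X k) b w - kappa))))%:E
     <= (expR c)%:E)%E -> 0 <= th ->
  (P [set w | (t <= eps * (cov a b w - kappa))%R] <= (expR (n%:R * (c - th * t)))%:E)%E.
Proof.
move=> hZ th0.
pose Z k w := eps * (lincomb (X k) a w * lincomb (X k) b w - kappa).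
have := @chernoff_indep _ T R P n S mS iX Z c th t _ _ hZ th0.
have sumZ w : \sum_(k < n) Z k w = n%:R * (eps * (cov a b w - kappa)).
  rewrite /Z -mulr_sumr sumrB sumr_const card_ord /empcov -[kappa *+ n]mulr_natl.
  by rewrite [RHS]mulrCA; congr (_ * _); rewrite mulrBr mulVKf// gt_eqF.
have -> : [set w | n%:R * t <= \sum_(k < n) Z k w] = [set w | t <= eps * (cov a b w - kappa)].
  by apply/seteqP; split => w /=; rewrite sumZ ler_pM2l.
apply.
- move=> k; apply: measurable_funM => //; apply: measurable_funB => //.
  by apply: measurable_funM; exact: measurable_lincomb.
- move=> k B mB.
  apply: (@g_sigma_preimage_product _ T R p (X k) a b
    (fun y => expR (th * (eps * (y - kappa)))) B) => //.
  apply: measurableT_comp => //; apply: measurable_funM => //.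
  by apply: measurable_funM => //; exact: measurable_funB.
Qed.

Lemma two_sided_tail (kappa c th t : R) (a b : 'cV[R]_p) :
  (forall (eps : R) (k : 'I_n), `|eps| = 1 ->
     (\int[P]_w (expR (th * (eps * (lincomb (X k) a w * lincomb (X k) b w - kappa))))%:E
     <= (expR c)%:E)%E) -> 0 <= th ->
  (P [set w | (t <= `|cov a b w - kappa|)%R] <= (2 * expR (n%:R * (c - th * t)))%:E)%E.
Proof.
move=> hZ th0.
have mside eps : measurable [set w | t <= eps * (cov a b w - kappa)].
  have mf : measurable_fun setT (fun w => eps * (cov a b w - kappa)).
    apply: measurable_funM => //; apply: measurable_funB => //.
    exact: measurable_empcov.
  rewrite (_ : [set _ | _] = (fun w => eps * (cov a b w - kappa)) @^-1` `[t, +oo[).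
    by rewrite -[X in measurable X]setTI; apply: mf.
  by apply/seteqP; split => w /=; rewrite in_itv /= andbT.
have h1 := @one_sided_tail 1 kappa c th t a b (fun k => hZ 1 k (normr1 R)) th0.
have n1 : `|-1 : R| = 1 by rewrite normrN1.
have h2 := @one_sided_tail (-1) kappa c th t a b (fun k => hZ (-1) k n1) th0.
have sub : [set w | t <= `|cov a b w - kappa|] `<=`
   [set w | t <= 1 * (cov a b w - kappa)] `|` [set w | t <= -1 * (cov a b w - kappa)].
  move=> w /=; rewrite mul1r mulN1r; case: (ger0P (cov a b w - kappa)) => _ h.
    by left.
  by right.
apply: (le_trans (le_measure _ _ _ sub)); rewrite ?inE//.
- exact: measurable_deviation.
- exact: measurableU.
apply: (le_trans (measureU2 P (mside 1) (mside (-1)))).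
rewrite (_ : 2 * expR _ = expR (n%:R * (c - th * t)) + expR (n%:R * (c - th * t))).
  by rewrite EFinD leeD.
by rewrite mulr2n mulrDl mul1r.
Qed.

(** Chernoff with parameter t / 3, which minimizes 3/2 th^2 - th t. *)
Lemma crude_tail (a b : 'cV[R]_p) (t q : R) :
  quad Sigma a = 1 -> quad Sigma b = 1 -> 0 <= t -> t <= 1 / 2 -> 0 < q ->
  4 * ln q <= n%:R * (t ^+ 2 / 6) ->
  (P [set w | (t <= `|cov a b w - bil Sigma a b|)%R] <= (2 * q ^- 4)%:E)%E.
Proof.
move=> qa qb t0 t1 q0 hq.
have hphi : `|t / 3| <= 1 / 6 by rewrite ger0_norm ?divr_ge0//; lra.
have := @two_sided_tail (bil Sigma a b) (3 / 2 * (t / 3) ^+ 2) (t / 3) t a b.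
move=> /(_ _ _)/le_trans; apply.
- move=> eps k he; have he' : `|t / 3 * eps| <= 1 / 6 by rewrite normrM he mulr1.
  under eq_integral do rewrite mulrA.
  have := unit_product_mgf symS posS (gX k) qa qb he'.
  rewrite exprMn -[eps ^+ 2]real_normK ?num_real// he expr1n mulr1; exact.
- by rewrite divr_ge0.
rewrite lee_fin ler_wpM2l// expR_ln4// ler_expR.
have -> : 3 / 2 * (t / 3) ^+ 2 - t / 3 * t = - (t ^+ 2 / 6) by field.
by rewrite mulrN lerN2.
Qed.

(** Chernoff with parameter t.  To leading order the exponent is - n t^2 / 2,
    against - n t^2 / 6 in [crude_tail]. *)
Lemma sharp_tail (a b : 'cV[R]_p) (t q : R) :
  quad Sigma a = 1 -> quad Sigma b = 1 -> bil Sigma a b = 0 ->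
  0 <= t -> t < 1 / 2 -> 0 < q ->
  4 * ln q <= n%:R * (t ^+ 2 - t ^+ 2 / (2 * (1 - t ^+ 2))) ->
  (P [set w | (t <= `|cov a b w|)%R] <= (2 * q ^- 4)%:E)%E.
Proof.
move=> qa qb ab t0 t1 q0 hq.
have := @two_sided_tail 0 (t ^+ 2 / (2 * (1 - t ^+ 2))) t t a b.
have -> : [set w | t <= `|cov a b w - 0|] = [set w | t <= `|cov a b w|].
  by apply/seteqP; split => w /=; rewrite subr0.
move=> /(_ _ t0)/le_trans; apply.
- move=> eps k he; under eq_integral do rewrite subr0.
  have e2 : eps ^+ 2 = 1 by rewrite -[eps ^+ 2]real_normK ?num_real// he expr1n.
  have qea : quad Sigma (eps *: a) = 1 by rewrite quad_scale e2 mul1r.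
  have eab : bil Sigma (eps *: a) b = 0 by rewrite bilZl ab mulr0.
  apply: le_trans (uncorrelated_product_mgf symS (gX k) qea qb eab t0 t1).
  rewrite le_eqVlt; apply/orP; left; apply/eqP.
  by apply: eq_integral => w _; rewrite lincombZ; congr (expR _)%:E; ring.
rewrite lee_fin ler_wpM2l// expR_ln4// ler_expR.
by rewrite -expr2 -opprB mulrN lerN2.
Qed.

End row_tails.

(** * Coordinate-restricted norms *)

Section finite_sums.
Context (R : realType) (I : finType).
Implicit Types (J : {set I}) (a b : I -> R).

Lemma cauchy_schwarz_sum J a b :
  (\sum_(j in J) a j * b j) ^+ 2 <= (\sum_(j in J) a j ^+ 2) * (\sum_(j in J) b j ^+ 2).
Proof.
set A := \sum_(j in J) a j ^+ 2; set B := \sum_(j in J) b j ^+ 2.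
set C := \sum_(j in J) a j * b j.
have A0 : 0 <= A by apply: sumr_ge0 => j _; exact: sqr_ge0.
have h : 0 <= A * (A * B - C ^+ 2).
  have -> : A * (A * B - C ^+ 2) = \sum_(j in J) (A * b j - C * a j) ^+ 2.
    under eq_bigr do rewrite sqrrB !exprMn.
    rewrite !big_split /= -!mulr_sumr -/A -/B sumrN.
    have -> : \sum_(j in J) A * b j * (C * a j) *+ 2 = 2 * A * C * C.
      rewrite -[RHS]/(2 * A * C * \sum_(j in J) a j * b j) mulr_sumr.
      by apply: eq_bigr => j _; rewrite -mulr_natl; ring.
    ring.
  by apply: sumr_ge0 => j _; exact: sqr_ge0.
have [A0'|An0] := eqVneq A 0.
  have a0 j : j \in J -> a j = 0.
    move=> jJ; apply/eqP; rewrite -sqrf_eq0 eq_le sqr_ge0 andbT -A0' /A (bigD1 j)//= lerDl.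
    by apply: sumr_ge0 => k _; exact: sqr_ge0.
  by rewrite A0' mul0r /C big1 ?expr0n// => j jJ; rewrite a0// mul0r.
have Ap : 0 < A by rewrite lt_neqAle eq_sym An0.
by rewrite -subr_ge0; rewrite pmulr_rge0 in h.
Qed.

End finite_sums.

Section norms.
Context (R : realType) (p : nat).
Implicit Types (J : {set 'I_p}) (v : 'cV[R]_p).

Lemma norm2_ge0 J v : 0 <= norm2 J v. Proof. exact: sqrtr_ge0. Qed.
Lemma norm1_ge0 J v : 0 <= norm1 J v. Proof. by apply: sumr_ge0. Qed.

Lemma norm2_sq J v : norm2 J v ^+ 2 = \sum_(j in J) v j 0 ^+ 2.
Proof. by rewrite sqr_sqrtr//; apply: sumr_ge0 => j _; exact: sqr_ge0. Qed.

Lemma norm2_subset J J' v : J \subset J' -> norm2 J v <= norm2 J' v.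
Proof.
move=> sJ; rewrite ler_wsqrtr// [leRHS](big_setID J) /= (finset.setIidPr sJ) lerDl.
by apply: sumr_ge0 => j _; exact: sqr_ge0.
Qed.

Lemma norm_coord_le J v j : j \in J -> `|v j 0| <= norm2 J v.
Proof.
move=> jJ; rewrite -sqrtr_sqr ler_wsqrtr// (bigD1 j)//= lerDl.
by apply: sumr_ge0 => k _; exact: sqr_ge0.
Qed.

Lemma norm1_le_norm2 J v : norm1 J v <= Num.sqrt #|J|%:R * norm2 J v.
Proof.
rewrite -(@ler_pXn2r _ 2)// ?nnegrE ?mulr_ge0 ?sqrtr_ge0 ?norm1_ge0 ?norm2_ge0//.
rewrite exprMn norm2_sq sqr_sqrtr// /norm1.
have := cauchy_schwarz_sum J (fun=> 1) (fun j => `|v j 0|).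
under eq_bigr do rewrite mul1r.
under [X in _ <= X * _]eq_bigr do rewrite expr1n.
by rewrite sumr_const; under [X in _ <= _ * X]eq_bigr do rewrite real_normK ?num_real//.
Qed.

Lemma norm1_setID J v : norm1 [set: 'I_p] v = norm1 J v + norm1 (~: J) v.
Proof. by rewrite /norm1 (big_setID J) /= finset.setTI finset.setTD. Qed.

Lemma norm1_supp J v : (forall j, j \notin J -> v j 0 = 0) -> norm1 (~: J) v = 0.
Proof. by move=> h; apply: big1 => j; rewrite inE => /h ->; rewrite normr0. Qed.

Lemma norm2_eq0 J v : norm2 J v = 0 -> forall j, j \in J -> v j 0 = 0.
Proof.
move=> h j jJ; apply/eqP; rewrite -normr_eq0 eq_le normr_ge0 andbT -h.
exact: norm_coord_le.
Qed.

Lemma norm2_gt0 J v : v != 0 -> (forall j, j \notin J -> v j 0 = 0) -> 0 < norm2 J v.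
Proof.
move=> v0 supp; rewrite lt_neqAle norm2_ge0 andbT eq_sym; apply: contra v0 => /eqP n0.
apply/eqP/matrixP => j k; rewrite (ord1 k) [RHS]mxE.
by have [jJ|jJ] := boolP (j \in J); [exact: (norm2_eq0 n0)|exact: supp].
Qed.

(** Greedily add a largest remaining coordinate. *)
Lemma largest_outside_exists J (m : nat) v : (m <= #|~: J|)%N ->
  exists J', largest_outside J m v J'.
Proof.
elim: m => [|m IH] hm.
  exists finset.set0; split; rewrite ?finset.sub0set ?finset.cards0// => j k.
  by rewrite inE.
have [J' [sub card big]] := IH (ltnW hm).
have [k0 k0N] : exists k, k \in ~: (J :|: J').
  apply/finset.set0Pn; rewrite -finset.card_gt0.
  have h1 := cardsC (J :|: J'); have h2 := cardsC J.
  have h3 : (#|J :|: J'| <= #|J| + m)%N by rewrite -card finset.cardsU leq_subr.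
  move: h1 h2 hm; lia.
pose k1 := [arg max_(k > k0 in ~: (J :|: J')) `|v k 0|]%O.
have [k1N k1max] : k1 \in ~: (J :|: J') /\
    forall k, k \in ~: (J :|: J') -> `|v k 0| <= `|v k1 0|.
  by rewrite /k1; case: arg_maxP.
move: (k1N); rewrite !inE negb_or => /andP[k1J k1J'].
exists (k1 |: J'); split.
- by rewrite finset.subUset finset.sub1set inE k1J.
- by rewrite cardsU1 k1J' card.
- move=> j k; rewrite !inE => /orP[/eqP ->|jJ'].
    rewrite !negb_or => /and3P[kJ _ kJ']; apply: k1max.
    by rewrite !inE negb_or kJ.
  rewrite !negb_or => /and3P[kJ _ kJ']; apply: big => //.
  by rewrite inE negb_or kJ.
Qed.

End norms.

(** * Restricted eigenvalues *)

Lemma quad_gram (R : realType) (m p : nat) (B : 'M[R]_(m, p)) (v : 'cV[R]_p) :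
  quad (B^T *m B) v = \sum_j (B *m v) j 0 ^+ 2.
Proof.
rewrite /quad mulmxA -trmx_mul -mulmxA mxE; apply: eq_bigr => j _.
by rewrite mxE expr2.
Qed.

Lemma quad_scaled_gram_ge0 (R : realType) (n p : nat) (D : 'M[R]_(n, p)) (v : 'cV[R]_p) :
  0 <= quad (n%:R^-1 *: (D^T *m D)) v.
Proof.
rewrite /quad -scalemxAr -scalemxAl mxE mulr_ge0 ?invr_ge0//.
rewrite -[(_ *m _) 0 0]/(quad (D^T *m D) v) quad_gram.
by apply: sumr_ge0 => j _; exact: sqr_ge0.
Qed.

Section restricted_eigenvalue.
Context (R : realType) (p s : nat) (Sigma : 'M[R]_p).
Hypothesis psdS : psdmx Sigma.
Hypothesis diag1 : forall j, Sigma j j = 1.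
Hypothesis s1 : (1 < s)%N.
Hypothesis sp : (2 * s < p)%N.
Hypothesis re0 : 0 < re_inv s s 3 Sigma.
Let symS : Sigma^T = Sigma. Proof. by case: psdS. Qed.

(** Without a square root [sqrtmx Sigma] would be 0 and so would be the restricted
    eigenvalue; hence its positivity replaces a diagonalization of Sigma. *)
Lemma sqrtmxP : psdmx (sqrtmx Sigma) /\ sqrtmx Sigma *m sqrtmx Sigma = Sigma.
Proof.
rewrite /sqrtmx; case: xgetP => [B _ [] //|noB]; exfalso.
move: re0; apply/negP; rewrite -leNgt /re_inv.
set E := [set r | _].
have sub r : E r -> r = 0.
  move=> [J0 [g [J [_ _ _ _ ->]]]]; rewrite /sqrtmx; case: xgetP => [B _ hB|_].
    by case: (noB B).
  rewrite mul0mx /norm2 big1 ?sqrtr0 ?mul0r// => j _.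
  by rewrite mxE expr0n.
have [->|/set0P[r Er]] := eqVneq E set0; first by rewrite inf0.
have lbE : has_lbound E by exists 0 => x /sub ->.
by rewrite (le_trans (ge_inf lbE Er))// (sub _ Er).
Qed.

Lemma norm2_sqrtmx (v : 'cV[R]_p) :
  norm2 [set: 'I_p] (sqrtmx Sigma *m v) = Num.sqrt (quad Sigma v).
Proof.
have [[sB _] BB] := sqrtmxP; congr Num.sqrt.
rewrite -[in RHS]BB -[X in quad (X *m _)]sB quad_gram.
by apply: eq_bigl => j; rewrite inE.
Qed.

Lemma quad_gt0 (v : 'cV[R]_p) : Sigma \in unitmx -> v != 0 -> 0 < quad Sigma v.
Proof.
move=> uS v0; rewrite lt_neqAle (proj2 psdS) andbT eq_sym; apply: contra v0 => /eqP q0.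
have h : norm2 [set: 'I_p] (sqrtmx Sigma *m v) = 0 by rewrite norm2_sqrtmx q0 sqrtr0.
have [_ BB] := sqrtmxP.
have Bv : sqrtmx Sigma *m v = 0.
  by apply/matrixP => j k; rewrite (ord1 k) [RHS]mxE (norm2_eq0 h)// inE.
have Sv : Sigma *m v = 0 by rewrite -BB -mulmxA Bv mulmx0.
by rewrite -(mulKmx uS v) Sv mulmx0.
Qed.

Lemma re_inv_le (J0 J : {set 'I_p}) (g : 'cV[R]_p) : (#|J0| <= s)%N ->
  norm1 (~: J0) g <= 3 * norm1 J0 g -> largest_outside J0 s g J ->
  re_inv s s 3 Sigma ^+ 2 * norm2 (J0 :|: J) g ^+ 2 <= quad Sigma g.
Proof.
move=> hJ0 cone hJ.
have [g0|gn0] := eqVneq g 0.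
  rewrite [X in _ * X](_ : _ = 0) ?mulr0; first exact: (proj2 psdS).
  rewrite g0 norm2_sq big1// => j _; by rewrite mxE expr0n.
have [n0|nn0] := eqVneq (norm2 (J0 :|: J) g) 0.
  by rewrite n0 expr0n mulr0; exact: (proj2 psdS).
have np : 0 < norm2 (J0 :|: J) g by rewrite lt_neqAle eq_sym nn0 norm2_ge0.
have h : re_inv s s 3 Sigma <= Num.sqrt (quad Sigma g) / norm2 (J0 :|: J) g.
  rewrite -norm2_sqrtmx; apply: ge_inf; last by exists J0, g, J.
  exists 0 => r [J0' [g' [J' [_ _ _ _ ->]]]].
  by rewrite divr_ge0 ?norm2_ge0.
move: h; rewrite ler_pdivlMr// -exprMn => h.
rewrite -[leRHS]sqr_sqrtr ?(proj2 psdS)//.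
by rewrite ler_pXn2r ?nnegrE ?sqrtr_ge0// mulr_ge0 ?ltW.
Qed.

Lemma Lambda_min_le (J0 : {set 'I_p}) (g : 'cV[R]_p) : (#|J0| <= s)%N ->
  (forall j, j \notin J0 -> g j 0 = 0) ->
  17 / 16 * Lambda_min Sigma s * norm2 J0 g ^+ 2 <= quad Sigma g.
Proof.
move=> hJ0 supp.
have [g0|gn0] := eqVneq g 0.
  rewrite [X in _ * X](_ : _ = 0) ?mulr0; first exact: (proj2 psdS).
  rewrite g0 norm2_sq big1// => j _; by rewrite mxE expr0n.
have np : 0 < norm2 J0 g by exact: norm2_gt0.
rewrite -ler_pdivlMr ?exprn_gt0// /Lambda_min mulrA.
rewrite (_ : 17 / 16 * (16 / 17) = 1 :> R) ?mul1r; last by field.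
apply: ge_inf; last by exists J0, g.
exists 0 => r [J0' [g' [_ _ _ ->]]].
by rewrite divr_ge0 ?(proj2 psdS)// sqr_ge0.
Qed.

Let i0 : 'I_p. Proof. by exists 0%N; lia. Defined.
Let e0 : 'cV[R]_p := delta_mx i0 0.

Let e0E j : e0 j 0 = (j == i0)%:R. Proof. by rewrite mxE eqxx andbT. Qed.
Let e0N0 : e0 != 0.
Proof.
by apply/eqP => /matrixP/(_ i0 0) /eqP; rewrite e0E eqxx mxE oner_eq0.
Qed.
Let qe0 : quad Sigma e0 = 1.
Proof. by rewrite /quad /e0 trmx_delta -rowE -colE !mxE diag1. Qed.
Let ne0 (J : {set 'I_p}) : i0 \in J -> norm2 J e0 ^+ 2 = 1.
Proof.
move=> h; rewrite norm2_sq (bigD1 i0)//= e0E eqxx expr1n big1 ?addr0// => j /andP[_ /negbTE ji].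
by rewrite e0E ji expr0n.
Qed.

(** Test the definition on a unit vector: Sigma has unit diagonal. *)
Lemma re_inv_le1 : re_inv s s 3 Sigma <= 1.
Proof.
have c1 : (#|[set i0]%SET| <= s)%N by rewrite cards1 ltnW.
have [J hJ] : exists J, largest_outside [set i0]%SET s e0 J.
  by apply: largest_outside_exists; rewrite cardsCs finset.setCK cards1 card_ord; lia.
have cone : norm1 (~: [set i0]%SET) e0 <= 3 * norm1 [set i0]%SET e0.
  rewrite norm1_supp ?mulr_ge0 ?norm1_ge0// => j; rewrite inE e0E.
  by move/negbTE ->.
have := re_inv_le c1 cone hJ; rewrite qe0 ne0 ?mulr1; last by rewrite !inE eqxx.
by rewrite expr_le1 ?(ltW re0).
Qed.

Lemma Lambda_min_le1 : 17 / 16 * Lambda_min Sigma s <= 1.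
Proof.
have c1 : (#|[set i0]%SET| <= s)%N by rewrite cards1 ltnW.
have := @Lambda_min_le [set i0]%SET e0 c1; rewrite ne0 ?inE// mulr1 qe0; apply.
by move=> j; rewrite inE e0E => /negbTE ->.
Qed.

(** Vectors supported in J0 lie in the cone, where the coordinates outside J0 can
    only increase the denominator. *)
Lemma re_inv_sq_le_Lambda : re_inv s s 3 Sigma ^+ 2 <= 17 / 16 * Lambda_min Sigma s.
Proof.
rewrite /Lambda_min mulrA (_ : 17 / 16 * (16 / 17) = 1 :> R) ?mul1r; last by field.
apply: lb_le_inf.
  exists (quad Sigma e0 / norm2 [set i0]%SET e0 ^+ 2); exists [set i0]%SET, e0.
  split=> //; first by rewrite cards1 ltnW.
  by move=> j; rewrite inE e0E => /negbTE ->.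
move=> r [J0 [g [hJ0 gn0 supp ->]]].
have cone : norm1 (~: J0) g <= 3 * norm1 J0 g by rewrite norm1_supp ?mulr_ge0 ?norm1_ge0.
have [J hJ] : exists J, largest_outside J0 s g J.
  apply: largest_outside_exists; have := cardsC J0; rewrite card_ord; lia.
have h := re_inv_le hJ0 cone hJ.
have np : 0 < norm2 J0 g by exact: norm2_gt0.
rewrite ler_pdivlMr ?exprn_gt0//; apply: le_trans h.
rewrite ler_wpM2l ?sqr_ge0// ler_pXn2r ?nnegrE ?norm2_ge0//.
by apply: norm2_subset; exact: finset.subsetUl.
Qed.

End restricted_eigenvalue.

Section gram_perturbation.
Context (R : realType) (p : nat).

Lemma quad_entrywise (D : 'M[R]_p) (eps : R) (h : 'cV[R]_p) :
  (forall j k, `|D j k| <= eps) -> `|quad D h| <= eps * norm1 [set: 'I_p] h ^+ 2.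
Proof.
move=> hD; rewrite quadE bil_sum.
have -> : norm1 [set: 'I_p] h = \sum_j `|h j 0| by apply: eq_bigl => j; rewrite inE.
apply: (le_trans (ler_norm_sum _ _ _)).
rewrite expr2 mulrCA mulr_suml; apply: ler_sum => i _.
rewrite normrM ler_wpM2l// mxE (le_trans (ler_norm_sum _ _ _))// mulr_sumr.
by apply: ler_sum => k _; rewrite normrM ler_wpM2r.
Qed.

End gram_perturbation.

(** * The Lasso *)

Definition dotc (R : realType) (p : nat) (u v : 'cV[R]_p) : R :=
  \sum_j u j 0 * v j 0.

Section dot.
Context (R : realType) (p : nat).
Implicit Types u v g : 'cV[R]_p.

Lemma dotcE u v : dotc u v = (u^T *m v) 0 0.
Proof. by rewrite mxE; apply: eq_bigr => j _; rewrite mxE. Qed.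

Lemma dotcDl u v g : dotc (u + v) g = dotc u g + dotc v g.
Proof. by rewrite /dotc -big_split; apply: eq_bigr => j _; rewrite mxE mulrDl. Qed.

Lemma dotcZl (c : R) u g : dotc (c *: u) g = c * dotc u g.
Proof. by rewrite /dotc mulr_sumr; apply: eq_bigr => j _; rewrite mxE mulrA. Qed.

Lemma dotcNl u g : dotc (- u) g = - dotc u g.
Proof. by rewrite -scaleN1r dotcZl mulN1r. Qed.

Lemma dotcBl u v g : dotc (u - v) g = dotc u g - dotc v g.
Proof. by rewrite dotcDl dotcNl. Qed.

Lemma dotc_suml (I : finType) (P : pred I) (u : I -> 'cV[R]_p) g :
  dotc (\sum_(i | P i) u i) g = \sum_(i | P i) dotc (u i) g.
Proof.
elim/big_ind2: _ => [|u1 x u2 y <- <-|//]; last exact: dotcDl.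
by rewrite /dotc big1// => j _; rewrite mxE mul0r.
Qed.

Lemma bil_dotc (A : 'M[R]_p) u v : bil A u v = dotc u (A *m v).
Proof. exact: bil_sum. Qed.

Lemma dotc_le_norm1 (J : {set 'I_p}) u g (c : R) :
  (forall j, j \notin J -> u j 0 = 0) -> (forall j, j \in J -> u j 0 != 0 -> `|g j 0| <= c) ->
  `|dotc u g| <= c * norm1 J u.
Proof.
move=> supp hg; rewrite /dotc (bigID [in J]) /= [X in _ + X]big1 ?addr0; last first.
  by move=> j /supp ->; rewrite mul0r.
rewrite (le_trans (ler_norm_sum _ _ _))// /norm1 mulr_sumr; apply: ler_sum => j jJ.
rewrite normrM mulrC; have [->|u0] := eqVneq (u j 0) 0; first by rewrite normr0 !mulr0.
by rewrite ler_wpM2r// hg.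
Qed.

Lemma dotc_le_norm2 (J : {set 'I_p}) u g (c : R) :
  (forall j, j \notin J -> u j 0 = 0) -> (forall j, j \in J -> `|g j 0| <= c) -> 0 <= c ->
  `|dotc u g| <= c * (Num.sqrt #|J|%:R * norm2 J u).
Proof.
move=> supp hg c0; apply: (le_trans (dotc_le_norm1 supp (fun j h _ => hg j h))).
by rewrite ler_wpM2l// norm1_le_norm2.
Qed.

End dot.

(** All estimators are compared through this second order expansion, which is
    exact: the increment of the loss depends on the data through the noise
    X^T V / n and the Gram matrix X^T X / n alone. *)
Lemma quad_loss_expand (R : realType) (n p : nat) (D : 'M[R]_(n, p)) (i : 'I_p)
    (b h : 'cV[R]_p) :
  quad_loss D i (b + h) = quad_loss D i b
    - dotc h (n%:R^-1 *: (D^T *m (col i D - D *m b)))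
    + quad (n%:R^-1 *: (D^T *m D)) h / 2.
Proof.
rewrite /quad_loss; set V := col i D - D *m b.
have -> : col i D - D *m (b + h) = V - D *m h by rewrite mulmxDr opprD addrA.
rewrite !norm2_sq.
have sT (f : 'I_n -> R) : \sum_(j in [set: 'I_n]%SET) f j = \sum_j f j.
  by apply: eq_bigl => j; rewrite inE.
rewrite !sT.
have -> : dotc h (n%:R^-1 *: (D^T *m V)) = n%:R^-1 * \sum_j V j 0 * (D *m h) j 0.
  rewrite dotcE -scalemxAr mxE mulmxA -trmx_mul [in LHS]mxE; congr (_ * _).
  by apply: eq_bigr => j _; rewrite [(D *m h)^T _ _]mxE mulrC.
have -> : quad (n%:R^-1 *: (D^T *m D)) h = n%:R^-1 * \sum_j (D *m h) j 0 ^+ 2.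
  by rewrite -quad_gram /quad -scalemxAr -scalemxAl mxE.
have -> : \sum_j (V - D *m h) j 0 ^+ 2 = \sum_j V j 0 ^+ 2
   - 2 * \sum_j V j 0 * (D *m h) j 0 + \sum_j (D *m h) j 0 ^+ 2.
  rewrite mulr_sumr -sumrB -big_split; apply: eq_bigr => j _ /=.
  rewrite [(V - _) _ _]mxE [(- (D *m h)) _ _]mxE; ring.
by rewrite invfM; move: (n%:R^-1) => v; field.
Qed.

Section lasso.
Context (R : realType) (p : nat).
Variables (A : 'M[R]_p) (S : {set 'I_p}) (b h g : 'cV[R]_p) (lam : R).
Hypothesis lam0 : 0 < lam.
Hypothesis bS : forall j, j \notin S -> b j 0 = 0.
Hypothesis hg : forall j, h j 0 != 0 -> `|g j 0| <= lam / 2.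

(** The basic inequality: the noise costs at most lam / 2 times the l1 norm of the
    error, and the penalty pays lam for the error off S and costs lam on S. *)
Lemma lasso_cone :
  - dotc h g + quad A h / 2 + lam * norm1 [set: 'I_p] (b + h) <= lam * norm1 [set: 'I_p] b ->
  quad A h + lam * norm1 (~: S) h <= 3 * lam * norm1 S h.
Proof.
move=> opt.
have hd : dotc h g <= lam / 2 * norm1 [set: 'I_p] h.
  rewrite (le_trans (ler_norm _))//; apply: dotc_le_norm1.
    by move=> j; rewrite inE.
  by move=> j _; exact: hg.
have e1 : norm1 [set: 'I_p] b = norm1 S b by rewrite (norm1_setID S) norm1_supp ?addr0.
have e2 : norm1 (~: S) (b + h) = norm1 (~: S) h.
  by apply: eq_bigr => j; rewrite inE => /bS e; rewrite mxE e add0r.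
have e3 : norm1 S b - norm1 S h <= norm1 S (b + h).
  rewrite /norm1 -sumrB; apply: ler_sum => j _; rewrite mxE.
  by rewrite -[X in `|X| - _](addrK (h j 0)) lerBlDr (le_trans (ler_normB _ _))// lexx.
rewrite (norm1_setID S (b + h)) e2 e1 in opt.
rewrite (norm1_setID S) in hd.
have := ler_wpM2l (ltW lam0) e3; lra.
Qed.

(** With x = norm2 (S u J) h, the hypotheses give
    x^2 + K2 lam |h|_1(S^c) <= 3 K2 lam m x.  The first term bounds x; a coordinate
    outside S u J is no larger than those of J, hence also at most x.
    Maximizing 3 u x - x^2 over x bounds the second term by 9/4 u^2, where
    u = K2 lam m. *)
Lemma lasso_error (J : {set 'I_p}) (s : nat) (K2 : R) :
  (0 < s)%N -> 0 < K2 -> largest_outside S s h J ->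
  norm2 (S :|: J) h ^+ 2 <= K2 * quad A h ->
  quad A h + lam * norm1 (~: S) h <= 3 * lam * norm1 S h ->
  (forall j, `|h j 0| <= 3 * K2 * lam * Num.sqrt #|S|%:R) /\
  norm1 (~: S) h <= 9 / 4 * K2 * lam * #|S|%:R.
Proof.
move=> s0 K20 [sJ cJ bigJ] hx cone.
set x := norm2 (S :|: J) h in hx *; set m := Num.sqrt #|S|%:R.
have x0 : 0 <= x by exact: norm2_ge0.
have m0 : 0 <= m by exact: sqrtr_ge0.
have m2 : m ^+ 2 = #|S|%:R by rewrite sqr_sqrtr.
have ha : norm1 S h <= m * x.
  rewrite (le_trans (norm1_le_norm2 _ _))// ler_wpM2l//.
  by apply: norm2_subset; exact: finset.subsetUl.
have c0 : 0 <= norm1 (~: S) h by exact: norm1_ge0.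
have la : lam * norm1 S h <= lam * (m * x) by rewrite ler_wpM2l// ltW.
have lc : 0 <= lam * norm1 (~: S) h by rewrite mulr_ge0// ltW.
have hx2 : x ^+ 2 + K2 * (lam * norm1 (~: S) h) <= 3 * K2 * lam * m * x.
  have : K2 * (quad A h + lam * norm1 (~: S) h) <= K2 * (3 * (lam * (m * x))).
    rewrite ler_wpM2l ?(ltW K20)//; lra.
  move: hx; rewrite mulrDr; lra.
have xb : x <= 3 * K2 * lam * m.
  have [->|xn0] := eqVneq x 0; first by rewrite !mulr_ge0// ltW.
  have xp : 0 < x by rewrite lt_neqAle eq_sym xn0.
  have : x * x <= 3 * K2 * lam * m * x.
    have : 0 <= K2 * (lam * norm1 (~: S) h) by apply: mulr_ge0 => //; exact: ltW.
    by move: hx2; rewrite expr2; lra.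
  by rewrite ler_pM2r.
split.
  move=> j; apply: le_trans xb.
  have [jSJ|jSJ] := boolP (j \in S :|: J); first exact: norm_coord_le.
  have /finset.set0Pn[k kJ] : J != finset.set0 by rewrite -finset.card_gt0 cJ.
  apply: (le_trans (bigJ _ _ kJ jSJ)); apply: norm_coord_le.
  by rewrite inE kJ orbT.
have : K2 * (lam * norm1 (~: S) h) <= 9 / 4 * (K2 * lam * m) ^+ 2.
  have := sqr_ge0 (x - 3 / 2 * (K2 * lam * m)); move: hx2.
  set u := K2 * (lam * _); nra.
have -> : 9 / 4 * (K2 * lam * m) ^+ 2 = K2 * (lam * (9 / 4 * K2 * lam * #|S|%:R)).
  by rewrite -m2; ring.
by rewrite ler_pM2l// ler_pM2l.
Qed.

(** Neighbours pass the threshold 4 lam because b is large there; each other index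
    that passes it contributes more than 4 lam to the l1 error off S. *)
Lemma sbar_bounds (i : 'I_p) (K2 delta : R) : i \notin S ->
  (forall j, `|h j 0| <= delta) ->
  (forall j, j \in S -> 4 * lam + delta < `|b j 0|) ->
  norm1 (~: S) h <= 9 / 4 * K2 * lam * #|S|%:R ->
  (#|S| <= sbar i lam (b + h))%N /\
  (sbar i lam (b + h))%:R <= (1 + 9 / 16 * K2) * #|S|%:R.
Proof.
move=> iS hd bmin hc; rewrite /sbar.
set E := [pred j | _]; split.
  apply: subset_leq_card; apply/fintype.subsetP => j jS; rewrite inE.
  rewrite (_ : j != i) /=; last by apply: contraNneq iS => <-.
  rewrite mxE; have := bmin j jS; have := hd j.
  have := ler_normB (b j 0 + h j 0) (h j 0); rewrite addrK; lra.
rewrite -(cardID [in S] E) natrD mulrDl mul1r lerD//.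
  by rewrite ler_nat; apply: subset_leq_card; apply/fintype.subsetP => j; rewrite !inE => /andP[].
have : 4 * lam * #|[predD E & [in S]]|%:R <= norm1 (~: S) h.
  rewrite -sum1_card natr_sum mulr_sumr /norm1 [leRHS](bigID E) /=.
  rewrite -[leLHS]addr0 lerD ?sumr_ge0//.
  rewrite (eq_bigl (fun j => (j \in ~: S) && E j)); last by move=> j; rewrite !inE.
  apply: ler_sum => j; rewrite !inE => /andP[jS /andP[_]].
  by rewrite mxE bS// add0r mulr1 => /ltW.
move=> /le_trans /(_ hc) => h2.
rewrite -(ler_pM2l (_ : 0 < 4 * lam)) ?mulr_gt0//; lra.
Qed.

End lasso.

(** * Regression on a set of variables *)

(** A is positive definite on vectors supported in S, so the matrix that equals A
    on S x S and the identity elsewhere is invertible.  With y a column of A the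
    solution is the projection of a variable on those of S, for the population
    (A = Sigma) as for the sample (A the Gram matrix). *)
Lemma restricted_solve (R : realType) (p : nat) (A : 'M[R]_p) (S : {set 'I_p}) (y : 'cV[R]_p) :
  (forall v : 'cV[R]_p, (forall j, j \notin S -> v j 0 = 0) -> v != 0 -> 0 < quad A v) ->
  exists theta : 'cV[R]_p, (forall j, j \notin S -> theta j 0 = 0) /\
    (forall k, k \in S -> (A *m theta) k 0 = y k 0).
Proof.
move=> pos.
pose B : 'M[R]_p := \matrix_(k, l) (if (k \in S) && (l \in S) then A k l else (k == l)%:R).
have BN v k : k \notin S -> (B *m v : 'cV[R]_p) k 0 = v k 0.
  move=> kS; rewrite mxE (bigD1 k)//= big1 ?addr0 => [|l lk].
    by rewrite mxE (negbTE kS) eqxx mul1r.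
  by rewrite mxE (negbTE kS) /= eq_sym (negbTE lk) mul0r.
have BS (v : 'cV[R]_p) k : (forall j, j \notin S -> v j 0 = 0) -> k \in S ->
    (B *m v : 'cV[R]_p) k 0 = (A *m v) k 0.
  move=> vS kS; rewrite !mxE; apply: eq_bigr => l _; rewrite mxE kS /=.
  by have [//|lS] := boolP (l \in S); rewrite vS// !mulr0.
have uB : B \in unitmx.
  rewrite -unitmx_tr -row_free_unit -kermx_eq0; apply/rowV0P => v /sub_kermxP vB.
  have Bv : B *m v^T = 0 by rewrite -[B]trmxK -trmx_mul vB trmx0.
  have vS j : j \notin S -> v^T j 0 = 0 by move=> jS; rewrite -BN// Bv mxE.
  apply/eqP; rewrite -trmx_eq0; apply: contraT => /(pos _ vS).
  rewrite quadE bil_sum big1 ?ltxx// => j _; have [jS|jS] := boolP (j \in S).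
    by rewrite -BS// Bv [X in _ * X]mxE mulr0.
  by rewrite vS// mul0r.
pose y' : 'cV[R]_p := \col_k (if k \in S then y k 0 else 0).
exists (invmx B *m y').
have hB : B *m (invmx B *m y') = y' by rewrite mulKVmx.
have hN j : j \notin S -> (invmx B *m y') j 0 = 0.
  by move=> jS; rewrite -BN// hB mxE (negbTE jS).
by split=> // k kS; rewrite -BS// hB mxE kS.
Qed.

Definition reg_vec (R : realType) (p : nat) (Sigma : 'M[R]_p) (i : 'I_p) : 'cV[R]_p :=
  \col_j (if j == i then 0 else reg_coef Sigma i j).

Section regression.
Context (R : realType) (p : nat) (Sigma : 'M[R]_p).
Hypothesis symS : Sigma^T = Sigma.
Hypothesis uS : Sigma \in unitmx.
Hypothesis posS : forall v : 'cV[R]_p, v != 0 -> 0 < quad Sigma v.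
Let Om := invmx Sigma.

Lemma residualE (n : nat) (D : 'M[R]_(n, p)) i :
  residual Sigma D i = col i D - D *m reg_vec Sigma i.
Proof.
apply/matrixP => k l; rewrite (ord1 l) /residual !mxE summxE; congr (_ - _).
rewrite [RHS](bigD1 i)//= !mxE eqxx mulr0 add0r; apply: eq_bigr => j /negbTE ji.
by rewrite !mxE ji mulrC.
Qed.

Lemma residual_mulE (n : nat) (D : 'M[R]_(n, p)) i :
  residual Sigma D i = D *m (delta_mx i 0 - reg_vec Sigma i).
Proof. by rewrite residualE mulmxBr -colE. Qed.

Lemma quad_delta j : quad Sigma (delta_mx j 0) = Sigma j j.
Proof. by rewrite /quad trmx_delta -rowE -colE !mxE. Qed.

Lemma bil_delta_l j (v : 'cV[R]_p) : bil Sigma (delta_mx j 0) v = (Sigma *m v) j 0.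
Proof. by rewrite /bil trmx_delta -rowE -row_mul mxE. Qed.

Lemma precision_diag_gt0 i : 0 < Om i i.
Proof.
have d0 : delta_mx i 0 != 0 :> 'cV[R]_p.
  by apply/eqP => /matrixP/(_ i 0)/eqP; rewrite !mxE !eqxx oner_eq0.
have v0 : Om *m (delta_mx i 0 : 'cV[R]_p) != 0.
  by apply: contra d0 => /eqP h; rewrite -(mulKVmx uS (delta_mx i 0)) -/Om h mulmx0.
have := posS v0; rewrite quadE bil_sum mulKVmx// (bigD1 i)//= big1 => [|j ji].
  by rewrite [delta_mx _ _ _ _]mxE !eqxx mulr1 addr0 -colE mxE.
by rewrite [delta_mx _ _ _ _]mxE (negbTE ji) mulr0.
Qed.

(** The residual V_i is a multiple of the i-th coordinate of the inverse of Sigma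
    applied to X; therefore it is uncorrelated with every other variable. *)
Lemma reg_residual_vecE i :
  delta_mx i 0 - reg_vec Sigma i = (Om i i)^-1 *: (Om *m delta_mx i 0).
Proof.
have symO : Om^T = Om by rewrite /Om trmx_inv symS.
apply/matrixP => j k; rewrite (ord1 k) -colE !mxE eqxx andbT.
have -> : Om j i = Om i j by rewrite -[in LHS]symO mxE.
have [->|ji] := eqVneq j i; first by rewrite subr0 mulVf// gt_eqF// precision_diag_gt0.
by rewrite sub0r /reg_coef opprK mulrC.
Qed.

Lemma Sigma_reg_residual i k :
  (Sigma *m (delta_mx i 0 - reg_vec Sigma i)) k 0 = (k == i)%:R / Om i i.
Proof. by rewrite reg_residual_vecE -scalemxAr mulKVmx// !mxE eqxx andbT mulrC. Qed.

Lemma quad_reg_residual i : quad Sigma (delta_mx i 0 - reg_vec Sigma i) = (Om i i)^-1.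
Proof.
rewrite quadE bil_sum (bigD1 i)//= Sigma_reg_residual big1 => [|j ji].
  by rewrite eqxx !mxE !eqxx subr0 addr0 !mul1r.
by rewrite Sigma_reg_residual (negbTE ji) mul0r mulr0.
Qed.

End regression.

(** * The adaptive Lasso *)

(** The estimator is b + h; [obj v] is the objective at b + v up to a constant. *)
Section adaptive.
Context (R : realType) (p : nat).
Variables (A : 'M[R]_p) (S : {set 'I_p}) (b h g : 'cV[R]_p) (i : 'I_p).
Variables (lam : R) (w : 'I_p -> R).
Hypothesis symA : A^T = A.
Hypothesis psdA : forall v, 0 <= quad A v.
Hypothesis iS : i \notin S.
Hypothesis bS : forall j, j \notin S -> b j 0 = 0.
Hypothesis lam0 : 0 < lam.
Hypothesis w0 : forall j, 0 <= w j.

Let pen (v : 'cV[R]_p) : R := \sum_(j | j != i) w j * `|v j 0|.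
Let obj (v : 'cV[R]_p) : R := - dotc v g + quad A v / 2 + lam * pen (b + v).

Let penE v : pen (b + v) = \sum_(j in S) w j * `|b j 0 + v j 0| +
    \sum_(j | (j \notin S) && (j != i)) w j * `|v j 0|.
Proof.
rewrite /pen (bigID [in S]) /=; congr (_ + _).
  apply: eq_big => [j|j _]; last by rewrite mxE.
  by rewrite andb_idl// => jS; apply: contraNneq iS => <-.
apply: eq_big => [j|j /andP[_ jS]]; first by rewrite andbC.
by rewrite mxE bS// add0r.
Qed.

(** Subtract from h the vector psi that coincides with h off S and is A-orthogonal
    to the vectors supported in S: psi combines the residuals of the projections
    theta_j of the variables j off S.  By orthogonality the quadratic part of the
    objective decreases.  The linear and penalty parts change by at most
    sum_j |h_j| (projected noise of j + lam sum_k w_k |theta_jk| - lam w_j), which is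
    negative unless h vanishes off S. *)
Lemma adaptive_vanishes_off_support (theta : 'I_p -> 'cV[R]_p) :
  h i 0 = 0 ->
  (forall j k, k \notin S -> theta j k 0 = 0) ->
  (forall j k, j \notin S -> k \in S -> (A *m (delta_mx j 0 - theta j)) k 0 = 0) ->
  (forall psi : 'cV[R]_p, (forall j, j \notin S -> psi j 0 = h j 0) -> obj h <= obj (h - psi)) ->
  (forall j, j \notin S -> j != i -> h j 0 != 0 ->
    `|dotc (delta_mx j 0 - theta j) g| + lam * \sum_(k in S) w k * `|theta j k 0| < lam * w j) ->
  forall j, j \notin S -> h j 0 = 0.
Proof.
move=> hi thS orth opt irr.
pose psi := \sum_(j | j \notin S) h j 0 *: (delta_mx j 0 - theta j).
have psiN j : j \notin S -> psi j 0 = h j 0.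
  move=> jS; rewrite /psi summxE (bigD1 j)//= !mxE !eqxx thS// subr0 mulr1 big1 ?addr0// => k /andP[kS kj].
  by rewrite !mxE thS// eq_sym (negbTE kj) subr0 mulr0.
have psiS k : k \in S -> psi k 0 = - \sum_(j | j \notin S) h j 0 * theta j k 0.
  move=> kS; rewrite /psi summxE -sumrN; apply: eq_bigr => j jS; rewrite !mxE.
  have /negbTE -> : k != j by apply: contraNneq jS => <-.
  by rewrite sub0r mulrN.
have Apsi k : k \in S -> (A *m psi) k 0 = 0.
  move=> kS; rewrite /psi mulmx_sumr summxE big1// => j jS.
  by rewrite -scalemxAr mxE orth// mulr0.
have cross : bil A (h - psi) psi = 0.
  rewrite bil_sum big1// => k _; have [kS|kS] := boolP (k \in S).
    by rewrite Apsi// mulr0.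
  by rewrite !mxE psiN// subrr mul0r.
have qh : quad A h = quad A (h - psi) + quad A psi.
  by rewrite -[in LHS](subrK psi h) (quad_add (h - psi) psi symA) cross mulr0 addr0.
have := opt psi psiN.
rewrite /obj qh !penE dotcBl.
have -> : \sum_(j | (j \notin S) && (j != i)) w j * `|(h - psi) j 0| = 0.
  by apply: big1 => j /andP[jS _]; rewrite !mxE psiN// subrr normr0 mulr0.
pose c j : R := `|dotc (delta_mx j 0 - theta j) g| + lam * \sum_(k in S) w k * `|theta j k 0|.
have hdot : dotc psi g <= \sum_(j | j \notin S) `|h j 0| * `|dotc (delta_mx j 0 - theta j) g|.
  rewrite /psi dotc_suml; apply: ler_sum => j _.
  by rewrite dotcZl (le_trans (ler_norm _))// normrM.
have hpen : \sum_(k in S) w k * `|b k 0 + (h - psi) k 0| <=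
    \sum_(k in S) w k * `|b k 0 + h k 0| +
    \sum_(j | j \notin S) `|h j 0| * \sum_(k in S) w k * `|theta j k 0|.
  under [X in _ <= _ + X]eq_bigr do rewrite mulr_sumr.
  rewrite exchange_big /= -big_split /=; apply: ler_sum => k kS.
  rewrite [(h - psi) k 0]mxE [(- psi) k 0]mxE addrA.
  rewrite (le_trans (ler_wpM2l (w0 k) (ler_normB _ _)))// mulrDr lerD2l.
  rewrite psiS// normrN (le_trans (ler_wpM2l (w0 k) (ler_norm_sum _ _ _)))// mulr_sumr.
  by apply: ler_sum => j _; rewrite normrM mulrCA.
have qpsi := psdA psi.
set PS := \sum_(k in S) w k * `|b k 0 + h k 0| in hpen *.
set PS' := \sum_(k in S) _ in hpen *.
set X1 := \sum_(j | _) _ in hdot; set X2 := \sum_(j | _) _ in hpen.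
set PN := \sum_(j | _) _ => hopt.
have hsum : \sum_(j | j \notin S) `|h j 0| * (lam * w j - c j) <= 0.
  have -> : \sum_(j | j \notin S) `|h j 0| * (lam * w j - c j) = lam * PN - (X1 + lam * X2).
    have -> : PN = \sum_(j | j \notin S) w j * `|h j 0|.
      rewrite [RHS](bigID (fun j => j != i)) /= [X in _ + X]big1 ?addr0//.
      by move=> j /andP[_ /negPn/eqP ->]; rewrite hi normr0 mulr0.
    rewrite /X1 /X2 !mulr_sumr -big_split -sumrB /=; apply: eq_bigr => j _.
    by rewrite /c; ring.
  have := ler_wpM2l (ltW lam0) hpen; lra.
move=> j jS; apply/eqP; apply: contraT => hj.
have ge0 k : k \notin S -> 0 <= `|h k 0| * (lam * w k - c k).
  move=> kS; have [hk|hk] := eqVneq (h k 0) 0; first by rewrite hk normr0 mul0r.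
  have ki : k != i by apply: contraNneq hk => ->; rewrite hi.
  by apply: mulr_ge0 => //; rewrite subr_ge0; apply: ltW; exact: irr.
have : 0 < `|h j 0| * (lam * w j - c j).
  have ji : j != i by apply: contraNneq hj => ->; rewrite hi.
  by apply: mulr_gt0; rewrite ?normr_gt0// subr_gt0; exact: irr.
rewrite ltNge => /negP[]; apply: le_trans hsum.
by rewrite (bigD1 j)//= lerDl sumr_ge0// => k /andP[kS _]; exact: ge0.
Qed.

(** Moving from h towards 0 by the fraction 1/4 changes the quadratic part by
    (1 - 9/16) / 2 = 7/32 of quad A h, which gives 7/8 after division by 1/4.  The
    full step to 0 would give only 1/2, too little against the constants
    1/64 + 52/100 that occur in [adaptive_recovery]. *)
Lemma adaptive_l2_error (L W mu : R) :
  0 < L -> 0 <= mu ->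
  (forall v : 'cV[R]_p, (forall j, j \notin S -> v j 0 = 0) -> L * norm2 S v ^+ 2 <= quad A v) ->
  (forall j, j \in S -> `|g j 0| <= mu) -> (forall j, j \in S -> w j <= W) -> 0 <= W ->
  (forall j, j \notin S -> h j 0 = 0) ->
  obj h <= obj ((3 / 4) *: h) ->
  7 / 8 * L * norm2 S h <= Num.sqrt #|S|%:R * (mu + lam * W).
Proof.
move=> L0 mu0 hA hg hw W0 hS.
rewrite /obj !penE.
have z (v : 'cV[R]_p) : (forall j, j \notin S -> v j 0 = 0) ->
   \sum_(j | (j \notin S) && (j != i)) w j * `|v j 0| = 0.
  by move=> vS; apply: big1 => j /andP[jS _]; rewrite vS// normr0 mulr0.
rewrite !z//; last by move=> j jS; rewrite mxE hS// mulr0.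
rewrite !addr0 quad_scale dotcZl.
set x := norm2 S h; have x0 : 0 <= x by exact: norm2_ge0.
set m := Num.sqrt #|S|%:R; have m0 : 0 <= m by exact: sqrtr_ge0.
have hdot : dotc h g <= mu * (m * x).
  by rewrite (le_trans (ler_norm _))//; exact: dotc_le_norm2.
have hn : norm1 S h <= m * x by exact: norm1_le_norm2.
have hpen : \sum_(j in S) w j * `|b j 0 + ((3 / 4) *: h) j 0| <=
    \sum_(j in S) w j * `|b j 0 + h j 0| + 1 / 4 * (W * norm1 S h).
  rewrite /norm1 !mulr_sumr -big_split /=; apply: ler_sum => j jS; rewrite mxE.
  have -> : b j 0 + 3 / 4 * h j 0 = (b j 0 + h j 0) - 1 / 4 * h j 0 by field.
  rewrite (le_trans (ler_wpM2l (w0 j) (ler_normB _ _)))// mulrDr lerD2l.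
  rewrite normrM (ger0_norm (_ : 0 <= 1 / 4 :> R)); last by rewrite divr_ge0.
  by rewrite mulrCA ler_wpM2l ?divr_ge0// ler_wpM2r// hw.
move=> opt.
have hq : 7 / 8 * quad A h <= dotc h g + lam * (W * norm1 S h).
  have := ler_wpM2l (ltW lam0) hpen; rewrite mulrDr; lra.
have hL := hA h hS; rewrite -/x in hL.
have hWm : W * norm1 S h <= W * (m * x) by rewrite ler_wpM2l.
have hl := ler_wpM2l (ltW lam0) hWm.
have [->|xn0] := eqVneq x 0.
  by rewrite mulr0 mulr_ge0// addr_ge0// mulr_ge0// ltW.
have xp : 0 < x by rewrite lt_neqAle eq_sym xn0.
rewrite -(ler_pM2r xp); rewrite expr2 in hL.
have : 7 / 8 * (L * (x * x)) <= mu * (m * x) + lam * (W * (m * x)) by lra.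
by rewrite !mulrA; lra.
Qed.

End adaptive.

(** One node whose neighbourhood S is not empty, under deterministic conditions:
    sL^2 is a lower eigenvalue bound for the Gram matrix on S, dl bounds the error
    of the initial estimator, B bounds the coefficients on S from below, and W
    bounds the adaptive weights on S. *)
Section adaptive_recovery.
Context (R : realType) (n p : nat) (D : 'M[R]_(n, p)) (i : 'I_p).
Variables (S : {set 'I_p}) (b binit bhat : 'cV[R]_p).
Variables (lam lamn K2 sL eta B : R).
Let A := n%:R^-1 *: (D^T *m D).
Let g := n%:R^-1 *: (D^T *m (col i D - D *m b)).
Let L := sL ^+ 2.
Let m := Num.sqrt #|S|%:R : R.
Let dl := 3 * K2 * lam * m.
Hypothesis iS : i \notin S.
Hypothesis S0 : (0 < #|S|)%N.
Hypothesis bS : forall j, j \notin S -> b j 0 = 0.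
Hypothesis lam0 : 0 < lam.
Hypothesis K2L : 1 <= K2 * L.
Hypothesis sL0 : 0 < sL.
Hypothesis sL1 : sL <= 1.
Hypothesis eta01 : 0 < eta < 1.
Hypothesis Adiag : forall j, A j j <= 3 / 2.
Hypothesis AL : forall v : 'cV[R]_p, (forall j, j \notin S -> v j 0 = 0) ->
  L * norm2 S v ^+ 2 <= quad A v.
Hypothesis hinit : forall j, `|binit j 0 - b j 0| <= dl.
Hypothesis bmin : forall j, j \in S -> B < `|b j 0|.
Hypothesis gS : forall j, j != i -> `|g j 0| <= lam / 2.
Hypothesis proj_noise : forall j (theta : 'cV[R]_p), j \notin S -> j != i ->
  (forall k, k \notin S -> theta k 0 = 0) ->
  (forall k, k \in S -> (A *m (delta_mx j 0 - theta)) k 0 = 0) ->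
  `|dotc (delta_mx j 0 - theta) g| <= 5 / 2 * lam.
Hypothesis beta_min_strong : 32 * K2 * lam * m ^+ 2 <= B * (1 - eta) * sL.
Hypothesis level_vs_signal : lamn <= 52 / 100 * lam * B.
Hypothesis level_vs_eigen : lamn * (1 - eta) <= 1664 / 100 * K2 * lam * m * sL.
Hypothesis level_lower : 16 * K2 * lam ^+ 2 * m <= lamn * eta.
Hypothesis sparsity_vs_eigen : 39 * K2 * lam * m ^+ 2 <= sL * (1 - eta).
Hypothesis opt : is_adaptive_lasso D i binit lamn bhat.

Let w := ada_weight binit.
Let W := Num.max 1 (B - dl)^-1.

Let e0 : 0 < eta. Proof. by case/andP: eta01. Qed.
Let e1 : 0 < 1 - eta. Proof. by rewrite subr_gt0; case/andP: eta01. Qed.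
Let L0 : 0 < L. Proof. exact: exprn_gt0. Qed.
Let K20 : 0 < K2. Proof. by rewrite -(pmulr_lgt0 _ L0) (lt_le_trans ltr01). Qed.
Let m1 : 1 <= m.
Proof. by rewrite -sqrtr1 ler_wsqrtr// ler1n. Qed.
Let m0 : 0 < m. Proof. exact: lt_le_trans ltr01 m1. Qed.
Let dl0 : 0 < dl. Proof. by rewrite !mulr_gt0. Qed.
Let Km2 : 0 < K2 * lam * m ^+ 2. Proof. by rewrite !mulr_gt0 ?exprn_gt0. Qed.
Let B0 : 0 < B.
Proof.
have : 0 < B * ((1 - eta) * sL) by rewrite mulrA; have := Km2; have := beta_min_strong; lra.
by rewrite pmulr_lgt0// mulr_gt0.
Qed.
Let lamn0 : 0 < lamn.
Proof.
have : 0 < lamn * eta.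
  by apply: lt_le_trans level_lower; rewrite !mulr_gt0 ?exprn_gt0.
by rewrite pmulr_lgt0.
Qed.

Let dlB : dl <= 3 / 32 * B.
Proof.
have h : (1 - eta) * sL <= 1 by have := sL1; have := e0; have := sL0; have := e1; nra.
have h2 : B * ((1 - eta) * sL) <= B by rewrite -[leRHS]mulr1 ler_wpM2l// ltW.
have h3 : K2 * lam * m <= K2 * lam * m ^+ 2.
  by rewrite expr2 mulrA -[leLHS]mulr1 ler_wpM2l// ?mulr_ge0// ltW.
have := beta_min_strong; rewrite /dl; lra.
Qed.
Let BdlB : 29 / 32 * B <= B - dl. Proof. have := dlB; lra. Qed.
Let Bdl0 : 0 < B - dl. Proof. have := BdlB; have := B0; lra. Qed.

Let binitS j : j \in S -> B - dl <= `|binit j 0|.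
Proof.
move=> jS; have := bmin jS; have := hinit j.
have := ler_normB (binit j 0) (binit j 0 - b j 0); rewrite opprB addrCA subrr addr0; lra.
Qed.

Let wW j : j \in S -> w j <= W.
Proof.
move=> /binitS h; rewrite /w /ada_weight /W ge_max !le_max lexx andbT.
have bp : 0 < `|binit j 0| := lt_le_trans Bdl0 h.
by rewrite lef_pV2 ?posrE// h orbT.
Qed.

Let w1 j : 1 <= w j. Proof. by rewrite /w /ada_weight le_max lexx orbT. Qed.
Let w0 j : 0 <= w j. Proof. exact: le_trans ler01 (w1 j). Qed.

Let wN j : j \notin S -> binit j 0 != 0 -> 1 <= dl * w j.
Proof.
move=> jS bj; have := hinit j; rewrite bS// subr0 => h.
have bp : 0 < `|binit j 0| by rewrite normr_gt0.
have : `|binit j 0|^-1 <= w j by rewrite /w /ada_weight le_max lexx.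
move=> /(ler_wpM2l (ltW dl0)); apply: le_trans.
by rewrite ler_pdivlMr// mul1r.
Qed.

Let W0 : 0 <= W. Proof. by rewrite /W le_max ler01. Qed.

Let Wdl : W * (dl * (123 / 100 * m)) <= (1 - eta) / 4 * sL.
Proof.
have -> : W * (dl * (123 / 100 * m)) = W * (369 / 100 * (K2 * lam * m ^+ 2)).
  by rewrite /dl; ring.
rewrite /W; case: (leP 1 (B - dl)^-1) => _.
  rewrite ler_pdivrMl//.
  have h : 0 <= (1 - eta) * sL by rewrite mulr_ge0 ?ltW.
  have := ler_wpM2l h BdlB; have := beta_min_strong; have := Km2; lra.
rewrite mul1r; have := sparsity_vs_eigen; have := Km2; lra.
Qed.

Let symA : A^T = A.
Proof. by rewrite /A linearZ /= trmx_mul trmxK. Qed.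
Let psdA v : 0 <= quad A v. Proof. exact: quad_scaled_gram_ge0. Qed.

Let pos_restr (v : 'cV[R]_p) : (forall j, j \notin S -> v j 0 = 0) -> v != 0 -> 0 < quad A v.
Proof.
move=> supp v0; apply: lt_le_trans (AL supp); rewrite mulr_gt0// exprn_gt0//.
exact: norm2_gt0.
Qed.

(* The sample projection of X_j has quad A theta <= A j j <= 3/2, and
   3/2 <= (123/100)^2. *)
Let theta_l1 j (theta : 'cV[R]_p) :
  (forall k, k \notin S -> theta k 0 = 0) ->
  (forall k, k \in S -> (A *m (delta_mx j 0 - theta)) k 0 = 0) ->
  sL * norm1 S theta <= 123 / 100 * m.
Proof.
move=> supp orth.
have cross : bil A theta (delta_mx j 0 - theta) = 0.
  rewrite bil_sum big1// => k _; have [kS|kS] := boolP (k \in S).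
    by rewrite orth// mulr0.
  by rewrite supp// mul0r.
have qd : quad A (delta_mx j 0) = A j j.
  by rewrite /quad trmx_delta -rowE -colE mxE mxE.
have h : quad A theta <= 3 / 2.
  have := psdA (delta_mx j 0 - theta).
  have := quad_add (delta_mx j 0 - theta) theta symA.
  rewrite subrK qd (bilC _ theta)// cross; have := Adiag j; lra.
have h2 := AL supp.
have h3 : (sL * norm2 S theta) ^+ 2 <= (123 / 100) ^+ 2 by rewrite exprMn -/L; lra.
have h4 : sL * norm2 S theta <= 123 / 100.
  by move: h3; rewrite ler_pXn2r// nnegrE ?mulr_ge0 ?norm2_ge0 ?(ltW sL0)// divr_ge0.
have := ler_wpM2l (ltW sL0) (norm1_le_norm2 S theta); rewrite -/m => /le_trans; apply.
by rewrite mulrCA [leRHS]mulrC ler_wpM2l// ltW.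
Qed.

Let h := bhat - b.
Let bhatE : bhat = b + h. Proof. by rewrite addrC subrK. Qed.

(* A comparison vector must vanish off S where h does, as the weight may be
   infinite there; on S the initial estimator is nonzero and all weights are
   finite. *)
Let opt_obj (v : 'cV[R]_p) : (forall j, j \notin S -> v j 0 != 0 -> h j 0 != 0) ->
  - dotc h g + quad A h / 2 + lamn * \sum_(j | j != i) w j * `|(b + h) j 0| <=
  - dotc v g + quad A v / 2 + lamn * \sum_(j | j != i) w j * `|(b + v) j 0|.
Proof.
move=> hv; have [[hi hdom] hopt] := opt.
have hj j : j \notin S -> h j 0 = bhat j 0 by move=> jS; rewrite /h !mxE bS// subr0.
have vz j : j \notin S -> bhat j 0 = 0 -> (b + v) j 0 = 0.
  move=> jS bj; rewrite mxE bS// add0r; apply/eqP; apply: contraT => /(hv _ jS).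
  by rewrite hj// bj eqxx.
have /hopt : [set b' : 'cV[R]_p | b' i 0 = 0 /\
     forall j, j != i -> binit j 0 = 0 -> b' j 0 = 0] (b + v).
  split; first exact: vz.
  move=> j ji bj; apply: vz; last exact: hdom.
  by apply/negP => /binitS; rewrite bj normr0 leNgt Bdl0.
move=> /= hle; rewrite bhatE !quad_loss_expand -/A -/g -/w in hle; lra.
Qed.

Lemma adaptive_recovery j : (bhat j 0 != 0) = (j \in S).
Proof.
have theta_ex k : exists theta : 'cV[R]_p, (forall j, j \notin S -> theta j 0 = 0) /\
    (forall l, l \in S -> (A *m theta) l 0 = (A *m delta_mx k 0 : 'cV[R]_p) l 0).
  exact: restricted_solve pos_restr.
pose theta k := proj1_sig (cid (theta_ex k)).
have [[hi hdom] _] := opt.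
have hi0 : h i 0 = 0 by rewrite /h !mxE hi bS// subrr.
have thS j' k : k \notin S -> theta j' k 0 = 0.
  by rewrite /theta; case: cid => t /= [+ _]; apply.
have orth j' k : k \in S -> (A *m (delta_mx j' 0 - theta j')) k 0 = 0.
  rewrite /theta; case: cid => t /= [_ ht] kS.
  by rewrite mulmxBr [LHS]mxE [X in _ + X]mxE ht// subrr.
have hN : forall j, j \notin S -> h j 0 = 0.
  apply: (@adaptive_vanishes_off_support _ _ A S b h g i lamn w symA psdA iS bS lamn0 w0 theta) => //.
  - by move=> j' k _; exact: orth.
  - move=> psi psiN; apply: opt_obj => k kS; rewrite !mxE psiN//.
    by rewrite /h !mxE subrr eqxx.
  - move=> j' jS ji hj.
    have bj : binit j' 0 != 0.
      apply: contraNneq hj => bj0; have := hdom _ ji bj0.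
      by rewrite /h !mxE bS// subr0 => ->.
    have dw := wN jS bj.
    have hnoise := proj_noise jS ji (fun k => thS j' k) (fun k => orth j' k).
    have hth := theta_l1 (fun k => thS j' k) (fun k => orth j' k).
    have hw : \sum_(k in S) w k * `|theta j' k 0| <= W * norm1 S (theta j').
      by rewrite /norm1 mulr_sumr; apply: ler_sum => k kS; rewrite ler_wpM2r// wW.
    (* 5/2 lam is at most 15/32 of eta lamn w_j, and the weights of the projection
       at most a quarter of (1 - eta) lamn w_j *)
    have c1 : lam <= 3 / 16 * (eta * (lamn * w j')).
      have h1 : 16 * K2 * lam ^+ 2 * m * w j' <= lamn * eta * w j' by rewrite ler_wpM2r.
      have h2 : lam * 1 <= lam * (dl * w j') by rewrite ler_wpM2l// ltW.
      by move: h2; rewrite /dl; lra.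
    have c2 : W * norm1 S (theta j') <= (1 - eta) / 4 * w j'.
      rewrite -(ler_pM2l sL0) mulrCA.
      apply: (le_trans (ler_wpM2l W0 hth)).
      have h1 : W * (dl * (123 / 100 * m)) * w j' <= (1 - eta) / 4 * sL * w j'.
        by rewrite ler_wpM2r// Wdl.
      have h2 : W * (123 / 100 * m) * 1 <= W * (123 / 100 * m) * (dl * w j').
        by rewrite ler_wpM2l// mulr_ge0// mulr_ge0 ?divr_ge0// ltW.
      by move: h2; rewrite mulr1; lra.
    have lw : 0 < lamn * w j' by rewrite mulr_gt0// (lt_le_trans ltr01 (w1 j')).
    have h3 := ler_wpM2l (ltW lamn0) (le_trans hw c2).
    have h4 : 0 < (1 - eta) * (lamn * w j') by rewrite mulr_gt0.
    have h5 : 0 < eta * (lamn * w j') by rewrite mulr_gt0.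
    lra.
have hl2 : 7 / 8 * L * norm2 S h <= m * (lam / 2 + lamn * W).
  apply: (@adaptive_l2_error _ _ A S b h g i lamn w iS bS lamn0 w0 L W (lam / 2)) => //.
  - by rewrite divr_ge0// ltW.
  - by move=> k kS; apply: gS; apply: contraNneq iS => <-.
  - apply: opt_obj => k kS; rewrite mxE; apply: contraNneq => ->.
    by rewrite mulr0.
have [jS|jS] := boolP (j \in S); last first.
  apply/negbTE; rewrite negbK; apply/eqP.
  by have := hN j jS; rewrite /h !mxE bS// subr0.
apply/eqP => bj.
(* a missed neighbour would make the error at least B *)
have hbig : B < norm2 S h.
  apply: (lt_le_trans (bmin jS)); apply: le_trans (norm_coord_le h jS).
  by rewrite /h !mxE bj sub0r normrN.
have mL : m * lam <= L * B / 32.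
  have h1 : (1 - eta) * sL <= 1 by have := sL1; have := e0; have := sL0; have := e1; nra.
  have h2 : B * ((1 - eta) * sL) <= B by rewrite -[leRHS]mulr1 ler_wpM2l// ltW.
  have h3 : m * lam <= m ^+ 2 * lam by rewrite expr2 ler_pM2r// -[leLHS]mulr1 ler_pM2l.
  have h4 : 1 * (m ^+ 2 * lam) <= K2 * L * (m ^+ 2 * lam).
    by rewrite ler_wpM2r// mulr_ge0 ?sqr_ge0// ltW.
  have h5 : L * (32 * K2 * lam * m ^+ 2) <= L * B.
    by rewrite ler_pM2l//; have := beta_min_strong; lra.
  lra.
have mW : m * (lamn * W) <= 52 / 100 * (L * B).
  have LB0 : 0 < L * B by rewrite mulr_gt0.
  rewrite /W; case: (leP 1 (B - dl)^-1) => _.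
    rewrite mulrA ler_pdivrMr//.
    have h1 := ler_wpM2l (ltW m0) level_vs_signal.
    have h2 := ler_wpM2l (ltW LB0) BdlB.
    have h3 : B * (m * lam) <= B * (L * B / 32) by rewrite ler_pM2l.
    have h4 : 0 < L * B * B by rewrite mulr_gt0.
    lra.
  rewrite mulr1 -(ler_pM2r e1).
  have h1 := ler_wpM2l (ltW m0) level_vs_eigen.
  have h2 := ler_wpM2l (ltW sL0) beta_min_strong.
  by rewrite /L; lra.
have h1 : L * B < L * norm2 S h by rewrite ltr_pM2l.
have LB0 : 0 < L * B by rewrite mulr_gt0.
lra.
Qed.

End adaptive_recovery.

(** * Calibration of the constants *)

Section calibration.
Context (R : realType) (n p s : nat) (C2 : R).
Hypothesis C2big : 4 * Num.sqrt (5 / 3) < C2.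
Hypothesis np : (n <= p)%N.
Hypothesis pexp : p%:R < expR (n%:R / (4 * C2 ^+ 2)).
Hypothesis s1 : (1 < s)%N.
Hypothesis sp : (2 * s < p)%N.
Let r := Num.sqrt (ln p%:R / n%:R) : R.

Lemma C2_gt0 : 0 < C2.
Proof. by apply: le_lt_trans C2big; rewrite mulr_ge0 ?sqrtr_ge0. Qed.

Lemma C2_sqr : 80 / 3 < C2 ^+ 2.
Proof.
have h0 : 0 <= 4 * Num.sqrt (5 / 3) :> R by rewrite mulr_ge0 ?sqrtr_ge0.
have h : (4 * Num.sqrt (5 / 3)) ^+ 2 < C2 ^+ 2.
  by rewrite ltr_pXn2r ?nnegrE// ltW// C2_gt0.
by move: h; rewrite exprMn sqr_sqrtr; lra.
Qed.

Lemma p_ge5 : (5 <= p)%N. Proof. lia. Qed.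

Lemma p_gt0 : 0 < p%:R :> R. Proof. by rewrite ltr0n; have := p_ge5; lia. Qed.

Lemma sample_size_gt0 : (0 < n)%N.
Proof.
rewrite lt0n; apply/negP => /eqP n0; move: pexp.
rewrite n0 mul0r expR0 ltNge => /negP; apply.
by rewrite ler1n; have := p_ge5; lia.
Qed.

Let n0 : 0 < n%:R :> R. Proof. by rewrite ltr0n sample_size_gt0. Qed.

Lemma ln_p_gt0 : 0 < ln p%:R :> R.
Proof. by rewrite ln_gt0// ltr1n; have := p_ge5; lia. Qed.

Lemma rate_gt0 : 0 < r. Proof. by rewrite sqrtr_gt0 divr_gt0// ln_p_gt0. Qed.

Lemma rate_sqr : r ^+ 2 = ln p%:R / n%:R.
Proof. by rewrite sqr_sqrtr// divr_ge0// ltW// ln_p_gt0. Qed.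

Lemma n_rate_sqr : n%:R * r ^+ 2 = ln p%:R.
Proof. by rewrite rate_sqr mulrC divfK// gt_eqF. Qed.

Lemma C2_rate_sqr : C2 ^+ 2 * r ^+ 2 < 1 / 4.
Proof.
have c2 : 0 < C2 ^+ 2 by rewrite exprn_gt0// C2_gt0.
have h : ln p%:R < n%:R / (4 * C2 ^+ 2).
  by rewrite -ltr_expR lnK// posrE p_gt0.
rewrite rate_sqr mulrA ltr_pdivrMr// -ltr_pdivlMl//.
by move: h; congr (_ < _); field; rewrite gt_eqF ?C2_gt0.
Qed.

Lemma C2_rate_lt : C2 * r < 1 / 2.
Proof.
have h0 : 0 <= C2 * r by rewrite mulr_ge0// ltW ?C2_gt0 ?rate_gt0.
rewrite -(@ltr_pXn2r _ 2)// ?nnegrE ?divr_ge0// exprMn.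
by have := C2_rate_sqr; lra.
Qed.

Lemma rate_sqr_lt : r ^+ 2 < 3 / 320.
Proof.
have := C2_rate_sqr; have := C2_sqr.
have := exprn_gt0 2 rate_gt0; nra.
Qed.

(** If p < 16 then n <= 15 and r^2 < 3/320 would force log p < 3/20, against
    p >= 5. *)
Lemma p_ge16 : (16 <= p)%N.
Proof.
rewrite leqNgt; apply/negP => p16.
have h1 : ln p%:R < 15 / 100 :> R.
  have := rate_sqr_lt; rewrite rate_sqr ltr_pdivrMr// => h.
  have h2 : n%:R <= 16 :> R by rewrite ler_nat; lia.
  lra.
have h2 : p%:R < expR (15 / 100) :> R by rewrite -[ltLHS]lnK ?posrE ?p_gt0// ltr_expR.
have h3 := expR_ge1Dx (- (15 / 100) : R); rewrite expRN in h3.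
have h4 : 5 <= p%:R :> R by rewrite ler_nat p_ge5.
have h5 : expR (15 / 100) * (1 + - (15 / 100)) <= 1 :> R.
  by rewrite -ler_pdivlMl ?expR_gt0// mulr1.
lra.
Qed.

(** p - s >= p / 2 and p >= 16 give (p - s)^4 >= p^4 / 16 >= p^3. *)
Lemma ln_complement_ge : 3 / 4 * ln p%:R <= ln (p - s)%:R :> R.
Proof.
have ps : (p <= 2 * (p - s))%N by lia.
have q0 : 0 < (p - s)%:R :> R by rewrite ltr0n; lia.
have h : p%:R ^+ 3 <= (p - s)%:R ^+ 4 :> R.
  have h1 : (p%:R : R) ^+ 4 <= (2 * (p - s)%:R) ^+ 4.
    by rewrite ler_pXn2r ?nnegrE ?mulr_ge0// -natrM ler_nat.
  have h2 : 16 * p%:R ^+ 3 <= p%:R ^+ 4 :> R.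
    by rewrite [leRHS]exprS ler_wpM2r ?exprn_ge0// ler_nat p_ge16.
  have e : (2 : R) ^+ 4 = 16 by rewrite -natrX.
  move: h1; rewrite exprMn e; lra.
have : ln (p%:R ^+ 3) <= ln ((p - s)%:R ^+ 4) :> R.
  by rewrite ler_ln// posrE exprn_gt0// p_gt0.
rewrite !lnXn ?p_gt0// -[_ *+ 3]mulr_natl -[_ *+ 4]mulr_natl; lra.
Qed.

Lemma ln_complement_le : ln (p - s)%:R <= ln p%:R :> R.
Proof. by rewrite ler_ln ?posrE ?ltr0n ?ler_nat; lia. Qed.

End calibration.

Lemma noise_level (R : realType) (sig x : R) :
  c0 R * sig * Num.sqrt (6 * x) = 3 * sig * Num.sqrt x.
Proof.
rewrite sqrtrM// /c0 mulrAC -!mulrA mulrA -sqrtrM//.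
have -> : 3 / 2 * 6 = 3 ^+ 2 :> R by rewrite -natrX; field.
by rewrite sqrtr_sqr ger0_norm// [Num.sqrt x * _]mulrC.
Qed.

Section penalty.
Context (R : realType).

(** Here t stands for sqrt sbar, m for sqrt |S|, ss for sqrt s, r3 for sqrt 3 and
    ell for c0 sigma sqrt (2 log (p - s) / n), so that lamn = q ell lam t.  As
    K^2 >= 2, the bound on sbar gives t <= 104/100 K m, because
    1/2 + 9/16 <= (104/100)^2; the constants 1664/100 = 16 * 104/100 and
    52/100 = 1664/100 / 32 follow. *)
Lemma penalty_level_bounds (K lam m ss t q ell M B sL eta lamn r3 : R) :
  2 <= K ^+ 2 -> 0 < K -> 0 < lam -> 0 < m -> m <= ss -> 0 < t -> 0 < M -> 0 < eta < 1 ->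
  0 < r3 -> 0 < sL ->
  m ^+ 2 <= t ^+ 2 -> t ^+ 2 <= (1 + 9 / 16 * K ^+ 2) * m ^+ 2 ->
  64 * K ^+ 2 / eta <= q -> q <= 16 * M * K ->
  lam / 4 <= ell -> r3 * ell <= lam / 2 -> M * ell * (1 - eta) <= sL ->
  M / r3 * 16 * K ^+ 2 * lam * ss <= B ->
  lamn = q * ell * lam * t ->
  [/\ lamn <= 52 / 100 * lam * B, lamn * (1 - eta) <= 1664 / 100 * K ^+ 2 * lam * m * sL &
      16 * K ^+ 2 * lam ^+ 2 * m <= lamn * eta].
Proof.
move=> K2 K0 lam0 m0 mss t0 M0 /andP[e0 e1] r30 sL0 mt tm q1 q2 ell1 ell2 ell3 HB ->.
have ell0 : 0 < ell by lra.
have e1' : 0 < 1 - eta by lra.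
have mt' : m <= t by rewrite -(@ler_pXn2r _ 2)// nnegrE ltW.
have tK : t <= 104 / 100 * K * m.
  have c0 : 0 <= 104 / 100 :> R by lra.
  have nn : 0 <= 104 / 100 * K * m := mulr_ge0 (mulr_ge0 c0 (ltW K0)) (ltW m0).
  rewrite -(@ler_pXn2r _ 2)// ?nnegrE ?(ltW t0)//.
  apply: (le_trans tm); rewrite !exprMn ler_wpM2r ?sqr_ge0//; lra.
have lt0 : 0 <= lam * t by rewrite mulr_ge0// ltW.
have ub : q * ell * lam * t <= 16 * M * K * ell * lam * t.
  by do 3 (rewrite ler_pM2r//).
have cc : 0 <= 1664 / 100 :> R by lra.
have ub2 : q * ell * lam * t <= 1664 / 100 * K ^+ 2 * lam * m * (M * ell).
  apply: (le_trans ub).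
  have h0 : 0 <= 16 * K * lam * (M * ell) by rewrite !mulr_ge0// ltW.
  have := ler_wpM2l h0 tK; lra.
split.
- have h1 : M * ell <= M / r3 * (lam / 2).
    have -> : M * ell = M / r3 * (r3 * ell) by field; rewrite gt_eqF.
    by rewrite ler_wpM2l// divr_ge0// ltW.
  apply: (le_trans ub2).
  have h2 : 0 <= 1664 / 100 * K ^+ 2 * lam by exact: (mulr_ge0 (mulr_ge0 cc (sqr_ge0 K)) (ltW lam0)).
  have Mr : 0 <= M / r3 * (lam / 2) by rewrite mulr_ge0 ?divr_ge0 ?(ltW lam0) ?(ltW M0) ?(ltW r30).
  have h3 : m * (M * ell) <= ss * (M / r3 * (lam / 2)).
    apply: (le_trans (ler_wpM2l (ltW m0) h1)); exact: ler_wpM2r.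
  have h4 := ler_wpM2l h2 h3.
  have h5 := ler_wpM2l (ltW lam0) HB.
  lra.
- have h1 := ler_wpM2r (ltW e1') ub2.
  have h2 : 0 <= 1664 / 100 * K ^+ 2 * lam * m by exact: (mulr_ge0 (mulr_ge0 (mulr_ge0 cc (sqr_ge0 K)) (ltW lam0)) (ltW m0)).
  have h3 := ler_wpM2l h2 ell3.
  lra.
- have h1 : 64 * K ^+ 2 <= q * eta by rewrite -ler_pdivrMr.
  have h2 : 64 * K ^+ 2 * (lam / 4) <= q * eta * ell.
    apply: ler_pM => //; last by rewrite divr_ge0// ltW.
    by rewrite mulr_ge0 ?sqr_ge0.
  have h3 : lam * m <= lam * t by rewrite ler_pM2l.
  have h4 : 64 * K ^+ 2 * (lam / 4) * (lam * m) <= q * eta * ell * (lam * t).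
    apply: ler_pM => //; last by rewrite mulr_ge0// ltW.
    by have := mulr_gt0 (exprn_gt0 2 K0) lam0; lra.
  lra.
Qed.

End penalty.

(** * Neighbourhood of one node *)

Section node_recovery.
Context (R : realType) (n p s : nat) (C2 eta M : R) (Sigma : 'M[R]_p) (sig : R).
Context (D : 'M[R]_(n, p)) (i : 'I_p) (binit bhat : 'cV[R]_p) (lamn : R).
Let K0 := re_K s s 3 Sigma.
Let K := Num.sqrt 2 * K0.
Let Lmin := Lambda_min Sigma s.
Let lam := lambda_init n p sig.
Let r := Num.sqrt (ln p%:R / n%:R) : R.
Let S := neighbours Sigma i.
Let b := reg_vec Sigma i.
Let A := n%:R^-1 *: (D^T *m D).
Let g := n%:R^-1 *: (D^T *m (col i D - D *m b)).
Let sL := Num.sqrt Lmin.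
Let re := re_inv s s 3 Sigma.
Let K2 := K ^+ 2.
Hypothesis psdS : psdmx Sigma.
Hypothesis uS : Sigma \in unitmx.
Hypothesis diag1 : forall j, Sigma j j = 1.
Hypothesis C2big : 4 * Num.sqrt (5 / 3) < C2.
Hypothesis np : (n <= p)%N.
Hypothesis pexp : p%:R < expR (n%:R / (4 * C2 ^+ 2)).
Hypothesis sig0 : 0 <= sig.
Hypothesis s1 : (1 < s)%N.
Hypothesis sp : (2 * s < p)%N.
Hypothesis hS : (#|neighbours Sigma i| <= s)%N.
Hypothesis re0 : 0 < re_inv s s 3 Sigma.
Hypothesis Lmin0 : 0 < 17 / 16 * Lambda_min Sigma s.
Hypothesis eta01 : 0 < eta < 1.
Hypothesis hM1 : 4 * K / eta <= M.
Hypothesis hM2 : M <= Num.sqrt Lmin / ((1 - eta) * c0 R * sig) *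
          Num.sqrt (n%:R / (2 * ln p%:R)).
Hypothesis hs : s%:R <= 1 / (32 * K0 ^+ 2) *
             Num.min (1 / C2) (Num.sqrt Lmin * (1 - eta) / (6 * Num.sqrt 6 * sig)) *
             Num.sqrt (n%:R / ln p%:R).
Hypothesis hbmin : forall j, j != i -> reg_coef Sigma i j != 0 ->
     Num.max (2 * Num.sqrt s%:R / ((1 - eta) * Num.sqrt Lmin)) (M / Num.sqrt 3) *
       16 * K ^+ 2 * lam * Num.sqrt s%:R < `|reg_coef Sigma i j|.
Hypothesis lasso : is_lasso D i lam binit.
Hypothesis ada : is_adaptive_lasso D i binit lamn bhat.
Hypothesis hpen : let sb := sbar i lam binit in
     (0 < sb)%N ->
     let q := lamn / (c0 R * sig * lam * Num.sqrt sb%:R) *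
              Num.sqrt (n%:R / (2 * ln (p - s)%:R)) in
     64 * K ^+ 2 / eta <= q /\ q <= 16 * M * K.
Hypothesis gram : gram_close C2 Sigma D.
Hypothesis noise : noise_small Sigma sig i D.
Hypothesis proj : forall j, j \notin S -> j != i -> exists theta : 'cV[R]_p,
  [/\ (forall k, k \notin S -> theta k 0 = 0),
      `|dotc (delta_mx j 0 - theta) g| <= 5 * sig * r &
      forall k, k \in S -> `|(A *m (delta_mx j 0 - theta)) k 0| <= C2 * r].

Let symS : Sigma^T = Sigma. Proof. by case: psdS. Qed.
Let posS (v : 'cV[R]_p) : v != 0 -> 0 < quad Sigma v.
Proof. exact: (quad_gt0 psdS re0 uS). Qed.

Let n0 : 0 < n%:R :> R. Proof. by rewrite ltr0n (sample_size_gt0 C2big np pexp s1 sp). Qed.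
Let lnp0 : 0 < ln p%:R :> R. Proof. exact: (ln_p_gt0 C2big np pexp s1 sp). Qed.
Let r0 : 0 < r. Proof. exact: (rate_gt0 C2big np pexp s1 sp). Qed.
Let C20 : 0 < C2. Proof. exact: C2_gt0 C2big. Qed.
Let e0 : 0 < eta. Proof. by case/andP: eta01. Qed.
Let e1 : 0 < 1 - eta. Proof. by rewrite subr_gt0; case/andP: eta01. Qed.
Let L0 : 0 < Lmin. Proof. by move: Lmin0; rewrite pmulr_rgt0. Qed.
Let sL0 : 0 < sL. Proof. by rewrite sqrtr_gt0. Qed.
Let sL2 : sL ^+ 2 = Lmin. Proof. by rewrite sqr_sqrtr// ltW. Qed.
Let c00 : 0 < c0 R. Proof. by rewrite sqrtr_gt0 divr_gt0. Qed.
Let c02 : c0 R ^+ 2 = 3 / 2. Proof. by rewrite sqr_sqrtr// divr_ge0. Qed.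
Let re1 : re <= 1. Proof. exact: (re_inv_le1 psdS diag1 s1 sp re0). Qed.
Let K00 : 0 < K0. Proof. by rewrite invr_gt0. Qed.
Let K_gt0 : 0 < K. Proof. by rewrite mulr_gt0 ?sqrtr_gt0. Qed.
Let K2E : K2 = 2 * K0 ^+ 2. Proof. by rewrite /K2 exprMn sqr_sqrtr. Qed.
Let K2re : K2 * re ^+ 2 = 2.
Proof. by rewrite K2E /K0 /re_K exprVn -mulrA mulVf ?mulr1// expf_neq0// gt_eqF. Qed.
Let K2_gt0 : 0 < K2. Proof. exact: exprn_gt0. Qed.
Let K2_ge2 : 2 <= K2.
Proof.
have h : re ^+ 2 <= 1 by rewrite expr_le1// ltW.
by rewrite -K2re -[leRHS]mulr1 ler_wpM2l// ltW.
Qed.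
Let reL : re ^+ 2 <= 17 / 16 * Lmin.
Proof. exact: (re_inv_sq_le_Lambda psdS s1 sp re0). Qed.
Let K2L : 1 <= K2 * sL ^+ 2.
Proof. rewrite sL2; have := ler_wpM2l (ltW K2_gt0) reL; rewrite K2re; lra. Qed.
Let sL1 : sL <= 1.
Proof.
rewrite -sqrtr1 ler_wsqrtr//; have := Lambda_min_le1 psdS diag1 s1 sp re0.
by rewrite -/Lmin; lra.
Qed.

Let M_gt0 : 0 < M.
Proof. by apply: lt_le_trans hM1; rewrite divr_gt0// mulr_gt0. Qed.

Let sig_gt0 : 0 < sig.
Proof.
rewrite lt_neqAle sig0 andbT eq_sym; apply/eqP => sz.
by have := lt_le_trans M_gt0 hM2; rewrite sz mulr0 invr0 mulr0 mul0r ltxx.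
Qed.

Let lamE : lam = 6 * sig * r.
Proof.
rewrite /lam /lambda_init -/r /c0 -sqrtrM//.
have -> : 24 * (3 / 2) = 6 ^+ 2 :> R by rewrite -natrX; field.
by rewrite sqrtr_sqr ger0_norm.
Qed.
Let lam_gt0 : 0 < lam. Proof. by rewrite lamE !mulr_gt0. Qed.

Let noiseE : c0 R * sig * Num.sqrt (6 * ln p%:R / n%:R) = lam / 2.
Proof.
by rewrite -[6 * _ / _]mulrA noise_level -/r lamE; field.
Qed.

Let iS : i \notin S. Proof. by rewrite inE eqxx. Qed.
Let bS j : j \notin S -> b j 0 = 0.
Proof.
rewrite inE negb_and !negbK mxE => /orP[->//|/eqP h].
by case: ifP => // _; rewrite /reg_coef h mul0r oppr0.
Qed.
Let bE j : j \in S -> b j 0 = reg_coef Sigma i j /\ reg_coef Sigma i j != 0.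
Proof.
rewrite inE => /andP[ji h]; rewrite mxE (negbTE ji); split => //.
by rewrite /reg_coef oppr_eq0 mulf_neq0// invr_eq0 gt_eqF// precision_diag_gt0.
Qed.

Let gE : g = n%:R^-1 *: (D^T *m residual Sigma D i).
Proof. by rewrite residualE. Qed.
Let gsmall j : j != i -> `|g j 0| <= lam / 2.
Proof. by move=> /noise; rewrite -gE noiseE. Qed.

Let h := binit - b.
Let binitE : binit = b + h. Proof. by rewrite addrC subrK. Qed.
Let hi : h i 0 = 0.
Proof. by case: lasso => bi _; rewrite /h !mxE bi eqxx subrr. Qed.

Let cone : quad A h + lam * norm1 (~: S) h <= 3 * lam * norm1 S h.
Proof.
apply: (@lasso_cone _ _ A S b h g lam lam_gt0 bS).
  move=> j hj; apply: gsmall; apply: contraNneq hj => ->; exact/eqP.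
case: lasso => bi /(_ b) hopt.
have : b i 0 = 0 by rewrite bS.
by move=> /hopt /=; rewrite binitE quad_loss_expand -/A -/g; lra.
Qed.

Let psdA v : 0 <= quad A v. Proof. exact: quad_scaled_gram_ge0. Qed.

Let cone3 : norm1 (~: S) h <= 3 * norm1 S h.
Proof.
have := cone; have := psdA h => q0 q1.
rewrite -(ler_pM2l lam_gt0); lra.
Qed.

Let quadA_ge v : quad Sigma v - C2 * r * norm1 [set: 'I_p] v ^+ 2 <= quad A v.
Proof.
have hD j k : `|(A - Sigma) j k| <= C2 * r by apply: ltW; exact: gram.
have := quad_entrywise v hD; rewrite ler_norml => /andP[h1 _].
have -> : quad A v = quad (A - Sigma) v + quad Sigma v.
  by rewrite -[in LHS](subrK Sigma A) /quad mulmxDr mulmxDl mxE.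
lra.
Qed.

Let cK0 : 0 <= 1 / (32 * K0 ^+ 2).
Proof. by apply: divr_ge0 => //; apply: mulr_ge0 => //; exact: sqr_ge0. Qed.

(* The first bound on s: entrywise errors C2 r of the Gram matrix change the
   quadratic form on the cone, where the l1 norm is at most 4 m norm2, by at most
   half of the restricted eigenvalue. *)
Let hs1 : 16 * (C2 * r) * s%:R * K2 <= 1.
Proof.
have y0 : Num.sqrt (n%:R / ln p%:R) = r^-1 :> R.
  by rewrite /r -sqrtrV ?invf_div// divr_ge0// ltW.
have h1 : s%:R <= 1 / (32 * K0 ^+ 2) * (1 / C2) * r^-1.
  apply: (le_trans hs); rewrite y0 ler_wpM2r ?invr_ge0 ?(ltW r0)//.
  by apply: ler_wpM2l => //; rewrite ge_min lexx.
have c : 0 <= 16 * (C2 * r) * K2 by rewrite !mulr_ge0// ltW.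
have := ler_wpM2l c h1; rewrite K2E.
have -> : 16 * (C2 * r) * (2 * K0 ^+ 2) * (1 / (32 * K0 ^+ 2) * (1 / C2) / r) = 1.
  by field; rewrite !gt_eqF.
lra.
Qed.

(* 39 <= 16 sqrt 6 *)
Let hs2 : 39 * K2 * lam * s%:R <= sL * (1 - eta).
Proof.
have y0 : Num.sqrt (n%:R / ln p%:R) = r^-1 :> R.
  by rewrite /r -sqrtrV ?invf_div// divr_ge0// ltW.
have h1 : s%:R <= 1 / (32 * K0 ^+ 2) * (sL * (1 - eta) / (6 * Num.sqrt 6 * sig)) * r^-1.
  apply: (le_trans hs); rewrite y0 ler_wpM2r ?invr_ge0 ?(ltW r0)//.
  by apply: ler_wpM2l => //; rewrite ge_min lexx orbT.
have s60 : 0 < Num.sqrt 6 :> R by rewrite sqrtr_gt0.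
have s6 : 39 / 16 <= Num.sqrt 6 :> R.
  rewrite -(@ler_pXn2r _ 2)// ?nnegrE ?sqrtr_ge0 ?divr_ge0// sqr_sqrtr//; lra.
have c : 0 <= 16 * Num.sqrt 6 * K2 * lam by rewrite !mulr_ge0// ltW.
have := ler_wpM2l c h1; rewrite K2E lamE.
have -> : 16 * Num.sqrt 6 * (2 * K0 ^+ 2) * (6 * sig * r) *
   (1 / (32 * K0 ^+ 2) * (sL * (1 - eta) / (6 * Num.sqrt 6 * sig)) / r) = sL * (1 - eta).
  by field; rewrite !gt_eqF.
apply: le_trans.
have c' : 0 <= (2 * K0 ^+ 2) * (6 * sig * r) * s%:R by rewrite !mulr_ge0 ?sqr_ge0// ltW.
have := ler_wpM2r c' s6; lra.
Qed.

Let m := Num.sqrt #|S|%:R : R.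
Let m2 : m ^+ 2 = #|S|%:R. Proof. by rewrite sqr_sqrtr. Qed.
Let ms : m ^+ 2 <= s%:R. Proof. by rewrite m2 ler_nat. Qed.

(* 17/16 Lmin loses at most 1/32 of 17/16 Lmin *)
Let AL (v : 'cV[R]_p) : (forall j, j \notin S -> v j 0 = 0) ->
  Lmin * norm2 S v ^+ 2 <= quad A v.
Proof.
move=> supp; apply: le_trans (quadA_ge v).
have h1 := Lambda_min_le psdS hS supp.
have h2 : norm1 [set: 'I_p] v ^+ 2 <= s%:R * norm2 S v ^+ 2.
  rewrite (norm1_setID S) norm1_supp// addr0.
  have := norm1_le_norm2 S v; rewrite -/m => hle.
  apply: (@le_trans _ _ ((m * norm2 S v) ^+ 2)).
    by rewrite ler_pXn2r ?nnegrE ?norm1_ge0 ?mulr_ge0 ?sqrtr_ge0.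
  by rewrite exprMn ler_wpM2r ?sqr_ge0.
have cr : 0 <= C2 * r by rewrite mulr_ge0 ?(ltW C20) ?(ltW r0).
have h3 := ler_wpM2l cr h2.
have h4 : 32 * (C2 * r * s%:R) <= 17 / 16 * Lmin.
  apply: le_trans reL.
  have r2 : 0 <= re ^+ 2 by exact: sqr_ge0.
  have := ler_wpM2r r2 hs1; rewrite -[_ * K2 * _]mulrA K2re; lra.
have h5 := ler_wpM2r (sqr_ge0 (norm2 S v)) h4.
have h6 : 0 <= Lmin * norm2 S v ^+ 2 by rewrite mulr_ge0 ?(ltW L0) ?sqr_ge0.
move: h1; rewrite -/Lmin; lra.
Qed.

Let Jex : exists J, largest_outside S s h J.
Proof.
apply: largest_outside_exists; rewrite -(leq_add2l #|S|) cardsC card_ord.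
by rewrite (leq_trans (leq_add hS (leqnn s)))// addnn -mul2n ltnW.
Qed.

Let init_error : (forall j, `|h j 0| <= 3 * K2 * lam * m) /\
  norm1 (~: S) h <= 9 / 4 * K2 * lam * #|S|%:R.
Proof.
have [J hJ] := Jex.
apply: (@lasso_error _ _ A S h lam lam_gt0 J s K2) => //; first exact: ltnW.
set x := norm2 (S :|: J) h.
have h1 := re_inv_le psdS re0 hS cone3 hJ; rewrite -/S -/re -/x in h1.
have h2 := quadA_ge h.
have nS : norm1 [set: 'I_p] h <= 4 * (m * x).
  rewrite (norm1_setID S); have h3 := norm1_le_norm2 S h.
  have h4 : norm2 S h <= x by apply: norm2_subset; exact: finset.subsetUl.
  have h5 : m * norm2 S h <= m * x by rewrite ler_wpM2l// sqrtr_ge0.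
  have := cone3; rewrite -/m in h3; lra.
have h3 : norm1 [set: 'I_p] h ^+ 2 <= 16 * (s%:R * x ^+ 2).
  apply: (@le_trans _ _ ((4 * (m * x)) ^+ 2)).
    by rewrite ler_pXn2r ?nnegrE ?norm1_ge0// !mulr_ge0 ?sqrtr_ge0 ?norm2_ge0.
  rewrite !exprMn (_ : 4 ^+ 2 = 16 :> R); last by rewrite -natrX.
  by rewrite ler_wpM2l// ler_wpM2r ?sqr_ge0.
have cr : 0 <= K2 * (C2 * r) := mulr_ge0 (ltW K2_gt0) (mulr_ge0 (ltW C20) (ltW r0)).
have h4 := ler_wpM2l cr h3.
have h5 := ler_wpM2r (sqr_ge0 x) hs1.
have h6 := ler_wpM2l (ltW K2_gt0) h1; rewrite mulrA K2re in h6.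
have h7 := ler_wpM2l (ltW K2_gt0) h2.
lra.
Qed.

(* For an isolated node the l1 error of the initial Lasso vanishes. *)
Let empty_case : #|S| = 0%N -> forall j, j != i -> bhat j 0 = 0.
Proof.
move=> S0 j ji; have [_ hc] := init_error.
rewrite S0 mulr0 in hc.
have hz k : h k 0 = 0.
  apply/eqP; rewrite -normr_eq0 eq_le normr_ge0 andbT.
  apply: le_trans hc; rewrite /norm1 (bigD1 k) /=; last first.
    by rewrite inE (cards0_eq S0) inE.
  by rewrite lerDl sumr_ge0.
have [[_ hdom] _] := ada; apply: hdom => //.
by rewrite binitE mxE hz addr0 bS// (cards0_eq S0) inE.
Qed.

Let B := Num.max (2 * Num.sqrt s%:R / ((1 - eta) * sL)) (M / Num.sqrt 3) *
       16 * K2 * lam * Num.sqrt s%:R.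
Let ss := Num.sqrt s%:R : R.
Let ss2 : ss ^+ 2 = s%:R. Proof. by rewrite sqr_sqrtr. Qed.
Let ss_gt0 : 0 < ss. Proof. by rewrite sqrtr_gt0 ltr0n ltnW. Qed.

Let c16 : 0 <= 16 * K2 * lam * ss.
Proof. exact: (mulr_ge0 (mulr_ge0 (mulr_ge0 (ler0n _ 16) (ltW K2_gt0)) (ltW lam_gt0)) (ltW ss_gt0)). Qed.

Let BE : B = Num.max (2 * ss / ((1 - eta) * sL)) (M / Num.sqrt 3) * (16 * K2 * lam * ss).
Proof. by rewrite /B -/ss !mulrA. Qed.

Let HB1 : 32 * K2 * lam * s%:R <= B * (1 - eta) * sL.
Proof.
have h1 : 2 * ss / ((1 - eta) * sL) * (16 * K2 * lam * ss) <= B.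
  by rewrite BE; apply: ler_wpM2r c16 _ _ _; rewrite le_max lexx.
have esL : 0 <= (1 - eta) * sL by rewrite mulr_ge0// ltW.
have := ler_wpM2r esL h1; rewrite -[B * _ * _]mulrA; apply: le_trans.
rewrite -ss2 le_eqVlt; apply/orP; left; apply/eqP; field.
by rewrite !gt_eqF.
Qed.

Let HB2 : M / Num.sqrt 3 * 16 * K2 * lam * ss <= B.
Proof.
have -> : M / Num.sqrt 3 * 16 * K2 * lam * ss = M / Num.sqrt 3 * (16 * K2 * lam * ss).
  by rewrite !mulrA.
by rewrite BE; apply: ler_wpM2r c16 _ _ _; rewrite le_max lexx orbT.
Qed.

Let bmin j : j \in S -> B < `|b j 0|.
Proof.
move=> jS; have [-> nz] := bE jS; apply: hbmin => //.
by apply: contraNneq iS => <-.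
Qed.

Let nonempty_case : (0 < #|S|)%N -> forall j, (bhat j 0 != 0) = (j \in S).
Proof.
move=> S0.
have [herr hN1] := init_error.
have m1 : 1 <= m by rewrite -sqrtr1 ler_wsqrtr// ler1n.
have m_gt0 : 0 < m := lt_le_trans ltr01 m1.
have m_ss : m <= ss by rewrite ler_wsqrtr// ler_nat.
have esL : (1 - eta) * sL <= 1 by have := sL1; have := e0; have := sL0; have := e1; nra.
have Kl : 0 < K2 * lam by rewrite mulr_gt0.
have B_ge : 32 * K2 * lam * s%:R <= B.
  have B0 : 0 <= B.
    have : 0 <= B * ((1 - eta) * sL).
      by rewrite mulrA; apply: le_trans HB1; rewrite !mulr_ge0// ltW.
    by rewrite pmulr_lge0// mulr_gt0.
  have := ler_wpM2l B0 esL; have := HB1; lra.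
have bmin2 j : j \in S -> 4 * lam + 3 * K2 * lam * m < `|b j 0|.
  move=> jS; apply: le_lt_trans (bmin jS); apply: le_trans B_ge.
  have h1 : 2 * lam <= K2 * lam by rewrite ler_pM2r.
  have h2 : m <= s%:R.
    apply: (le_trans _ ms); by rewrite expr2 -[leLHS]mulr1 ler_pM2l.
  have h3 : 1 <= s%:R :> R by rewrite ler1n ltnW.
  have h4 : K2 * lam * m <= K2 * lam * s%:R by rewrite ler_pM2l.
  have h5 : K2 * lam * 1 <= K2 * lam * s%:R by rewrite ler_pM2l.
  lra.
have [sb1 sb2] := @sbar_bounds _ _ S b h lam lam_gt0 bS i K2 _ iS herr bmin2 hN1.
rewrite -binitE in sb1 sb2.
set sb := sbar i lam binit in sb1 sb2.
have sb0 : (0 < sb)%N by exact: leq_trans S0 sb1.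
have [q1 q2] := hpen sb0.
set y := Num.sqrt (n%:R / (2 * ln (p - s)%:R)) in q1 q2.
set t := Num.sqrt (sbar i lam binit)%:R in q1 q2.
set q := lamn / _ * y in q1 q2.
have t0 : 0 < t by rewrite sqrtr_gt0 ltr0n.
have t2 : t ^+ 2 = sb%:R by rewrite sqr_sqrtr.
have lnc := ln_complement_ge C2big np pexp s1 sp.
have lnc2 := ln_complement_le C2big np pexp s1 sp.
have lnq0 : 0 < ln (p - s)%:R :> R by apply: lt_le_trans lnc; rewrite mulr_gt0.
have y_gt0 : 0 < y by rewrite sqrtr_gt0 divr_gt0// mulr_gt0.
have y2 : y ^+ 2 = n%:R / (2 * ln (p - s)%:R) by rewrite sqr_sqrtr// divr_ge0// mulr_ge0// ltW.
pose ell := c0 R * sig / y.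
have ell_gt0 : 0 < ell by rewrite divr_gt0// mulr_gt0.
have ell2 : ell ^+ 2 = 3 * sig ^+ 2 * (ln (p - s)%:R / n%:R).
  by rewrite /ell !exprMn c02 exprVn y2 invf_div; field; rewrite gt_eqF.
have r2 : r ^+ 2 = ln p%:R / n%:R := rate_sqr C2big np pexp s1 sp.
have lnr1 : 3 / 4 * r ^+ 2 <= ln (p - s)%:R / n%:R by rewrite r2 mulrA ler_pM2r ?invr_gt0.
have lnr2 : ln (p - s)%:R / n%:R <= r ^+ 2 by rewrite r2 ler_pM2r ?invr_gt0.
have sig2 : 0 < sig ^+ 2 by rewrite exprn_gt0.
(* 3/4 log p <= log (p - s) <= log p becomes
   lam^2 / 16 <= ell^2 <= lam^2 / 12 *)
have ell_lo : lam / 4 <= ell.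
  have l4 : 0 <= lam / 4 by rewrite divr_ge0// ltW.
  rewrite -(@ler_pXn2r _ 2)// ?nnegrE ?l4 ?(ltW ell_gt0)//.
  rewrite ell2 lamE; have := ler_wpM2l (ltW sig2) lnr1; lra.
have r3_gt0 : 0 < Num.sqrt 3 :> R by rewrite sqrtr_gt0.
have ell_hi : Num.sqrt 3 * ell <= lam / 2.
  have l2 : 0 <= lam / 2 by rewrite divr_ge0// ltW.
  have r3e : 0 <= Num.sqrt 3 * ell := mulr_ge0 (ltW r3_gt0) (ltW ell_gt0).
  rewrite -(@ler_pXn2r _ 2)// ?nnegrE ?l2 ?r3e//.
  rewrite [leLHS]exprMn sqr_sqrtr// ell2 lamE; have := ler_wpM2l (ltW sig2) lnr2; lra.
have Mell : M * ell * (1 - eta) <= sL.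
  have yp : Num.sqrt (n%:R / (2 * ln p%:R)) <= y.
    rewrite ler_wsqrtr// ler_pM2l// lef_pV2 ?posrE ?mulr_gt0//.
    by rewrite ler_pM2l.
  have cc : 0 <= sL / ((1 - eta) * c0 R * sig) by rewrite divr_ge0 ?mulr_ge0// ltW.
  have h1 : M <= sL / ((1 - eta) * c0 R * sig) * y.
    by apply: (le_trans hM2); exact: ler_wpM2l.
  have ce : 0 <= ell * (1 - eta) by rewrite mulr_ge0// ltW.
  have := ler_wpM2r ce h1; rewrite mulrA => /le_trans; apply.
  by rewrite /ell le_eqVlt; apply/orP; left; apply/eqP; field; rewrite !gt_eqF.
have lamnE : lamn = q * ell * lam * t.
  by rewrite /q /ell; field; rewrite !gt_eqF.
have mt : m ^+ 2 <= t ^+ 2 by rewrite m2 t2 ler_nat.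
have tm : t ^+ 2 <= (1 + 9 / 16 * K ^+ 2) * m ^+ 2 by rewrite m2 t2.
have [H2 H3 H4] := penalty_level_bounds K2_ge2 K_gt0 lam_gt0 m_gt0 m_ss t0 M_gt0 eta01
   r3_gt0 sL0 mt tm q1 q2 ell_lo ell_hi Mell HB2 lamnE.
apply: (@adaptive_recovery _ n p D i S b binit bhat lam lamn K2 sL eta B) => //.
- move=> j; have := gram j j; rewrite -/A -/r [(A - Sigma) j j]mxE [(- Sigma) j j]mxE diag1.
  have := C2_rate_lt C2big np pexp s1 sp; rewrite -/r.
  by rewrite ltr_norml => h1 /andP[_ h2]; lra.
- by move=> v supp; rewrite sL2; exact: AL.
- by move=> j; have := herr j; rewrite /h !mxE.
- move=> j th jS ji thS orth.
  have [th0 [th0S hrho hAr]] := proj jS ji.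
  (* th is the sample projection and th0 the population one; their difference e
     is small since A e agrees on S with the small covariances of the population
     residual *)
  pose e := th - th0.
  have eS k : k \notin S -> e k 0 = 0 by move=> kS; rewrite /e !mxE thS// th0S// subrr.
  have Ae k : k \in S -> (A *m e) k 0 = (A *m (delta_mx j 0 - th0)) k 0.
    move=> kS; have -> : e = (delta_mx j 0 - th0) - (delta_mx j 0 - th).
      by apply/matrixP => u v; rewrite !mxE; ring.
    by rewrite mulmxBr [LHS]mxE [X in _ + X]mxE orth// subr0.
  have cr : 0 <= C2 * r by rewrite mulr_ge0 ?(ltW C20) ?(ltW r0).
  have q3 : quad A e <= C2 * r * (m * norm2 S e).
    rewrite quadE bil_dotc (le_trans (ler_norm _))//; apply: dotc_le_norm2 => // k kS.
    by rewrite Ae// hAr.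
  have q4 := le_trans (AL eS) q3.
  have ne : norm2 S e <= K2 * (C2 * r) * m.
    have [->|xn0] := eqVneq (norm2 S e) 0.
      by rewrite mulr_ge0 ?sqrtr_ge0// mulr_ge0// ltW.
    have xp : 0 < norm2 S e by rewrite lt_neqAle eq_sym xn0 norm2_ge0.
    have h1 : Lmin * norm2 S e <= C2 * r * m.
      by rewrite -(ler_pM2r xp); move: q4; rewrite expr2 !mulrA.
    have h2 := ler_wpM2l (ltW K2_gt0) h1.
    have h3 := ler_wpM2r (ltW xp) K2L; rewrite sL2 in h3.
    lra.
  have q5 : `|dotc e g| <= lam / 2 * (m * norm2 S e).
    apply: dotc_le_norm2 => //; last by rewrite divr_ge0// ltW.
    by move=> k kS; apply: gsmall; apply: contraNneq iS => <-.
  have q6 : m * norm2 S e <= 1 / 16.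
    have h1 := ler_wpM2l (ltW m_gt0) ne.
    have kc : 0 <= K2 * (C2 * r) by rewrite mulr_ge0// ltW.
    have h2 := ler_wpM2l kc ms.
    have := hs1; lra.
  have -> : delta_mx j 0 - th = (delta_mx j 0 - th0) - e.
    by apply/matrixP => u v; rewrite !mxE; ring.
  rewrite dotcBl (le_trans (ler_normB _ _))//.
  have l2 : 0 <= lam / 2 by rewrite divr_ge0// ltW.
  have := ler_wpM2l l2 q6; move: hrho q5 lamE; rewrite -/g; have := lam_gt0.
  have sr : 0 < sig * r by rewrite mulr_gt0.
  lra.
- have : 32 * K2 * lam * m ^+ 2 <= 32 * K2 * lam * s%:R.
    by rewrite ler_wpM2l// !mulr_ge0// ltW.
  by move=> /le_trans; apply; exact: HB1.
- apply: le_trans hs2; by rewrite ler_wpM2l// !mulr_ge0// ltW.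
Qed.

Lemma node_recovery j : j != i -> (bhat j 0 != 0) = (invmx Sigma i j != 0).
Proof.
move=> ji; have e : (j \in S) = (invmx Sigma i j != 0) by rewrite inE ji.
rewrite -e; have [S0|S0] := posnP #|S|; last exact: nonempty_case.
by rewrite empty_case// eqxx (cards0_eq S0) inE.
Qed.

End node_recovery.

(** * Estimation of the graph *)

Lemma finite_union_bound d (T : measurableType d) (R : realType) (P : probability T R)
    (I : finType) (F : I -> set T) (c : R) :
  (forall i, measurable (F i)) -> (forall i, (P (F i) <= c%:E)%E) ->
  measurable (\big[setU/set0]_i F i) /\
  (P (\big[setU/set0]_i F i) <= (#|I|%:R * c)%:E)%E.
Proof.
move=> mF hF; have -> : #|I| = size (index_enum I) by rewrite [index_enum _]unlock -enumT -cardT.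
elim: (index_enum I) => [|i s [IH1 IH2]].
  by rewrite big_nil measure0 mul0r; split.
rewrite big_cons; split; first exact: measurableU.
apply: (le_trans (measureU2 P (mF i) IH1)).
by rewrite /= -natr1 mulrDl mul1r addrC EFinD leeD.
Qed.

Lemma mem_bigsetU (T : Type) (I : finType) (F : I -> set T) (i : I) (w : T) :
  F i w -> (\big[setU/set0]_i F i) w.
Proof. by move=> h; rewrite (bigD1 i)//=; left. Qed.

Section empcov_matrix.
Context d (T : measurableType d) (R : realType) (P : probability T R) (n p : nat).
Variable X : 'I_n -> 'I_p -> {RV P >-> R}.
Local Notation cov := (empcov (fun k j => X k j : T -> R)).

Lemma data_mx_mulE (a : 'cV[R]_p) (w : T) k :
  (data_mx X w *m a) k 0 = lincomb (fun j => X k j : T -> R) a w.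
Proof. by rewrite mxE; apply: eq_bigr => j _; rewrite mxE mulrC. Qed.

Lemma empcov_dotc (a b : 'cV[R]_p) (w : T) :
  cov a b w = dotc a (n%:R^-1 *: ((data_mx X w)^T *m (data_mx X w *m b))).
Proof.
rewrite dotcE -scalemxAr [RHS]mxE (mulmxA a^T) -trmx_mul [in RHS]mxE; congr (_ * _).
by apply: eq_bigr => k _; rewrite [(data_mx X w *m a)^T _ _]mxE !data_mx_mulE.
Qed.

Lemma empcovZl (c : R) a b w : cov (c *: a) b w = c * cov a b w.
Proof. by rewrite !empcov_dotc dotcZl. Qed.

Lemma empcovZr (c : R) a b w : cov a (c *: b) w = c * cov a b w.
Proof.
rewrite /empcov mulrCA; congr (_ * _); rewrite mulr_sumr.
by apply: eq_bigr => k _; rewrite lincombZ mulrCA.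
Qed.

Lemma dotc_delta (j : 'I_p) (v : 'cV[R]_p) : dotc (delta_mx j 0) v = v j 0.
Proof.
rewrite /dotc (bigD1 j)//= big1 => [|k kj].
  by rewrite mxE !eqxx mul1r addr0.
by rewrite mxE (negbTE kj) mul0r.
Qed.

Lemma empcov_delta (j : 'I_p) (b : 'cV[R]_p) w :
  cov (delta_mx j 0) b w = (n%:R^-1 *: ((data_mx X w)^T *m data_mx X w) *m b) j 0.
Proof. by rewrite empcov_dotc dotc_delta -scalemxAl mulmxA. Qed.

Lemma empcov_delta2 (j k : 'I_p) w :
  cov (delta_mx j 0) (delta_mx k 0) w = (n%:R^-1 *: ((data_mx X w)^T *m data_mx X w)) j k.
Proof. by rewrite empcov_delta -colE mxE. Qed.

Lemma measurable_estimated_supp (bhat : 'I_p -> T -> 'cV[R]_p) (rule : edge_rule)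
    (E : {set 'I_p * 'I_p}) :
  (forall i j, measurable_fun [set: T] (fun w => bhat i w j 0)) ->
  measurable [set w | estimated_supp rule (fun i => bhat i w) = E].
Proof.
move=> mb.
have mA i j : measurable [set w | bhat i w j 0 != 0].
  rewrite (_ : [set _ | _] = ~` ((fun w => bhat i w j 0) @^-1` [set 0])).
    by apply: measurableC; rewrite -[X in measurable X]setTI; exact: mb.
  by apply/seteqP; split => w /= /eqP.
pose G e := [set w | (e \in estimated_supp rule (fun i => bhat i w)) = (e \in E)].
have -> : [set w | estimated_supp rule (fun i => bhat i w) = E] = \bigcap_(e in [set: 'I_p * 'I_p]) G e.
  apply/seteqP; split => w /=; first by move=> h e _; rewrite /G /= h.
  by move=> h; apply/setP => e; exact: h.
apply: fin_bigcap_measurable => // e _; rewrite /G.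
have mbool (Q : T -> bool) (c : bool) : measurable [set w | Q w] -> measurable [set w | Q w = c].
  move=> mQ; case: c => //.
  rewrite (_ : [set _ | _] = ~` [set w | Q w]); first exact: measurableC.
  by apply/seteqP; split => w /=; [move=> ->|move/negP/negbTE].
apply: mbool; clear G; case: e => i j.
have [ij|ij] := eqVneq i j.
  rewrite (_ : [set _ | _] = set0)//.
  by apply/seteqP; split => w //=; rewrite inE /= ij eqxx.
case: rule => /=.
- rewrite (_ : [set _ | _] = [set w | bhat i w j 0 != 0] `&` [set w | bhat j w i 0 != 0]).
    exact: measurableI.
  by apply/seteqP; split => w /=; rewrite inE /= ij /= => /andP.
- rewrite (_ : [set _ | _] = [set w | bhat i w j 0 != 0] `|` [set w | bhat j w i 0 != 0]).
    exact: measurableU.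
  by apply/seteqP; split => w /=; rewrite inE /= ij /= => /orP.
Qed.

End empcov_matrix.

Theorem theorem6p1 (d : measure_display) (T : measurableType d) (R : realType)
    (P : probability T R) (n p s : nat) (C2 eta M : R)
    (Sigma : 'M[R]_p) (X : 'I_n -> 'I_p -> {RV P >-> R})
    (sigma : 'I_p -> R)
    (beta_init : 'I_p -> T -> 'cV[R]_p)
    (lambda_n : 'I_p -> T -> R)
    (beta_hat : 'I_p -> T -> 'cV[R]_p)
    (rule : edge_rule) :
  let K0 := re_K s s 3 Sigma in
  let K := Num.sqrt 2 * K0 in
  let Lmin := Lambda_min Sigma s in
  let lam_init := fun i => lambda_init n p (sigma i) in
  (* Gaussian graphical model *)
  psdmx Sigma ->
  Sigma \in unitmx ->
  (forall j, Sigma j j = 1) ->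
  (forall k, gaussian_vector (X k) Sigma) ->
  independent_rows X ->
  4 * Num.sqrt (5 / 3) < C2 ->
  (n <= p)%N ->
  p%:R < expR (n%:R / (4 * C2 ^+ 2)) ->
  (* sigma i ^+ 2 is the variance of the residual V_i *)
  (forall i, 0 <= sigma i) ->
  (forall i k, 'V_P[fun w => residual Sigma (data_mx X w) i k 0]
               = (sigma i ^+ 2)%:E) ->
  (* sparsity *)
  (1 < s)%N ->
  (2 * s < p)%N ->
  (forall i, (#|neighbours Sigma i| <= s)%N) ->
  (* (a) *)
  0 < re_inv s s 3 Sigma ->
  (forall J : {set 'I_p}, J != finset.set0 -> (#|J| <= s)%N ->
     17 / 16 * Lmin <= lambda_min (principal_submx Sigma J)) ->
  0 < 17 / 16 * Lmin ->
  (* (b) *)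
  0 < eta < 1 ->
  (forall i,
     4 * K / eta <= M /\
     M <= Num.sqrt Lmin / ((1 - eta) * c0 R * sigma i) *
          Num.sqrt (n%:R / (2 * ln p%:R))) ->
  (forall i,
     s%:R <= 1 / (32 * K0 ^+ 2) *
             Num.min (1 / C2)
                     (Num.sqrt Lmin * (1 - eta) / (6 * Num.sqrt 6 * sigma i)) *
             Num.sqrt (n%:R / ln p%:R)) ->
  (forall i j, j != i -> reg_coef Sigma i j != 0 ->
     Num.max (2 * Num.sqrt s%:R / ((1 - eta) * Num.sqrt Lmin)) (M / Num.sqrt 3) *
       16 * K ^+ 2 * lam_init i * Num.sqrt s%:R
     < `|reg_coef Sigma i j|) ->
  (* (c) *)
  (forall i w, is_lasso (data_mx X w) i (lam_init i) (beta_init i w)) ->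
  (forall i w, is_adaptive_lasso (data_mx X w) i (beta_init i w) (lambda_n i w)
                 (beta_hat i w)) ->
  (forall i w,
     gram_close C2 Sigma (data_mx X w) ->
     noise_small Sigma (sigma i) i (data_mx X w) ->
     let sb := sbar i (lam_init i) (beta_init i w) in
     (* the quotient below is undefined for sb = 0 *)
     (0 < sb)%N ->
     let q := lambda_n i w / (c0 R * sigma i * lam_init i * Num.sqrt sb%:R) *
              Num.sqrt (n%:R / (2 * ln (p - s)%:R)) in
     64 * K ^+ 2 / eta <= q /\ q <= 16 * M * K) ->
  (* the estimators are random variables *)
  (forall i j, measurable_fun [set: T] (fun w => beta_hat i w j 0)) ->
  ((1 - 3 / p%:R)%:E <=
     P [set w | estimated_supp rule (fun i => beta_hat i w)
                = concentration_supp Sigma])%E.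
Proof.
move=> K0 K Lmin lam_init psdS uS diag1 gX iX C2big np pexp sig0 hvar s1 sp hS re0 ha Lmin0
  eta01 hM hs hbmin hlasso hada hpen mbhat.
have symS : Sigma^T = Sigma by case: psdS.
have posS (v : 'cV[R]_p) : v != 0 -> 0 < quad Sigma v by exact: (quad_gt0 psdS re0 uS).
pose r := Num.sqrt (ln p%:R / n%:R) : R.
have n0 : (0 < n)%N := sample_size_gt0 C2big np pexp s1 sp.
have r0 : 0 < r := rate_gt0 C2big np pexp s1 sp.
have nr2 : n%:R * r ^+ 2 = ln p%:R := n_rate_sqr C2big np pexp s1 sp.
have lnp0 : 0 < ln p%:R :> R := ln_p_gt0 C2big np pexp s1 sp.
have p0 : 0 < p%:R :> R := p_gt0 C2big np pexp s1 sp.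
have r2lt : r ^+ 2 < 3 / 320 := rate_sqr_lt C2big np pexp s1 sp.
have C2r : C2 * r < 1 / 2 := C2_rate_lt C2big np pexp s1 sp.
have C20 : 0 < C2 := C2_gt0 C2big.
have cr0 : 0 <= C2 * r by rewrite mulr_ge0 ?(ltW C20) ?(ltW r0).
have C2sq : 80 / 3 < C2 ^+ 2 := C2_sqr C2big.
pose cov := empcov (fun k j => X k j : T -> R).
(* V_i is the linear combination of X with coefficients a i, and u i is a i
   scaled to unit variance. *)
pose a i : 'cV[R]_p := delta_mx i 0 - reg_vec Sigma i.
have residE w i : residual Sigma (data_mx X w) i = data_mx X w *m a i.
  by rewrite residual_mulE.
have qa_gt0 i : 0 < quad Sigma (a i).
  by rewrite quad_reg_residual// invr_gt0 precision_diag_gt0.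
have qa i : quad Sigma (a i) = sigma i ^+ 2.
  have := hvar i (Ordinal n0).
  rewrite (_ : (fun w => _) = lincomb (fun j => X (Ordinal n0) j : T -> R) (a i)).
    by rewrite (gaussian_variance (gX _) (qa_gt0 i)) => -[].
  by apply/funext => w; rewrite residE data_mx_mulE.
have sig_gt0 i : 0 < sigma i.
  by rewrite lt_neqAle sig0 andbT eq_sym -sqrf_eq0 -qa gt_eqF.
pose u i := (sigma i)^-1 *: a i.
have qu i : quad Sigma (u i) = 1.
  by rewrite quad_scale qa exprVn mulVf// gt_eqF// exprn_gt0.
have aE i : a i = sigma i *: u i by rewrite scalerA divff ?scale1r// gt_eqF.
have qd j : quad Sigma (delta_mx j 0) = 1 by rewrite quad_delta diag1.
have bild j v : bil Sigma (delta_mx j 0) v = (Sigma *m v) j 0 by exact: bil_delta_l.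
have Sa i j : j != i -> (Sigma *m a i) j 0 = 0.
  by move=> ji; rewrite Sigma_reg_residual// (negbTE ji) mul0r.
(* theta i j: coefficients of the population regression of X_j on the neighbours
   of i; rho i j: its residual; v i j: the residual scaled to unit variance. *)
have th_ex i j : exists theta : 'cV[R]_p,
    (forall k, k \notin neighbours Sigma i -> theta k 0 = 0) /\
    (forall k, k \in neighbours Sigma i ->
       (Sigma *m theta) k 0 = (Sigma *m delta_mx j 0 : 'cV[R]_p) k 0).
  by apply: restricted_solve => v _; exact: posS.
pose theta i j := proj1_sig (cid (th_ex i j)).
have thN i j k : k \notin neighbours Sigma i -> theta i j k 0 = 0.
  by rewrite /theta; case: cid => t /= [+ _]; apply.
pose rho i j : 'cV[R]_p := delta_mx j 0 - theta i j.
have Srho i j k : k \in neighbours Sigma i -> (Sigma *m rho i j) k 0 = 0.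
  rewrite /rho /theta; case: cid => t /= [_ ht] kS.
  by rewrite mulmxBr [LHS]mxE [X in _ + X]mxE ht// subrr.
have rho_neq0 i j : j \notin neighbours Sigma i -> rho i j != 0.
  move=> jS; apply/eqP => /matrixP/(_ j 0)/eqP.
  by rewrite !mxE !eqxx thN// subr0 oner_eq0.
have qrho_le i j : quad Sigma (rho i j) <= 1.
  have cross : bil Sigma (theta i j) (rho i j) = 0.
    rewrite bil_sum big1// => k _; have [kS|kS] := boolP (k \in neighbours Sigma i).
      by rewrite Srho// mulr0.
    by rewrite thN// mul0r.
  have := quad_add (rho i j) (theta i j) symS.
  rewrite subrK qd (bilC _ (theta i j))// cross mulr0 addr0 => ->.
  by rewrite lerDl; exact: (proj2 psdS).
pose sv i j := Num.sqrt (quad Sigma (rho i j)).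
have sv_gt0 i j : j \notin neighbours Sigma i -> 0 < sv i j.
  by move=> jS; rewrite sqrtr_gt0 posS// rho_neq0.
have sv_ge0 i j : 0 <= sv i j by exact: sqrtr_ge0.
have sv_le1 i j : sv i j <= 1 by rewrite -sqrtr1 ler_wsqrtr.
pose v i j := (sv i j)^-1 *: rho i j.
have rhoE i j : j \notin neighbours Sigma i -> rho i j = sv i j *: v i j.
  by move=> jS; rewrite scalerA divff ?scale1r// gt_eqF// sv_gt0.
have qv i j : j \notin neighbours Sigma i -> quad Sigma (v i j) = 1.
  move=> jS; rewrite quad_scale -[quad _ _]sqr_sqrtr; last exact: (proj2 psdS).
  by rewrite -/(sv i j) exprVn mulVf// gt_eqF// exprn_gt0// sv_gt0.
(* One failure event for each bound; indices for which no bound is required get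
   the empty event. *)
pose dev b c kappa t := [set w | t <= `|cov b c w - kappa|].
pose F (x : ('I_p * 'I_p) + ('I_p * 'I_p) + ('I_p * 'I_p) + ('I_p * 'I_p * 'I_p)) : set T :=
  match x with
  | inl (inl (inl (j, k))) => dev (delta_mx j 0) (delta_mx k 0) (Sigma j k) (C2 * r)
  | inl (inl (inr (i, j))) => if j != i then dev (delta_mx j 0) (u i) 0 (3 * r) else set0
  | inl (inr (i, j)) =>
      if (j \notin neighbours Sigma i) && (j != i) then dev (v i j) (u i) 0 (5 * r) else set0
  | inr (i, j, k) =>
      if (j \notin neighbours Sigma i) && (k \in neighbours Sigma i)
      then dev (delta_mx k 0) (v i j) 0 (C2 * r) else set0
  end.
have mF x : measurable (F x).
  case: x => [[[[j k]|[i j]]|[i j]]|[[i j] k]] /=; try case: ifP => _ //;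
    exact: measurable_deviation.
pose c : R := 2 * p%:R ^- 4.
have cge0 : 0 <= c by rewrite mulr_ge0// invr_ge0 exprn_ge0.
have C2tail : 4 * ln p%:R <= n%:R * ((C2 * r) ^+ 2 / 6).
  rewrite exprMn -nr2; have := ler_wpM2r (ltW lnp0) (ltW C2sq); rewrite -nr2; lra.
have PF x : (P (F x) <= c%:E)%E.
  case: x => [[[[j k]|[i j]]|[i j]]|[[i j] k]] /=.
  - have := crude_tail n0 symS posS gX iX (qd j) (qd k) cr0 (ltW C2r) p0 C2tail.
    by rewrite bild -colE mxE.
  - case: ifP => ji; last by rewrite measure0 lee_fin.
    have b0 : bil Sigma (delta_mx j 0) (u i) = 0 by rewrite bilZr bild Sa ?mulr0.
    have t0 : 0 <= 3 * r by rewrite mulr_ge0// ltW.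
    have t1 : 3 * r < 1 / 2.
      by rewrite -(@ltr_pXn2r _ 2)// ?nnegrE ?divr_ge0// exprMn; lra.
    have -> : dev (delta_mx j 0) (u i) 0 (3 * r) =
        [set w | 3 * r <= `|cov (delta_mx j 0) (u i) w|].
      by apply/seteqP; split => w; rewrite /dev /= subr0.
    apply: (sharp_tail n0 symS gX iX (qd j) (qu i) b0 t0 t1 p0).
    have -> : (3 * r) ^+ 2 = 9 * r ^+ 2 by ring.
    set x := r ^+ 2 in r2lt nr2 *.
    have x0 : 0 < x by rewrite exprn_gt0.
    have d0 : 0 < 1 - 9 * x by lra.
    (* 9 - 5 = 4 is the exponent needed; this uses x < 3/320 *)
    have h1 : 9 * x / (2 * (1 - 9 * x)) <= 5 * x.
      rewrite ler_pdivrMr; last by lra.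
      nra.
    have nn : 0 <= n%:R :> R by [].
    have := ler_wpM2l nn h1; lra.
  - case: ifP => [/andP[jS ji]|_]; last by rewrite measure0 lee_fin.
    have b0 : bil Sigma (v i j) (u i) = 0.
      rewrite bilZl bilZr bil_sum big1 ?mulr0// => k _.
      have [->|ki] := eqVneq k i; last by rewrite Sa ?mulr0.
      rewrite !mxE thN ?inE ?eqxx//.
      by rewrite eq_sym (negbTE ji) subr0 mul0r.
    have t0 : 0 <= 5 * r by rewrite mulr_ge0// ltW.
    have t1 : 5 * r <= 1 / 2.
      by rewrite -(@ler_pXn2r _ 2)// ?nnegrE ?divr_ge0// exprMn; lra.
    have := crude_tail n0 symS posS gX iX (qv i j jS) (qu i) t0 t1 p0.
    rewrite b0; apply; rewrite exprMn; lra.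
  - case: ifP => [/andP[jS kS]|_]; last by rewrite measure0 lee_fin.
    have b0 : bil Sigma (delta_mx k 0) (v i j) = 0 by rewrite bilZr bild Srho ?mulr0.
    have := crude_tail n0 symS posS gX iX (qd k) (qv i j jS) cr0 (ltW C2r) p0 C2tail.
    by rewrite b0.
set G := [set w | _].
have mG : measurable G by exact: measurable_estimated_supp.
have [mbad Pbad] := finite_union_bound mF PF.
set bad := \big[setU/set0]_x F x in mbad Pbad.
have sub : ~` G `<=` bad.
  apply: subsetCl => w hw; rewrite /G /=.
  have hF x : ~ F x w by move=> Fx; apply: hw; exact: (mem_bigsetU Fx).
  pose D := data_mx X w.
  have gram : gram_close C2 Sigma D.
    move=> j k; rewrite ltNge; apply/negP => h; apply: (hF (inl (inl (inl (j, k))))).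
    rewrite /F /dev /= /cov empcov_delta2; move: h.
    by rewrite [(_ - Sigma) j k]mxE [(- Sigma) j k]mxE.
  have noiseE i : c0 R * sigma i * Num.sqrt (6 * ln p%:R / n%:R) = 3 * sigma i * r.
    by rewrite -[6 * _ / _]mulrA noise_level.
  have noise i : noise_small Sigma (sigma i) i D.
    move=> j ji; rewrite noiseE residE -dotc_delta -empcov_dotc aE empcovZr -/cov.
    rewrite normrM ger0_norm// mulrAC [leRHS]mulrC ler_wpM2l// leNgt; apply/negP => /ltW h.
    apply: (hF (inl (inl (inr (i, j))))); rewrite /F ji /dev /=.
    by rewrite subr0.
  have proj i j : j \notin neighbours Sigma i -> j != i -> exists theta : 'cV[R]_p,
     [/\ (forall k, k \notin neighbours Sigma i -> theta k 0 = 0),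
      `|dotc (delta_mx j 0 - theta) (n%:R^-1 *: (D^T *m (col i D - D *m reg_vec Sigma i)))|
        <= 5 * sigma i * r &
      forall k, k \in neighbours Sigma i ->
        `|(n%:R^-1 *: (D^T *m D) *m (delta_mx j 0 - theta)) k 0| <= C2 * r].
    move=> jS ji; exists (theta i j); split; first exact: thN.
      rewrite -residualE residE -empcov_dotc -/(rho i j) rhoE// aE
        empcovZl empcovZr -/cov normrM [X in _ * X]normrM (ger0_norm (sv_ge0 i j)) (ger0_norm (sig0 i)).
      have h : `|cov (v i j) (u i) w| <= 5 * r.
        rewrite leNgt; apply/negP => /ltW h; apply: (hF (inl (inr (i, j)))).
        by rewrite /F jS ji /dev /= subr0.
      have h2 : sigma i * `|cov (v i j) (u i) w| <= sigma i * (5 * r) by rewrite ler_wpM2l.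
      rewrite (_ : 5 * sigma i * r = 1 * (sigma i * (5 * r))); last by ring.
        exact: ler_pM (sv_ge0 i j) (mulr_ge0 (sig0 i) (normr_ge0 _)) (sv_le1 i j) h2.
    move=> k kS; rewrite -empcov_delta -/(rho i j) rhoE// empcovZr -/cov normrM (ger0_norm (sv_ge0 i j)).
    have h : `|cov (delta_mx k 0) (v i j) w| <= C2 * r.
      rewrite leNgt; apply/negP => /ltW h; apply: (hF (inr (i, j, k))).
      by rewrite /F jS kS /dev /= subr0.
    by rewrite -[leRHS]mul1r; exact: ler_pM (sv_ge0 i j) (normr_ge0 _) (sv_le1 i j) h.
  have rec i j : j != i -> (beta_hat i w j 0 != 0) = (invmx Sigma i j != 0).
    have [hM1 hM2] := hM i.
    exact: (node_recovery psdS uS diag1 C2big np pexp (sig0 i) s1 sp (hS i) re0 Lmin0 eta01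
      hM1 hM2 (hs i) (hbmin i) (hlasso i w) (hada i w) (hpen i w gram (noise i)) gram (noise i)
      (proj i)).
  have symO : (invmx Sigma)^T = invmx Sigma by rewrite trmx_inv symS.
  apply/setP => -[i j]; rewrite !inE /=; have [//|ij] := eqVneq i j.
  rewrite !rec//; last by rewrite eq_sym.
  rewrite (_ : invmx Sigma j i = invmx Sigma i j); last by rewrite -[in LHS]symO mxE.
  by rewrite andbb orbb; case: (rule).
have hG : (P (~` G) <= (3 / p%:R)%:E)%E.
  apply: (le_trans (le_measure _ _ _ sub)); rewrite ?inE//; first exact: measurableC.
  apply: (le_trans Pbad); rewrite lee_fin.
  rewrite !card_sum !card_prod !card_ord !natrD !natrM /c.
  have p16 : 16 <= p%:R :> R by rewrite ler_nat (p_ge16 C2big np pexp s1 sp).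
  (* (3 p^2 + p^3) 2 p^-4 <= 3 / p as soon as p >= 6 *)
  have -> : 3 / p%:R = (3 * p%:R ^+ 3) * p%:R ^- 4 :> R by field; rewrite gt_eqF.
  rewrite mulrA ler_wpM2r ?invr_ge0 ?exprn_ge0//.
  have : 0 <= p%:R ^+ 2 * (p%:R - 6) :> R by rewrite mulr_ge0 ?exprn_ge0//; lra.
  lra.
rewrite -[G]setCK probability_setC; last exact: measurableC.
rewrite EFinB leeB//.
Qed.
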